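(* Let $A$ be a unital $\mathbb K$-algebra and $\Omega_\bullet(A)$ a DGA on top of $A$. Consider the group homomorphisms (defined in the context) $I,R,a,\alpha,\beta,r,\mathrm{Pr},\mathrm{ch}^{\mathrm{Ka}}$, the inclusion $\mathrm{incl}\colon MK(A)\hookrightarrow\widehat K_0(A)$, and $d$ induced by the differential. Then they form a hexagon diagram in which all squares and triangles commute: $$a\circ r=\mathrm{incl}\circ\alpha,\qquad I\circ\mathrm{incl}=\beta,\qquad R\circ a=d,\qquad \mathrm{Pr}\circ R=\mathrm{ch}^{\mathrm{Ka}}\circ I,$$ and in which all of the following sequences are exact: $$0\to MK(A)\xrightarrow{\mathrm{incl}}\widehat K_0(A)\xrightarrow{R}\Omega_{\mathrm{ch}_0}(A)\to0,$$ $$0\to\Omega^{\mathrm{ab}}_{\mathrm{odd}}(A)/\Omega_{\mathrm{ch}_1}(A)\xrightarrow{a}\widehat K_0(A)\xrightarrow{I}K_0(A)\to0,$$ $$H^{\mathrm{dR}}_{\mathrm{odd}}(A)\xrightarrow{\alpha}MK(A)\xrightarrow{\beta}K_0(A)\xrightarrow{\mathrm{ch}^{\mathrm{Ka}}}H^{\mathrm{dR}}_{\mathrm{even}}(A),$$ $$H^{\mathrm{dR}}_{\mathrm{odd}}(A)\xrightarrow{r}\Omega^{\mathrm{ab}}_{\mathrm{odd}}(A)/\Omega_{\mathrm{ch}_1}(A)\xrightarrow{d}\Omega_{\mathrm{ch}_0}(A)\xrightarrow{\mathrm{Pr}}H^{\mathrm{dR}}_{\mathrm{even}}(A).$$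
   Context: $\mathbb K$ is a field containing $\mathbb Q$. Algebras are unital and associative, not necessarily commutative; all modules are finitely generated projective right modules. A DGA on top of $A$ is a non-negatively graded differential graded $\mathbb K$-algebra $(\Omega_\bullet(A),d)$, $d$ of degree $+1$, with $\Omega_0(A)=A$. Its abelianization is the complex $\Omega_n(A)_{\mathrm{ab}}=\Omega_n(A)/[\Omega_\bullet(A),\Omega_\bullet(A)]_n$, where $[\cdot,\cdot]_n$ is the $\mathbb K$-span of $\omega_i\omega_j-(-1)^{ij}\omega_j\omega_i$ with $\omega_i,\omega_j$ of degrees $i,j$, $i+j=n$, with the induced $d$. Put $\Omega^{\mathrm{ab}}_{\mathrm{even}}(A)=\bigoplus_k\Omega_{2k}(A)_{\mathrm{ab}}$, $\Omega^{\mathrm{ab}}_{\mathrm{odd}}(A)=\bigoplus_k\Omega_{2k+1}(A)_{\mathrm{ab}}$; $\mathrm{Im}(d)$ is the image of $d$. $H^{\mathrm{dR}}_n(A)$ is the degree-$n$ homology of the complex $\Omega_\bullet(A)_{\mathrm{ab}}$; $H^{\mathrm{dR}}_{\mathrm{even}}$, $H^{\mathrm{dR}}_{\mathrm{odd}}$ are the direct sums over even, odd $n$. A connection on $M$ is a $\mathbb K$-linear map $D\colon M\to M\otimes_A\Omega_1(A)$ with $D(ma)=D(m)a+m\otimes da$; it extends to $M\otimes_A\Omega_\bullet(A)$ by $D(s\otimes\omega)=D(s)\omega+s\otimes d\omega$, and $D^2$ is right $\Omega_\bullet(A)$-linear. For a ring $R$ and a finitely generated projective right $R$-module $F$, $\mathrm{tr}\colon\mathrm{End}_R(F)\cong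 F\otimes_R\mathrm{Hom}_R(F,R)\to R/[R,R]$ sends $x\otimes\mu$ to the class of $\mu(x)$; with $R=\bigoplus_k\Omega_{2k}(A)$, $F=M\otimes_AR$, $\mathrm{tr}(D^{2k})$ denotes the image of $\mathrm{tr}((D^2)^k)$ in $\Omega_{2k}(A)_{\mathrm{ab}}$. Set $\mathrm{ch}^{\mathrm{Ka}}(D)=\sum_k\frac1{k!}\mathrm{tr}(D^{2k})\in\Omega^{\mathrm{ab}}_{\mathrm{even}}(A)$; this sum is regarded as finite, $M$ being finitely generated. The form $\mathrm{ch}^{\mathrm{Ka}}(D)$ is closed, and $\mathrm{ch}^{\mathrm{Ka}}\colon K_0(A)\to H^{\mathrm{dR}}_{\mathrm{even}}(A)$, $[M]\mapsto[\mathrm{ch}^{\mathrm{Ka}}(D)]$ ($D$ any connection on $M$), is a homomorphism. $K_0(A)$ is the Grothendieck group of isomorphism classes of modules under $\oplus$. Let $\Lambda_0=\mathbb K[t]$, $\Lambda_1=\mathbb K[t]\,dt$, with $d(P)=P'dt$. The graded tensor product $\Lambda_\bullet\otimes\Omega_\bullet(A)$ is a DGA on top of $\Lambda_0\otimes A$ with abelianization $\Lambda_\bullet\otimes\Omega_\bullet(A)_{\mathrm{ab}}$; let $K(P\otimes\theta)=0$, $K(P\,dt\otimes\theta)=(\int_0^1P\,dt)\theta$. A polynomial path of connections on $M$ is a $\mathbb K$-linear $\mathcal D\colon M\to\Lambda_0\otimes M\otimes_A\Omega_1(A)$ with $\mathcal D(ma)=1\otimes m\otimes da+\mathcal D(m)a$;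 it goes from $\mathcal D_0$ to $\mathcal D_1$ (evaluations at $t=0,1$) and defines a connection $\widetilde{\mathcal D}(q\otimes m)=dq\otimes m+q\mathcal D(m)$ on the $\Lambda_0\otimes A$-module $\Lambda_0\otimes M$. Put $\mathrm{KCS}(\mathcal D)=K\,\mathrm{ch}^{\mathrm{Ka}}(\widetilde{\mathcal D})\in\Omega^{\mathrm{ab}}_{\mathrm{odd}}(A)$, and let $\mathrm{KCS}(D_0,D_1)$ be its class mod $\mathrm{Im}(d)$ for any polynomial path from $D_0$ to $D_1$ (independent of the choice). For an isomorphism $\varphi\colon M\to L$ and a connection $\nabla$ on $L$, $\varphi^*\nabla=(\varphi^{-1}\otimes\mathrm{id})\nabla\varphi$. A $\widehat K_0$-generator is a triple $(M,D,\omega)$, $D$ a connection on $M$, $\omega\in\Omega^{\mathrm{ab}}_{\mathrm{odd}}(A)/\mathrm{Im}(d)$. $(M_0,D_0,\omega_0)\sim(M_1,D_1,\omega_1)$ if there are $(N,D)$ and an isomorphism $\varphi\colon M_0\oplus N\to M_1\oplus N$ with $\mathrm{KCS}(D_0\oplus D,\varphi^*(D_1\oplus D))=\omega_0-\omega_1$ mod $\mathrm{Im}(d)$. $\widehat K_0(A)$ is the Grothendieck group of the monoid of classes under direct sum (forms are added). $I([(M,D,\omega)])=[M]$; $R([(M,D,\omega)])=\mathrm{ch}^{\mathrm{Ka}}(D)+d\omega$, a closed even form; $MK(A)=\ker R$; $\Omega_{\mathrm{ch}_0}(A)=\mathrm{Im}(R)$, the subgroup of $d$-closed even forms whose de Rham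 homology class is in the image of $\mathrm{ch}^{\mathrm{Ka}}$; $\mathrm{Pr}$ takes the de Rham homology class. $\Omega_{\mathrm{ch}_1}(A)\subseteq\Omega^{\mathrm{ab}}_{\mathrm{odd}}(A)$ is the subgroup generated by the exact odd forms and all forms $\mathrm{KCS}(t\mapsto(1-t)D+t\phi^*D)$, for $(M,D)$ a module with connection and $\phi\in\mathrm{Aut}(M)$. With $O$ the zero module: $a([\omega])=[(O,0,\omega)]-[(O,0,0)]$; $\alpha([\omega])=[(O,0,\omega)]-[(O,0,0)]$; $\beta([(M_0,D_0,\omega)]-[(M_1,D_1,\eta)])=[M_0]-[M_1]$; $r([\omega])=\omega+\Omega_{\mathrm{ch}_1}(A)$.
   Formalization: The sums defining ch^Ka(D) and ch^Ka of path connections are assumed finite in the abelianization; finite generation of M does not ensure this (universal DGA of K×K: e(de)^{2k} never vanishes), so ch^Ka would leave the direct sum. A is nonzero. *)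

(* Defs.v *)
From HB Require Import structures.
From mathcomp Require Import all_boot all_order all_algebra.
From mathcomp Require Import boolp.

Set Implicit Arguments.
Unset Strict Implicit.
Unset Printing Implicit Defensive.

Import GRing.Theory.
Local Open Scope ring_scope.
Local Open Scope quotient_scope.

Definition choose_or (T : Type) (x0 : T) (P : T -> Prop) : T :=
  if pselect (exists x, P x) is left h then projT1 (cid h) else x0.

Lemma choose_orP (T : Type) (x0 : T) (P : T -> Prop) :
  (exists x, P x) -> P (choose_or x0 P).
Proof. by rewrite /choose_or => h; case: pselect => // h'; case: cid. Qed.

Inductive gensub (V : zmodType) (S : V -> Prop) : V -> Prop :=
| gensub_mem x : S x -> gensub S x
| gensub0 : gensub S 0
| gensubB x y : gensub S x -> gensub S y -> gensub S (x - y).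

(* M (x)_B N for a right action ra of B on M and a left action la of B on N.
   Finite lists of pairs stand for sums of pure tensors; two of them are
   identified when no B-balanced biadditive map separates them. *)
Section Tensor.
Context (B : Type) (M N : zmodType) (ra : M -> B -> M) (la : B -> N -> N).

Definition balanced (V : zmodType) (f : M -> N -> V) : Prop :=
  [/\ forall m m' n, f (m + m') n = f m n + f m' n,
      forall m n n', f m (n + n') = f m n + f m n' &
      forall m b n, f (ra m b) n = f m (la b n)].

Definition tens_rel (s t : seq (M * N)) : Prop :=
  forall (V : zmodType) (f : M -> N -> V), balanced f ->
    \sum_(p <- s) f p.1 p.2 = \sum_(p <- t) f p.1 p.2.

Definition tens_relb (s t : seq (M * N)) : bool := `[< tens_rel s t >].

Lemma tens_relb_refl : reflexive tens_relb.
Proof. by move=> s; apply/asboolP. Qed.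

Lemma tens_relb_sym : symmetric tens_relb.
Proof. by move=> s t; apply/asboolP/asboolP => h V f /h. Qed.

Lemma tens_relb_trans : transitive tens_relb.
Proof.
move=> t s u /asboolP h1 /asboolP h2; apply/asboolP => V f bf.
by rewrite h1 // h2.
Qed.

Canonical tens_equiv :=
  EquivRel tens_relb tens_relb_refl tens_relb_sym tens_relb_trans.

Definition tens : Type := {eq_quot tens_equiv}.
HB.instance Definition _ := Choice.on tens.
HB.instance Definition _ := EqQuotient.on tens.

Definition tlift (V : zmodType) (f : M -> N -> V) (x : tens) : V :=
  \sum_(p <- repr x) f p.1 p.2.

Lemma tlift_pi (V : zmodType) (f : M -> N -> V) (s : seq (M * N)) :
  balanced f -> tlift f (\pi_tens s) = \sum_(p <- s) f p.1 p.2.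
Proof.
move=> bf; rewrite /tlift.
have /eqmodP /asboolP h : repr (\pi_tens s) = s %[mod tens] by rewrite reprK.
exact: h.
Qed.

Lemma tens_ext (x y : tens) :
  (forall (V : zmodType) (f : M -> N -> V), balanced f ->
     tlift f x = tlift f y) -> x = y.
Proof.
by move=> h; rewrite -[x]reprK -[y]reprK; apply/eqmodP/asboolP => V f /h.
Qed.

Definition tens_zero : tens := \pi_tens [::].
Definition tens_opp (x : tens) : tens :=
  \pi_tens [seq (- p.1, p.2) | p <- repr x].
Definition tens_add (x y : tens) : tens := \pi_tens (repr x ++ repr y).

Lemma balanced0l (V : zmodType) (f : M -> N -> V) n : balanced f -> f 0 n = 0.
Proof. by case=> h _ _; apply: (addrI (f 0 n)); rewrite -h !addr0. Qed.

Lemma balanced0r (V : zmodType) (f : M -> N -> V) m : balanced f -> f m 0 = 0.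
Proof. by case=> _ h _; apply: (addrI (f m 0)); rewrite -h !addr0. Qed.

Lemma balancedNl (V : zmodType) (f : M -> N -> V) m n :
  balanced f -> f (- m) n = - f m n.
Proof.
move=> bf; have [h _ _] := bf; apply: (addrI (f m n)).
by rewrite -h !subrr (balanced0l _ bf).
Qed.

Lemma tlift_zero (V : zmodType) (f : M -> N -> V) :
  balanced f -> tlift f tens_zero = 0.
Proof. by move=> bf; rewrite tlift_pi // big_nil. Qed.

Lemma tlift_opp (V : zmodType) (f : M -> N -> V) x :
  balanced f -> tlift f (tens_opp x) = - tlift f x.
Proof.
move=> bf; rewrite tlift_pi // big_map /tlift -sumrN.
by apply: eq_bigr => p _ /=; rewrite balancedNl.
Qed.

Lemma tlift_add (V : zmodType) (f : M -> N -> V) x y :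
  balanced f -> tlift f (tens_add x y) = tlift f x + tlift f y.
Proof. by move=> bf; rewrite tlift_pi // big_cat. Qed.

Lemma tens_addA : associative tens_add.
Proof. by move=> x y z; apply: tens_ext => V f bf; rewrite !tlift_add // addrA. Qed.

Lemma tens_addC : commutative tens_add.
Proof. by move=> x y; apply: tens_ext => V f bf; rewrite !tlift_add // addrC. Qed.

Lemma tens_add0 : left_id tens_zero tens_add.
Proof.
by move=> x; apply: tens_ext => V f bf; rewrite tlift_add // tlift_zero // add0r.
Qed.

Lemma tens_addN : left_inverse tens_zero tens_opp tens_add.
Proof.
move=> x; apply: tens_ext => V f bf.
by rewrite tlift_add // tlift_opp // tlift_zero // addNr.
Qed.

HB.instance Definition _ :=
  GRing.isZmodule.Build tens tens_addA tens_addC tens_add0 tens_addN.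

Definition tpure (m : M) (n : N) : tens := \pi_tens [:: (m, n)].

Lemma tlift_pure (V : zmodType) (f : M -> N -> V) m n :
  balanced f -> tlift f (tpure m n) = f m n.
Proof. by move=> bf; rewrite tlift_pi // big_seq1. Qed.

Lemma tliftD (V : zmodType) (f : M -> N -> V) :
  balanced f -> {morph tlift f : x y / x + y}.
Proof. by move=> bf x y; exact: tlift_add. Qed.

Lemma tlift0 (V : zmodType) (f : M -> N -> V) : balanced f -> tlift f 0 = 0.
Proof. exact: tlift_zero. Qed.

Lemma tlift_sum (V : zmodType) (f : M -> N -> V) I (r : seq I) (F : I -> tens) :
  balanced f -> tlift f (\sum_(i <- r) F i) = \sum_(i <- r) tlift f (F i).
Proof. by move=> bf; apply: big_morph; [exact: tliftD | exact: tlift0]. Qed.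

Lemma balanced_tpure : balanced tpure.
Proof.
split=> [m m' n|m n n'|m b n]; apply: tens_ext => V f bf;
  have [h1 h2 h3] := bf; rewrite ?tliftD // !tlift_pure //.
Qed.

Lemma tens_sum (x : tens) : x = \sum_(p <- repr x) tpure p.1 p.2.
Proof.
apply: tens_ext => V f bf; rewrite tlift_sum // /tlift.
by apply: eq_bigr => p _; rewrite -/(tlift f _) tlift_pure.
Qed.

Lemma tens_ind (P : tens -> Prop) :
  (forall m n, P (tpure m n)) -> P 0 ->
  (forall x y, P x -> P y -> P (x + y)) -> forall x, P x.
Proof. by move=> h1 h0 hD x; rewrite [x]tens_sum; elim/big_ind: _. Qed.

Lemma tens_lin_ext (V : zmodType) (g h : tens -> V) :
  {morph g : x y / x + y} -> {morph h : x y / x + y} ->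
  (forall m n, g (tpure m n) = h (tpure m n)) -> g =1 h.
Proof.
move=> gD hD e; have z (k : tens -> V) : {morph k : x y / x + y} -> k 0 = 0.
  by move=> kD; apply: (addrI (k 0)); rewrite -kD !addr0.
elim/tens_ind => // [|x y ex ey]; first by rewrite !z.
by rewrite gD hD ex ey.
Qed.

End Tensor.

(* Omega_n is the image of the n-th projection dproj n; demb identifies A with
   Omega_0. *)
Record dga (K : fieldType) (A : algType K) := Dga {
  dform :> algType K;
  dproj : nat -> {linear dform -> dform};
  ddiff : {linear dform -> dform};
  demb : {lrmorphism A -> dform};
  dprojK : forall i j w, dproj i (dproj j w) = if i == j then dproj j w else 0;
  dproj_fin : forall w, exists n, w = \sum_(i < n) dproj i w;
  dproj_mul : forall i j u v,
    dproj (i + j) (dproj i u * dproj j v) = dproj i u * dproj j v;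
  ddiff_deg : forall n w, dproj n.+1 (ddiff (dproj n w)) = ddiff (dproj n w);
  ddiffK : forall w, ddiff (ddiff w) = 0;
  ddiffM : forall n u v, ddiff (dproj n u * v) =
    ddiff (dproj n u) * v + (-1) ^+ n * (dproj n u * ddiff v);
  demb_inj : injective demb;
  demb_im : forall w, dproj 0 w = w <-> exists a, demb a = w
}.

Section DgaTheory.
Context (K : fieldType) (A : algType K) (Om : dga A).
Implicit Types u v w : Om.

Definition homog (n : nat) (w : Om) : Prop := dproj Om n w = w.
Definition evenf (w : Om) : Prop := forall i, odd i -> dproj Om i w = 0.
Definition oddf (w : Om) : Prop := forall i, ~~ odd i -> dproj Om i w = 0.

(* [Omega, Omega]: being a graded subspace, its even (odd) part is the direct
   sum of the even (odd) [Omega, Omega]_n. *)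
Definition gcomm : Om -> Prop := gensub (fun w => exists c i j u v,
  [/\ homog i u, homog j v & w = c *: (u * v - (-1) ^+ (i * j) * (v * u))]).

(* w is exact in Omega_ab (whose elements are handled through representatives
   in Omega, modulo gcomm), with a primitive in P, the forms of the opposite
   parity. *)
Definition exact_by (P : Om -> Prop) (w : Om) : Prop :=
  exists2 h, P h & gcomm (w - ddiff Om h).

Definition closedf (w : Om) : Prop := gcomm (ddiff Om w).

Lemma dproj_out w n m : w = \sum_(i < n) dproj Om i w -> (n <= m)%N -> dproj Om m w = 0.
Proof.
move=> ew nm; rewrite ew raddf_sum /= big1 // => i _; rewrite dprojK.
by rewrite gtn_eqF // (leq_trans (ltn_ord i)).
Qed.

Lemma dproj_sum w n m : w = \sum_(i < n) dproj Om i w -> (n <= m)%N ->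
  w = \sum_(i < m) dproj Om i w.
Proof.
move=> ew nm; rewrite -(subnKC nm) big_split_ord /= -ew big1 ?addr0 // => i _.
by apply: (dproj_out ew); rewrite leq_addr.
Qed.

Lemma dproj_finb w : exists n, w == \sum_(i < n) dproj Om i w.
Proof. by have [n /eqP] := dproj_fin w; exists n. Qed.

(* w |-> (-1)^n w on Omega_n *)
Definition sgnf (w : Om) : Om :=
  \sum_(i < ex_minn (dproj_finb w)) (-1) ^+ i * dproj Om i w.

Lemma sgnfE w n : w = \sum_(i < n) dproj Om i w ->
  sgnf w = \sum_(i < n) (-1) ^+ i * dproj Om i w.
Proof.
rewrite /sgnf; case: ex_minnP => m /eqP em mmin en.
have mn : (m <= n)%N by apply: mmin; apply/eqP.
rewrite -(subnKC mn) big_split_ord /= [X in _ + X]big1 ?addr0 // => i _.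
by rewrite (dproj_out em) ?mulr0 // leq_addr.
Qed.

Lemma dproj_fin2 u v : exists2 n, u = \sum_(i < n) dproj Om i u &
  v = \sum_(i < n) dproj Om i v.
Proof.
have [n en] := dproj_fin u; have [m em] := dproj_fin v.
by exists (maxn n m); [apply: (dproj_sum en) | apply: (dproj_sum em)];
  rewrite ?leq_maxl ?leq_maxr.
Qed.

Lemma sgnfB : {morph sgnf : u v / u - v}.
Proof.
move=> u v; have [n eu ev] := dproj_fin2 u v.
rewrite (sgnfE eu) (sgnfE ev) (@sgnfE _ n) -?sumrB.
  by apply: eq_bigr => i _; rewrite raddfB mulrBr.
by rewrite {1}eu {1}ev -sumrB; apply: eq_bigr => i _; rewrite raddfB.
Qed.

HB.instance Definition _ := GRing.isZmodMorphism.Build Om Om sgnf sgnfB.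

Lemma sgnf_dproj n w : sgnf (dproj Om n w) = (-1) ^+ n * dproj Om n w.
Proof.
have e : dproj Om n w = \sum_(i < n.+1) dproj Om i (dproj Om n w).
  rewrite big_ord_recr /= dprojK eqxx big1 ?add0r // => i _.
  by rewrite dprojK ltn_eqF.
rewrite (sgnfE e) big_ord_recr /= dprojK eqxx big1 ?add0r // => i _.
by rewrite dprojK ltn_eqF ?mulr0.
Qed.

Lemma sgnf1 : sgnf 1 = 1.
Proof.
have <- : dproj Om 0 1 = 1 by apply/demb_im; exists 1; rewrite rmorph1.
by rewrite sgnf_dproj mul1r.
Qed.

Lemma dproj_elim (P : Om -> Prop) :
  (forall n w, P (dproj Om n w)) -> P 0 ->
  (forall u v, P u -> P v -> P (u + v)) -> forall w, P w.
Proof.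
by move=> h h0 hD w; have [n ->] := dproj_fin w; elim/big_ind: _.
Qed.

Lemma sgnfM : {morph sgnf : u v / u * v}.
Proof.
move=> u v; elim/dproj_elim: u => [n u||x y hx hy]; last 1 first.
- by rewrite mulrDl !raddfD /= hx hy mulrDl.
- elim/dproj_elim: v => [m v||x y hx hy]; last 1 first.
  + by rewrite mulrDr !raddfD /= hx hy mulrDr.
  + rewrite -dproj_mul !sgnf_dproj dproj_mul exprD -!mulrA; congr (_ * _).
    by rewrite !mulrA; congr (_ * _); rewrite commr_sign.
  by rewrite !(mulr0, raddf0).
by rewrite !(mul0r, raddf0).
Qed.

HB.instance Definition _ :=
  GRing.isMonoidMorphism.Build Om Om sgnf (conj sgnf1 sgnfM).

Lemma sgnfK : involutive sgnf.
Proof.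
elim/dproj_elim => [n w||x y hx hy]; last by rewrite !raddfD /= hx hy.
  by rewrite sgnf_dproj rmorphM /= rmorphXn /= raddfN /= sgnf1 sgnf_dproj
    mulrA -expr2 sqrr_sign mul1r.
by rewrite !raddf0.
Qed.

Lemma sgnfZ c w : sgnf (c *: w) = c *: sgnf w.
Proof.
elim/dproj_elim: w => [n w||x y hx hy].
- by rewrite -linearZ /= !sgnf_dproj linearZ /= scalerAr.
- by rewrite scaler0 !raddf0.
by rewrite scalerDr !raddfD /= hx hy.
Qed.

Lemma sgnf_demb a : sgnf (demb Om a) = demb Om a.
Proof.
have <- : dproj Om 0 (demb Om a) = demb Om a by apply/demb_im; exists a.
by rewrite sgnf_dproj mul1r.
Qed.

Lemma sgnf_ddiff w : sgnf (ddiff Om w) = - ddiff Om (sgnf w).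
Proof.
elim/dproj_elim: w => [n w||x y hx hy].
- rewrite -ddiff_deg !sgnf_dproj ddiff_deg exprS mulN1r mulNr.
  congr (- _); case: (odd n) / (boolP (odd n)) => [|] hn.
    by rewrite -signr_odd hn expr1 !mulN1r raddfN.
  by rewrite -signr_odd (negbTE hn) !mul1r.
- by rewrite !raddf0.
by rewrite !raddfD /= hx hy -opprD.
Qed.

Lemma ddiffMs u v :
  ddiff Om (u * v) = ddiff Om u * v + sgnf u * ddiff Om v.
Proof.
elim/dproj_elim: u => [n u||x y hx hy].
- by rewrite ddiffM sgnf_dproj mulrA.
- by rewrite !raddf0 !mul0r raddf0 addr0.
by rewrite mulrDl !raddfD /= hx hy !mulrDl addrACA.
Qed.

Lemma dproj_sgnf n w : dproj Om n (sgnf w) = (-1) ^+ n * dproj Om n w.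
Proof.
elim/dproj_elim: w => [m w||x y hx hy].
- rewrite sgnf_dproj -signr_odd; case: (eqVneq n m) => [->|nm].
    by rewrite -[in RHS]signr_odd; case: (odd m);
      rewrite ?expr1 ?expr0 ?mulN1r ?mul1r ?raddfN /= dprojK eqxx.
  have z : dproj Om n (dproj Om m w) = 0 by rewrite dprojK (negbTE nm).
  by rewrite z mulr0; case: (odd m);
    rewrite ?expr1 ?expr0 ?mulN1r ?mul1r ?raddfN /= z ?oppr0.
- by rewrite !raddf0 mulr0.
by rewrite !raddfD /= hx hy mulrDr.
Qed.

End DgaTheory.

(* Lambda_0 (x) A, as polynomials in t with coefficients in A *)
Definition tpoly (K : fieldType) (A : algType K) : Type := {poly A}.

Section TPoly.
Context (K : fieldType) (A : algType K).

HB.instance Definition _ := GRing.NzRing.on (tpoly A).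

Definition tpoly_scale (c : K) (p : tpoly A) : tpoly A := c%:A *: (p : {poly A}).

Lemma tpoly_scaleA a b v : tpoly_scale a (tpoly_scale b v) = tpoly_scale (a * b) v.
Proof. by rewrite /tpoly_scale scalerA -scalerAl mul1r scalerA. Qed.
Lemma tpoly_scale1 : left_id 1 tpoly_scale.
Proof. by move=> v; rewrite /tpoly_scale !scale1r. Qed.
Lemma tpoly_scaleDr : right_distributive tpoly_scale +%R.
Proof. by move=> a u v; rewrite /tpoly_scale scalerDr. Qed.
Lemma tpoly_scaleDl v : {morph tpoly_scale^~ v : a b / a + b}.
Proof. by move=> a b; rewrite /tpoly_scale !scalerDl. Qed.

HB.instance Definition _ := GRing.Zmodule_isLmodule.Build K (tpoly A)
  tpoly_scaleA tpoly_scale1 tpoly_scaleDr tpoly_scaleDl.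

Lemma tpoly_scaleAl (a : K) (u v : tpoly A) : a *: (u * v) = (a *: u) * v.
Proof. exact: (@scalerAl A {poly A}). Qed.
HB.instance Definition _ := GRing.Lmodule_isLalgebra.Build K (tpoly A) tpoly_scaleAl.

Lemma tpoly_coefZ (c : K) (p : tpoly A) i : (c *: p : {poly A})`_i = c *: (p : {poly A})`_i.
Proof. by rewrite [LHS](coefZ _ (p : {poly A})) -scalerAl mul1r. Qed.

Lemma tpoly_scaleAr (a : K) (u v : tpoly A) : a *: (u * v) = u * (a *: v).
Proof.
apply/polyP => i; rewrite tpoly_coefZ !coefM scaler_sumr.
by apply: eq_bigr => j _; rewrite tpoly_coefZ scalerAr.
Qed.
HB.instance Definition _ := GRing.Lalgebra_isAlgebra.Build K (tpoly A) tpoly_scaleAr.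

End TPoly.

(* Lambda (x) Omega: the pair (P, Q) stands for P + dt Q, the monomial
   theta * 'X^n for t^n (x) theta. Moving dt to the left through a form w
   yields dt (sgnf w). *)
Record cylf (K : fieldType) (A : algType K) (Om : dga A) := Cyl {
  cylP : {poly Om};
  cylQ : {poly Om}
}.

Section Cylinder.
Context (K : fieldType) (A : algType K) (Om : dga A).
Implicit Types (x y z : cylf Om) (P Q : {poly Om}).

Definition cyl_pair x : {poly Om} * {poly Om} := (cylP x, cylQ x).
Lemma cyl_pairK : cancel cyl_pair (fun p => Cyl p.1 p.2).
Proof. by case. Qed.
HB.instance Definition _ := Choice.copy (cylf Om) (can_type cyl_pairK).

Definition cyl_zero : cylf Om := Cyl 0 0.
Definition cyl_opp x : cylf Om := Cyl (- cylP x) (- cylQ x).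
Definition cyl_add x y : cylf Om := Cyl (cylP x + cylP y) (cylQ x + cylQ y).
Lemma cyl_addA : associative cyl_add.
Proof. by case=> [P Q] [R S] [T U]; rewrite /cyl_add /= !addrA. Qed.
Lemma cyl_addC : commutative cyl_add.
Proof. by case=> [P Q] [R S]; congr Cyl; rewrite addrC. Qed.
Lemma cyl_add0 : left_id cyl_zero cyl_add.
Proof. by case=> [P Q]; rewrite /cyl_add /= !add0r. Qed.
Lemma cyl_addN : left_inverse cyl_zero cyl_opp cyl_add.
Proof. by case=> [P Q]; rewrite /cyl_add /= !addNr. Qed.
HB.instance Definition _ :=
  GRing.isZmodule.Build (cylf Om) cyl_addA cyl_addC cyl_add0 cyl_addN.

Definition cyl_scale (c : K) x : cylf Om :=
  Cyl (c *: (cylP x : tpoly Om)) (c *: (cylQ x : tpoly Om)).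
Lemma cyl_scaleA a b x : cyl_scale a (cyl_scale b x) = cyl_scale (a * b) x.
Proof. by rewrite /cyl_scale /= !(@scalerA K (tpoly Om)). Qed.
Lemma cyl_scale1 : left_id 1 cyl_scale.
Proof. by case=> [P Q]; rewrite /cyl_scale /= !(@scale1r K (tpoly Om)). Qed.
Lemma cyl_scaleDr : right_distributive cyl_scale +%R.
Proof. by move=> a [P Q] [R S]; congr Cyl; exact: (@scalerDr K (tpoly Om)). Qed.
Lemma cyl_scaleDl x : {morph cyl_scale^~ x : a b / a + b}.
Proof. by move=> a b; congr Cyl; exact: (@scalerDl K (tpoly Om)). Qed.
HB.instance Definition _ := GRing.Zmodule_isLmodule.Build K (cylf Om)
  cyl_scaleA cyl_scale1 cyl_scaleDr cyl_scaleDl.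

Definition psgn (P : {poly Om}) : {poly Om} := map_poly (@sgnf K A Om) P.
HB.instance Definition _ := GRing.RMorphism.copy psgn (map_poly (@sgnf K A Om)).

Definition cyl_one : cylf Om := Cyl 1 0.
Definition cyl_mul x y : cylf Om :=
  Cyl (cylP x * cylP y) (cylQ x * cylP y + psgn (cylP x) * cylQ y).

Lemma cyl_mulA : associative cyl_mul.
Proof.
move=> [P Q] [P' Q'] [P'' Q'']; rewrite /cyl_mul /=; congr Cyl.
  by rewrite mulrA.
by rewrite rmorphM /= mulrDl mulrDr !mulrA addrA.
Qed.
Lemma cyl_mul1l : left_id cyl_one cyl_mul.
Proof. by move=> [P Q]; rewrite /cyl_mul /= rmorph1 !mul1r mul0r add0r. Qed.
Lemma cyl_mul1r : right_id cyl_one cyl_mul.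
Proof. by move=> [P Q]; rewrite /cyl_mul /= !mulr1 mulr0 addr0. Qed.
Lemma cyl_mulDl : left_distributive cyl_mul +%R.
Proof.
move=> [P Q] [P' Q'] [P'' Q'']; rewrite /cyl_mul /=; congr Cyl.
  by rewrite mulrDl.
by rewrite raddfD /= !mulrDl addrACA.
Qed.
Lemma cyl_mulDr : right_distributive cyl_mul +%R.
Proof.
move=> [P Q] [P' Q'] [P'' Q'']; rewrite /cyl_mul /=; congr Cyl.
  by rewrite mulrDr.
by rewrite !mulrDr addrACA.
Qed.
Lemma cyl_one_neq0 : cyl_one != 0.
Proof. by apply/eqP => -[] /eqP; rewrite oner_eq0. Qed.

HB.instance Definition _ := GRing.Zmodule_isNzRing.Build (cylf Om)
  cyl_mulA cyl_mul1l cyl_mul1r cyl_mulDl cyl_mulDr cyl_one_neq0.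

Lemma psgnZ (a : K) (P : tpoly Om) : psgn (a *: P) = a *: (psgn P : tpoly Om).
Proof. by apply/polyP => i; rewrite coef_map !tpoly_coefZ coef_map /= sgnfZ. Qed.

Lemma cyl_scaleAl (a : K) x y : a *: (x * y) = (a *: x) * y.
Proof.
case: x y => [P Q] [R S].
have e (P' Q' R' S' : tpoly Om) : a *: (Q' * R' + psgn P' * S' : tpoly Om) =
    (a *: Q') * R' + psgn (a *: P') * S' :> tpoly Om.
  by rewrite psgnZ scalerDr !(@scalerAl K (tpoly Om)).
by congr Cyl; [exact: (@scalerAl K (tpoly Om)) | exact: e].
Qed.
HB.instance Definition _ := GRing.Lmodule_isLalgebra.Build K (cylf Om) cyl_scaleAl.

Lemma cyl_scaleAr (a : K) x y : a *: (x * y) = x * (a *: y).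
Proof.
case: x y => [P Q] [R S].
have e (P' Q' R' S' : tpoly Om) : a *: (Q' * R' + psgn P' * S' : tpoly Om) =
    Q' * (a *: R') + psgn P' * (a *: S') :> tpoly Om.
  by rewrite scalerDr !(@scalerAr K (tpoly Om)).
by congr Cyl; [exact: (@scalerAr K (tpoly Om)) | exact: e].
Qed.
HB.instance Definition _ := GRing.Lalgebra_isAlgebra.Build K (cylf Om) cyl_scaleAr.

Definition pproj n (P : {poly Om}) : {poly Om} := map_poly (dproj Om n) P.
Definition pdiff (P : {poly Om}) : {poly Om} := map_poly (ddiff Om) P.
HB.instance Definition _ n := GRing.Additive.copy (pproj n) (map_poly (dproj Om n)).
HB.instance Definition _ := GRing.Additive.copy pdiff (map_poly (ddiff Om)).

Lemma coef_pproj n P i : (pproj n P)`_i = dproj Om n P`_i.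
Proof. by rewrite coef_map. Qed.
Lemma coef_pdiff P i : (pdiff P)`_i = ddiff Om P`_i.
Proof. by rewrite coef_map. Qed.
Lemma coef_psgn P i : (psgn P)`_i = sgnf P`_i.
Proof. by rewrite coef_map. Qed.

Definition cyl_proj n x : cylf Om :=
  Cyl (pproj n (cylP x)) (if n is n'.+1 then pproj n' (cylQ x) else 0).

Definition cyl_diff x : cylf Om :=
  Cyl (pdiff (cylP x)) ((cylP x)^`() - pdiff (cylQ x)).

Definition cyl_emb (p : tpoly A) : cylf Om := Cyl (map_poly (demb Om) p) 0.

Lemma pscale_coef (f : {linear Om -> Om}) (c : K) (P : tpoly Om) :
  map_poly f (c *: P : tpoly Om) = c *: (map_poly f P : tpoly Om).
Proof. by apply/polyP => i; rewrite coef_map !tpoly_coefZ coef_map /= linearZ. Qed.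

Lemma cyl_proj_linear n : linear (cyl_proj n).
Proof.
move=> a [P Q] [P' Q']; congr Cyl.
  by rewrite /= raddfD /=; congr (_ + _); exact: pscale_coef.
case: n => [|n] /=; first by rewrite [LHS](_ : _ = a *: (0 : tpoly Om) + 0) // scaler0 addr0.
by rewrite raddfD /=; congr (_ + _); exact: pscale_coef.
Qed.
HB.instance Definition _ n :=
  GRing.isLinear.Build K (cylf Om) (cylf Om) *:%R (cyl_proj n) (cyl_proj_linear n).

Lemma pderivZ (a : K) (P : tpoly Om) :
  (a *: P : {poly Om})^`() = a *: (P^`() : tpoly Om).
Proof. exact: derivZ. Qed.

Lemma cyl_diff_linear : linear cyl_diff.
Proof.
move=> a [P Q] [P' Q']; congr Cyl.
  by rewrite /= raddfD /=; congr (_ + _); exact: pscale_coef.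
rewrite /= derivD raddfD /= pderivZ.
rewrite [pdiff _](pscale_coef (ddiff Om)).
by rewrite (@scalerBr K (tpoly Om)) opprD addrACA.
Qed.
HB.instance Definition _ :=
  GRing.isLinear.Build K (cylf Om) (cylf Om) *:%R cyl_diff cyl_diff_linear.

Lemma cyl_emb_linear : linear cyl_emb.
Proof.
move=> a p q; congr Cyl; last by rewrite [LHS](_ : _ = a *: (0 : tpoly Om) + 0) // scaler0 addr0.
rewrite raddfD /=; congr (_ + _).
by apply/polyP => i; rewrite coef_map !tpoly_coefZ coef_map /= linearZ.
Qed.
HB.instance Definition _ :=
  GRing.isLinear.Build K (tpoly A) (cylf Om) *:%R cyl_emb cyl_emb_linear.

Lemma psgn_emb (p : {poly A}) : psgn (map_poly (demb Om) p) = map_poly (demb Om) p.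
Proof. by apply/polyP => i; rewrite coef_psgn coef_map sgnf_demb. Qed.

Lemma cyl_emb_monoid : monoid_morphism cyl_emb.
Proof.
split=> [|p q]; first by rewrite /cyl_emb rmorph1.
congr Cyl; first by rewrite rmorphM.
by rewrite /= mul0r mulr0 addr0.
Qed.
HB.instance Definition _ :=
  GRing.isMonoidMorphism.Build (tpoly A) (cylf Om) cyl_emb cyl_emb_monoid.

Lemma pprojK i j P : pproj i (pproj j P) = if i == j then pproj j P else 0.
Proof.
apply/polyP => k; rewrite !coef_pproj dprojK.
by case: eqP; rewrite ?coef_pproj ?coef0.
Qed.

Lemma cyl_projK i j x :
  cyl_proj i (cyl_proj j x) = if i == j then cyl_proj j x else 0.
Proof.
case: x => P Q; rewrite /cyl_proj /= pprojK.
case: i j => [|i] [|j] //=; rewrite ?raddf0 // pprojK eqSS; by case: eqP.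
Qed.

Lemma pproj_fin P : exists n, forall m, (n <= m)%N -> P = \sum_(i < m) pproj i P.
Proof.
have [n hn] : exists n, forall k, (k < size P)%N -> forall m, (n <= m)%N ->
    P`_k = \sum_(i < m) dproj Om i P`_k.
  elim: (size P) => [|s [n hn]]; first by exists 0.
  have [n' e] := dproj_fin (P`_s); exists (maxn n n') => k.
  rewrite ltnS leq_eqVlt => /orP[/eqP -> m|ks m]; rewrite geq_max => /andP[h h'].
    exact: dproj_sum e h'.
  exact: hn.
exists n => m nm; apply/polyP => k; rewrite coef_sum.
under eq_bigr do rewrite coef_pproj.
case: (ltnP k (size P)) => ks; first exact: hn.
by rewrite nth_default // big1 // => i _; rewrite raddf0.
Qed.

Lemma cyl_proj_fin x : exists n, x = \sum_(i < n) cyl_proj i x.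
Proof.
case: x => P Q; have [n en] := pproj_fin P; have [m em] := pproj_fin Q.
exists (maxn n m).+1.
have sumE (F : nat -> cylf Om) k : \sum_(i < k) F i =
    Cyl (\sum_(i < k) cylP (F i)) (\sum_(i < k) cylQ (F i)).
  by elim: k => [|k IH]; rewrite ?big_ord0 // !big_ord_recr /= IH.
rewrite (sumE (fun i => cyl_proj i (Cyl P Q))) /=; congr Cyl.
  by apply: en; rewrite (leq_trans (leq_maxl n m)).
rewrite big_ord_recl /= add0r; apply: em; exact: leq_maxr.
Qed.

Lemma pproj_mul i j P Q :
  pproj (i + j) (pproj i P * pproj j Q) = pproj i P * pproj j Q.
Proof.
apply/polyP => k; rewrite coef_pproj coefM raddf_sum.
by apply: eq_bigr => l _; rewrite !coef_pproj /= dproj_mul.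
Qed.

Lemma psgn_pproj n P : psgn (pproj n P) = (-1) ^+ n * pproj n P.
Proof.
apply/polyP => k; rewrite coef_psgn coef_pproj sgnf_dproj -signr_odd.
rewrite -[in RHS]signr_odd; case: (odd n);
  by rewrite ?expr1 ?expr0 ?mulN1r ?mul1r ?coefN coef_pproj.
Qed.

Lemma pproj_sign n m P : pproj n ((-1) ^+ m * P) = (-1) ^+ m * pproj n P.
Proof.
rewrite -signr_odd; case: (odd m); by rewrite ?expr1 ?expr0 ?mulN1r ?mul1r ?raddfN.
Qed.

Lemma cyl_proj_mul i j x y :
  cyl_proj (i + j) (cyl_proj i x * cyl_proj j y) = cyl_proj i x * cyl_proj j y.
Proof.
case: x y => [P Q] [P' Q']; congr Cyl; first exact: pproj_mul.
rewrite /= psgn_pproj; case: i j => [|i] [|j];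
  rewrite ?addn0 ?addnS ?addSn /= ?mul0r ?mulr0 ?add0r ?addr0 //.
- by rewrite -mulrA pproj_sign pproj_mul.
- by rewrite -{1}[i]addn0 pproj_mul.
rewrite raddfD /=; congr (_ + _); last by rewrite -mulrA pproj_sign -addSn pproj_mul.
by rewrite -addnS pproj_mul.
Qed.

Lemma pdiff_pproj n P : pproj n.+1 (pdiff (pproj n P)) = pdiff (pproj n P).
Proof. by apply/polyP => k; rewrite !(coef_pproj, coef_pdiff) ddiff_deg. Qed.

Lemma pproj_deriv n P : pproj n (P^`()) = (pproj n P)^`().
Proof. by apply/polyP => k; rewrite !(coef_deriv, coef_pproj) raddfMn. Qed.

Lemma pdiff_deriv P : pdiff (P^`()) = (pdiff P)^`().
Proof. by apply/polyP => k; rewrite !(coef_deriv, coef_pdiff) raddfMn. Qed.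

Lemma cyl_diff_deg n x :
  cyl_proj n.+1 (cyl_diff (cyl_proj n x)) = cyl_diff (cyl_proj n x).
Proof.
case: x => P Q; congr Cyl; first exact: pdiff_pproj.
rewrite /= raddfB /= pproj_deriv pprojK eqxx; congr (_ - _).
by case: n => [|n]; [rewrite !raddf0 | exact: pdiff_pproj].
Qed.

Lemma pdiffK P : pdiff (pdiff P) = 0.
Proof. by apply/polyP => k; rewrite !coef_pdiff ddiffK coef0. Qed.

Lemma cyl_diffK x : cyl_diff (cyl_diff x) = 0.
Proof.
case: x => P Q; congr Cyl; first exact: pdiffK.
by rewrite /= raddfB /= pdiffK subr0 pdiff_deriv subrr.
Qed.

Lemma pdiffM P Q : pdiff (P * Q) = pdiff P * Q + psgn P * pdiff Q.
Proof.
apply/polyP => k; rewrite coefD coef_pdiff !coefM raddf_sum -big_split /=.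
by apply: eq_bigr => l _; rewrite !(coef_pdiff, coef_psgn) /= ddiffMs.
Qed.

Lemma psgn_pdiff P : psgn (pdiff P) = - pdiff (psgn P).
Proof.
by apply/polyP => k; rewrite coefN !(coef_pdiff, coef_psgn) sgnf_ddiff.
Qed.

Lemma psgnK P : psgn (psgn P) = P.
Proof. by apply/polyP => k; rewrite !coef_psgn sgnfK. Qed.

Lemma cyl_diffMs x y :
  cyl_diff (x * y) = cyl_diff x * y + Cyl (psgn (cylP x)) (- psgn (cylQ x)) * cyl_diff y.
Proof.
case: x y => [P Q] [R S]; congr Cyl; first exact: pdiffM.
rewrite /= derivM raddfD /= !pdiffM psgn_pdiff psgnK.
rewrite mulrBl mulrBr !mulNr !opprD.
move: ((P^`()) * R) (P * R^`()) (pdiff Q * R) (psgn Q * pdiff R)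
  (pdiff (psgn P) * S) (P * pdiff S) => a b c d e f.
rewrite -!addrA; congr (_ + _); rewrite [LHS]addrCA; congr (_ + _).
by rewrite [LHS]addrCA [RHS]addrCA; congr (_ + _); rewrite addrCA.
Qed.

Lemma cyl_diffM n x y : cyl_diff (cyl_proj n x * y) =
  cyl_diff (cyl_proj n x) * y + (-1) ^+ n * (cyl_proj n x * cyl_diff y).
Proof.
rewrite cyl_diffMs [in RHS]mulrA; congr (_ + _ * _).
case: x => P Q; rewrite /= psgn_pproj -[in RHS]signr_odd.
have e : - psgn (if n is n'.+1 then pproj n' Q else 0) =
    (-1) ^+ n * (if n is n'.+1 then pproj n' Q else 0).
  case: n => [|n]; first by rewrite raddf0 oppr0 mulr0.
  by rewrite psgn_pproj exprS mulN1r mulNr.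
rewrite e -signr_odd; case: (odd n); rewrite ?expr1 ?expr0 ?mul1r //.
by rewrite !mulN1r.
Qed.

Lemma cyl_emb_inj : injective cyl_emb.
Proof. by move=> p q [] /(map_inj_poly (@demb_inj _ _ Om) (raddf0 _)). Qed.

Lemma cyl_emb_im x : cyl_proj 0 x = x <-> exists p, cyl_emb p = x.
Proof.
case: x => P Q; split=> [[eP <-]|[p [<- <-]]]; last first.
  congr Cyl; apply/polyP => k; rewrite coef_pproj coef_map.
  by apply/demb_im; exists p`_k.
have h k : exists a, demb Om a == P`_k.
  have /demb_im [a e] : dproj Om 0 P`_k = P`_k by rewrite -[in RHS]eP coef_pproj.
  by exists a; apply/eqP.
exists (\poly_(i < size P) xchoose (h i)); congr Cyl; apply/polyP => k.
rewrite coef_map coef_poly; case: ltnP => [_|s].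
  exact/eqP/(xchooseP (h k)).
by rewrite raddf0 nth_default.
Qed.

Definition cyl : dga (tpoly A) :=
  Dga cyl_projK cyl_proj_fin cyl_proj_mul cyl_diff_deg cyl_diffK cyl_diffM
    cyl_emb_inj cyl_emb_im.

(* K (P + dt Q) = \int_0^1 Q dt *)
Definition fiber_int (x : cyl) : Om :=
  let Q := cylQ x in
  \sum_(i < size Q) (i.+1%:R : K)^-1 *: Q`_i.

End Cylinder.

(* A right R-module is a left module over the converse ring R^c. *)
Definition rmul (R : pzRingType) (M : lmodType R^c) (m : M) (r : R) : M :=
  (r : R^c) *: m.

(* direct summand of a free right module of finite rank *)
Definition fgproj (R : pzRingType) (M : lmodType R^c) : Prop :=
  exists n (i : {linear M -> 'rV[R^c]_n}) (p : {linear 'rV[R^c]_n -> M}),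
    cancel i p.

Lemma rmulDl (R : pzRingType) (M : lmodType R^c) (m m' : M) (r : R) :
  rmul (m + m') r = rmul m r + rmul m' r.
Proof. exact: scalerDr. Qed.
Lemma rmulDr (R : pzRingType) (M : lmodType R^c) (m : M) (r s : R) :
  rmul m (r + s) = rmul m r + rmul m s.
Proof. exact: scalerDl. Qed.
Lemma rmulA (R : pzRingType) (M : lmodType R^c) (m : M) (r s : R) :
  rmul (rmul m r) s = rmul m (r * s).
Proof. exact: scalerA. Qed.
Lemma rmul1 (R : pzRingType) (M : lmodType R^c) (m : M) : rmul m 1 = m.
Proof. exact: scale1r. Qed.

(* M (x)_A Omega *)
Definition mform (K : fieldType) (A : algType K) (Om : dga A)
    (M : lmodType A^c) : Type :=
  tens (@rmul A M) (fun (a : A) (w : Om) => demb Om a * w).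

Section ModuleForms.
Context (K : fieldType) (A : algType K) (Om : dga A) (M : lmodType A^c).

HB.instance Definition _ := GRing.Zmodule.on (mform Om M).

Definition mpure (m : M) (w : Om) : mform Om M := tpure _ _ m w.

Lemma mpure_balanced :
  balanced (@rmul A M) (fun (a : A) (w : Om) => demb Om a * w) mpure.
Proof. exact: balanced_tpure. Qed.

Definition mform_scale (r : Om^c) (x : mform Om M) : mform Om M :=
  tlift (fun m (w : Om) => mpure m (w * (r : Om))) x.

Lemma mform_scale_balanced (r : Om) :
  balanced (@rmul A M) (fun (a : A) (w : Om) => demb Om a * w)
    (fun m (w : Om) => mpure m (w * r)).
Proof.
have [h1 h2 h3] := mpure_balanced.
by split=> *; rewrite ?mulrDl ?h1 ?h2 ?h3 ?mulrA.
Qed.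

Lemma mform_scale_pure (r : Om) m w :
  mform_scale r (mpure m w) = mpure m (w * r).
Proof. exact: tlift_pure (mform_scale_balanced r). Qed.

Lemma mform_scaleDr : right_distributive mform_scale +%R.
Proof. by move=> r x y; apply: tliftD (mform_scale_balanced r) _ _. Qed.

Lemma mform_scaleA (r s : Om^c) x :
  mform_scale r (mform_scale s x) = mform_scale (r * s) x.
Proof.
apply: (tens_lin_ext (g := fun x => mform_scale r (mform_scale s x))) x => [x y|x y|m w].
- by rewrite !mform_scaleDr.
- by rewrite mform_scaleDr.
by rewrite !mform_scale_pure -mulrA.
Qed.

Lemma mform_scale1 : left_id 1 mform_scale.
Proof.
apply: tens_lin_ext => [x y|//|m w]; first by rewrite mform_scaleDr.
by rewrite mform_scale_pure mulr1.
Qed.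

Lemma mform_scaleDl x : {morph mform_scale^~ x : r s / r + s}.
Proof.
move=> r s /=; have [_ h2 _] := mpure_balanced.
apply: (tens_lin_ext (h := fun x => mform_scale r x + mform_scale s x)) x
  => [x y|x y|m w].
- by rewrite mform_scaleDr.
- by rewrite !mform_scaleDr addrACA.
by rewrite !mform_scale_pure mulrDr h2.
Qed.

HB.instance Definition _ := GRing.Zmodule_isLmodule.Build Om^c (mform Om M)
  mform_scaleA mform_scale1 mform_scaleDr mform_scaleDl.

(* elements of the image of M (x) P in M (x) Omega *)
Definition mform_in (P : Om -> Prop) (x : mform Om M) : Prop :=
  exists s : seq (M * Om),
    (forall i, i \in s -> P i.2) /\ x = \sum_(i <- s) mpure i.1 i.2.

Definition is_conn (D : M -> mform Om M) : Prop :=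
  [/\ {morph D : m n / m + n},
      forall (c : K) m, D (rmul m c%:A) = rmul (D m) (c%:A : Om),
      forall m, mform_in (homog 1) (D m) &
      forall m (a : A), D (rmul m a) =
        rmul (D m) (demb Om a) + mpure m (ddiff Om (demb Om a))].

(* D (m (x) w) = D(m) w + m (x) dw *)
Definition cext (D : M -> mform Om M) (x : mform Om M) : mform Om M :=
  tlift (fun m (w : Om) => rmul (D m) w + mpure m (ddiff Om w)) x.

Definition curv (D : M -> mform Om M) (x : mform Om M) : mform Om M :=
  cext D (cext D x).

(* With R = \bigoplus_k Omega_2k and F = M (x)_A R (the even part of
   M (x)_A Omega): R-linear functionals on F, and tr : End_R(F) -> R/[R, R].
   t represents tr f when f is the image of a tensor \sum_i x_i (x) mu_i
   of F (x)_R Hom_R(F, R) and t = \sum_i mu_i (x_i). *)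
Definition even_functional (mu : mform Om M -> Om) : Prop :=
  [/\ forall x, mform_in (@evenf K A Om) x -> evenf (mu x),
      forall x y, mform_in (@evenf K A Om) x -> mform_in (@evenf K A Om) y ->
        mu (x + y) = mu x + mu y &
      forall x (r : Om), mform_in (@evenf K A Om) x -> evenf r ->
        mu (rmul x r) = mu x * r].

Definition is_trace (f : mform Om M -> mform Om M) (t : Om) : Prop :=
  exists n (x : 'I_n -> mform Om M) (mu : 'I_n -> mform Om M -> Om),
    [/\ forall i, mform_in (@evenf K A Om) (x i),
        forall i, even_functional (mu i),
        forall y, mform_in (@evenf K A Om) y ->
          f y = \sum_i rmul (x i) (mu i y) &
        t = \sum_i mu i (x i)].

Definition trace (f : mform Om M -> mform Om M) : Om :=
  choose_or 0 (is_trace f).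

(* representative of tr(D^(2k)) *)
Definition trpow (D : M -> mform Om M) (k : nat) : Om :=
  trace (iter k (curv D)).

Definition finite_from (D : M -> mform Om M) (n : nat) : Prop :=
  forall k, (n <= k)%N -> gcomm (trpow D k).

Definition finite_ch (D : M -> mform Om M) : Prop := exists n, finite_from D n.

(* representative of ch^Ka(D), meaningful when finite_ch D *)
Definition chKa (D : M -> mform Om M) : Om :=
  \sum_(k < choose_or 0 (finite_from D)) (k`!%:R : K)^-1 *: trpow D k.

End ModuleForms.

Arguments mpure {K A} Om {M}.
Arguments is_conn {K A} Om M.

Definition mform_map (K : fieldType) (A : algType K) (Om : dga A)
    (M N : lmodType A^c) (f : M -> N) (x : mform Om M) : mform Om N :=
  tlift (fun m (w : Om) => mpure Om (f m) w) x.

(* phi^* nabla = (phi^-1 (x) id) nabla phi *)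
Definition pullback (K : fieldType) (A : algType K) (Om : dga A)
    (M L : lmodType A^c) (phi : M -> L) (psi : L -> M)
    (D : L -> mform Om L) (m : M) : mform Om M :=
  mform_map psi (D (phi m)).

Section Inclusions.
Context (R : pzRingType) (M N : lmodType R).

Definition pinl (m : M) : M * N := (m, 0).
Definition pinr (n : N) : M * N := (0, n).

Lemma pinl_linear : linear pinl.
Proof. by move=> a m n; congr (_, _); rewrite /= scaler0 addr0. Qed.
HB.instance Definition _ :=
  GRing.isLinear.Build R M (M * N)%type *:%R pinl pinl_linear.

Lemma pinr_linear : linear pinr.
Proof. by move=> a m n; congr (_, _); rewrite /= scaler0 addr0. Qed.
HB.instance Definition _ :=
  GRing.isLinear.Build R N (M * N)%type *:%R pinr pinr_linear.

End Inclusions.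

Definition dsum (K : fieldType) (A : algType K) (Om : dga A)
    (M N : lmodType A^c) (D : M -> mform Om M) (E : N -> mform Om N)
    (p : M * N) : mform Om (M * N)%type :=
  mform_map (@pinl _ M N) (D p.1) + mform_map (@pinr _ M N) (E p.2).

Section DirectSums.
Context (K : fieldType) (A : algType K) (Om : dga A).

Lemma mform_map_balanced (M N : lmodType A^c) (f : {linear M -> N}) :
  balanced (@rmul A M) (fun (a : A) (w : Om) => demb Om a * w)
    (fun m (w : Om) => mpure Om (f m) w).
Proof.
have [h1 h2 h3] := mpure_balanced Om N.
split=> [m m' w|m w w'|m b w]; rewrite -?h2 // -?h1 -?h3 ?raddfD //.
by rewrite /rmul linearZ.
Qed.

Section Map.
Context (M N : lmodType A^c) (f : {linear M -> N}).

Lemma mform_map_pure m w : mform_map f (mpure Om m w) = mpure Om (f m) w.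
Proof. exact: tlift_pure (mform_map_balanced f). Qed.

Lemma mform_mapD : {morph mform_map (Om := Om) f : x y / x + y}.
Proof. exact: tliftD (mform_map_balanced f). Qed.

Lemma mform_map0 : mform_map (Om := Om) f 0 = 0.
Proof. exact: tlift0 (mform_map_balanced f). Qed.

Lemma mform_mapZ (r : Om) x : mform_map f (rmul x r) = rmul (mform_map f x) r.
Proof.
pose g (x : mform Om M) := mform_map f (rmul x r).
pose h (x : mform Om M) := rmul (mform_map f x) r.
rewrite -/(g x) -/(h x); apply: tens_lin_ext x => [x y|x y|m w]; rewrite /g /h.
- by rewrite rmulDl mform_mapD.
- by rewrite mform_mapD rmulDl.
rewrite mform_map_pure [rmul _ _]mform_scale_pure mform_map_pure.
by rewrite [RHS]mform_scale_pure.
Qed.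

Lemma mform_map_in P (x : mform Om M) :
  mform_in P x -> mform_in P (mform_map f x).
Proof.
case=> s [sP ->]; exists [seq (f i.1, i.2) | i <- s]; split.
  by move=> _ /mapP [i /sP Pi ->].
rewrite big_map (big_morph _ mform_mapD mform_map0).
by apply: eq_bigr => i _; rewrite mform_map_pure.
Qed.

End Map.

Lemma mform_inD (M : lmodType A^c) P (x y : mform Om M) :
  mform_in P x -> mform_in P y -> mform_in P (x + y).
Proof.
move=> [s [sP ->]] [t [tP ->]]; exists (s ++ t); split; last by rewrite big_cat.
by move=> i; rewrite mem_cat => /orP[/sP|/tP].
Qed.

Lemma dsum_conn (M N : lmodType A^c) (D : M -> mform Om M) (E : N -> mform Om N) :
  is_conn Om M D -> is_conn Om N E -> is_conn Om (M * N)%type (dsum D E).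
Proof.
move=> [D1 D2 D3 D4] [E1 E2 E3 E4].
have [h1 h2 h3] := mpure_balanced Om (M * N)%type.
split=> [p q|c p|p|p a]; rewrite /dsum.
- by rewrite D1 E1 !mform_mapD addrACA.
- by rewrite D2 E2 !mform_mapZ rmulDl.
- by apply: mform_inD; apply: mform_map_in.
rewrite D4 E4 !mform_mapD !mform_mapZ rmulDl addrACA; congr (_ + _).
rewrite !mform_map_pure -h1; congr mpure.
by case: p => m n; congr (_, _); rewrite /= ?addr0 ?add0r.
Qed.

Lemma zero_conn : is_conn Om 'rV[A^c]_0 (fun=> 0).
Proof.
have [h1 h2 h3] := mpure_balanced Om 'rV[A^c]_0.
split=> [m n|c m|m|m a].
- by rewrite addr0.
- by rewrite /rmul scaler0.
- by exists [::]; split=> //; rewrite big_nil.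
rewrite /rmul scaler0 add0r.
have -> : m = 0 by apply/rowP => -[].
apply/esym/(addrI (mpure Om (0 : 'rV[A^c]_0) (ddiff Om (demb Om a)))).
by rewrite -h1 !addr0.
Qed.

Lemma zero_fgproj : fgproj 'rV[A^c]_0.
Proof. by exists 0%N, idfun, idfun. Qed.

Lemma dsum_fgproj (M N : lmodType A^c) :
  fgproj M -> fgproj N -> fgproj (M * N)%type.
Proof.
move=> [n [i [p pK]]] [n' [i' [p' pK']]].
pose I (x : M * N) := row_mx (i x.1) (i' x.2).
pose P (v : 'rV[A^c]_(n + n')) := (p (lsubmx v), p' (rsubmx v)).
have Il : linear I.
  move=> a x y; rewrite /I scale_row_mx add_row_mx.
  by rewrite [in LHS]linearD [in X in row_mx _ X]linearD /= !linearZ.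
have Pl : linear P.
  move=> a x y; rewrite /P; congr (_, _); rewrite linearP /=;
  by rewrite linearP.
exists (n + n')%N.
pose mI := GRing.isLinear.Build A^c (M * N)%type 'rV[A^c]_(n + n') *:%R I Il.
pose mP := GRing.isLinear.Build A^c 'rV[A^c]_(n + n') (M * N)%type *:%R P Pl.
pose IL : {linear (M * N)%type -> 'rV[A^c]_(n + n')} := HB.pack I mI.
pose PL : {linear 'rV[A^c]_(n + n') -> (M * N)%type} := HB.pack P mP.
exists IL, PL.
by move=> [m m'] /=; rewrite /P /I row_mxKl row_mxKr pK pK'.
Qed.

End DirectSums.

(* Lambda_0 (x)_K M *)
Definition tmod (K : fieldType) (A : algType K) (M : lmodType A^c) : Type :=
  tens (fun (q : {poly K}) (c : K) => c *: q)
       (fun (c : K) (m : M) => rmul m (c%:A : A)).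

Section TMod.
Context (K : fieldType) (A : algType K) (M : lmodType A^c).

HB.instance Definition _ := GRing.Zmodule.on (tmod M).

Definition tmod_pure (q : {poly K}) (m : M) : tmod M := tpure _ _ q m.

Lemma tmod_pure_balanced : balanced (fun (q : {poly K}) (c : K) => c *: q)
  (fun (c : K) (m : M) => rmul m (c%:A : A)) tmod_pure.
Proof. exact: balanced_tpure. Qed.

(* (q (x) m) (a t^i) = q t^i (x) m a *)
Definition tmod_scale (p : (tpoly A)^c) (x : tmod M) : tmod M :=
  tlift (fun (q : {poly K}) m => \sum_(i < size (p : {poly A}))
    tmod_pure (q * 'X^i) (rmul m (p : {poly A})`_i)) x.

Lemma tmod_scaleE (p : {poly A}) n q m : (size p <= n)%N ->
  \sum_(i < size p) tmod_pure (q * 'X^i) (rmul m p`_i) =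
  \sum_(i < n) tmod_pure (q * 'X^i) (rmul m p`_i).
Proof.
move=> h; rewrite -(subnKC h) big_split_ord /= [X in _ = _ + X]big1 ?addr0 //.
move=> i _; rewrite nth_default ?leq_addr // /rmul scale0r.
exact: balanced0r tmod_pure_balanced.
Qed.

Lemma tmod_scale_balanced (p : {poly A}) :
  balanced (fun (q : {poly K}) (c : K) => c *: q)
    (fun (c : K) (m : M) => rmul m (c%:A : A))
    (fun (q : {poly K}) m =>
      \sum_(i < size p) tmod_pure (q * 'X^i) (rmul m p`_i)).
Proof.
have [h1 h2 h3] := tmod_pure_balanced.
split=> [q q' m|q m m'|q c m].
- by rewrite -big_split; apply: eq_bigr => i _; rewrite mulrDl h1.
- by rewrite -big_split; apply: eq_bigr => i _; rewrite rmulDl h2.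
apply: eq_bigr => i _; rewrite -scalerAl h3; congr tmod_pure.
by rewrite !rmulA -scalerAl -scalerAr mul1r mulr1.
Qed.

Lemma tmod_scale_pure (p : {poly A}) n q m : (size p <= n)%N ->
  tmod_scale p (tmod_pure q m) =
  \sum_(i < n) tmod_pure (q * 'X^i) (rmul m p`_i).
Proof.
by move=> h; rewrite -tmod_scaleE //; exact: tlift_pure (tmod_scale_balanced p).
Qed.

Lemma tmod_scaleDr : right_distributive tmod_scale +%R.
Proof. by move=> p x y; apply: tliftD (tmod_scale_balanced p) _ _. Qed.

Lemma tmod_scale0 p : tmod_scale p 0 = 0.
Proof. exact: tlift0 (tmod_scale_balanced p). Qed.

Lemma tmod_scaleDl x : {morph tmod_scale^~ x : p r / p + r}.
Proof.
move=> p r /=; pose g x := tmod_scale p x + tmod_scale r x.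
rewrite -/(g x); apply: tens_lin_ext x => [x y|x y|q m]; rewrite /g.
- by rewrite tmod_scaleDr.
- by rewrite !tmod_scaleDr addrACA.
pose n := maxn (size (p : {poly A})) (size (r : {poly A})).
have [h1 h2 h3] := tmod_pure_balanced.
rewrite !(@tmod_scale_pure _ n) ?leq_maxl ?leq_maxr //; last exact: size_polyD.
by rewrite -big_split; apply: eq_bigr => i _; rewrite coefD rmulDr h2.
Qed.

Lemma tmod_scaleC a i q m :
  tmod_scale (a%:P * 'X^i : {poly A}) (tmod_pure q m) =
  tmod_pure (q * 'X^i) (rmul m a).
Proof.
rewrite (@tmod_scale_pure _ i.+1); last first.
  by apply/leq_sizeP => j ij; rewrite coefCM coefXn gtn_eqF ?mulr0.
rewrite big_ord_recr /= coefCM coefXn eqxx mulr1 big1 ?add0r // => j _.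
rewrite coefCM coefXn ltn_eqF // mulr0 /rmul scale0r.
exact: balanced0r tmod_pure_balanced.
Qed.

Lemma poly_elim (P : {poly A} -> Prop) :
  (forall a i, P (a%:P * 'X^i)) -> P 0 ->
  (forall p q, P p -> P q -> P (p + q)) -> forall p, P p.
Proof.
move=> h h0 hD p; rewrite -[p]coefK poly_def; elim/big_ind: _ => // i _.
by rewrite -mul_polyC.
Qed.

Lemma tmod_scale0l x : tmod_scale (0 : tpoly A) x = 0.
Proof.
by apply: (addrI (tmod_scale (0 : tpoly A) x)); rewrite -tmod_scaleDl !addr0.
Qed.

Lemma tmod_scaleA (p r : (tpoly A)^c) x :
  tmod_scale p (tmod_scale r x) = tmod_scale (p * r) x.
Proof.
elim/poly_elim: p => [a i||p p' IH IH'].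
- elim/poly_elim: r => [b j||r r' IH IH'].
  + pose g x := tmod_scale (a%:P * 'X^i : {poly A})
      (tmod_scale (b%:P * 'X^j : {poly A}) x).
    rewrite -/(g x); apply: tens_lin_ext x => [x y|x y|q m]; rewrite /g.
    * by rewrite !tmod_scaleDr.
    * by rewrite tmod_scaleDr.
    rewrite !tmod_scaleC.
    have -> : ((a%:P * 'X^i : (tpoly A)^c) * (b%:P * 'X^j : (tpoly A)^c) : {poly A})
        = (b * a)%:P * 'X^(j + i).
      rewrite /= [LHS](_ : _ = (b%:P * 'X^j) * (a%:P * 'X^i) :> {poly A}) //.
      by rewrite -mulrA (mulrA 'X^j) -commr_polyXn -mulrA -exprD mulrA polyCM.
    by rewrite tmod_scaleC rmulA exprD mulrA.
  + by rewrite mulr0 tmod_scale0l tmod_scale0.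
  by rewrite tmod_scaleDl tmod_scaleDr IH IH' mulrDr tmod_scaleDl.
- by rewrite mul0r !tmod_scale0l.
by rewrite tmod_scaleDl IH IH' mulrDl tmod_scaleDl.
Qed.

Lemma tmod_scale1 : left_id 1 tmod_scale.
Proof.
apply: tens_lin_ext => [x y|//|q m]; first by rewrite tmod_scaleDr.
have -> : (1 : (tpoly A)^c) = 1%:P * 'X^0 :> {poly A} by rewrite mulr1.
by rewrite [LHS]tmod_scaleC mulr1 rmul1.
Qed.

HB.instance Definition _ := GRing.Zmodule_isLmodule.Build (tpoly A)^c (tmod M)
  tmod_scaleA tmod_scale1 tmod_scaleDr tmod_scaleDl.

End TMod.

(* Lambda_0 (x)_K (M (x)_A Omega) *)
Definition pform (K : fieldType) (A : algType K) (Om : dga A)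
    (M : lmodType A^c) : Type :=
  tens (fun (q : {poly K}) (c : K) => c *: q)
       (fun (c : K) (x : mform Om M) => rmul x (c%:A : Om)).

Section Paths.
Context (K : fieldType) (A : algType K) (Om : dga A) (M : lmodType A^c).

HB.instance Definition _ := GRing.Zmodule.on (pform Om M).

Definition ppure (q : {poly K}) (x : mform Om M) : pform Om M := tpure _ _ q x.

Definition pmull (q : {poly K}) (y : pform Om M) : pform Om M :=
  tlift (fun (r : {poly K}) x => ppure (q * r) x) y.
Definition pmulr (y : pform Om M) (w : Om) : pform Om M :=
  tlift (fun (r : {poly K}) x => ppure r (rmul x w)) y.

Definition peval (c : K) (y : pform Om M) : mform Om M :=
  tlift (fun (q : {poly K}) x => rmul x (q.[c]%:A : Om)) y.

Definition is_path (D : M -> pform Om M) : Prop :=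
  [/\ {morph D : m n / m + n},
      forall (c : K) m, D (rmul m c%:A) = pmull c%:P (D m),
      forall m, exists s : seq ({poly K} * mform Om M),
        (forall p, p \in s -> mform_in (homog 1) p.2) /\
        D m = \sum_(p <- s) ppure p.1 p.2 &
      forall m (a : A), D (rmul m a) =
        ppure 1 (mpure Om m (ddiff Om (demb Om a))) + pmulr (D m) (demb Om a)].

Definition path_from_to (D : M -> pform Om M) (D0 D1 : M -> mform Om M) : Prop :=
  [/\ is_path D, forall m, peval 0 (D m) = D0 m &
      forall m, peval 1 (D m) = D1 m].

Definition affine_path (D0 D1 : M -> mform Om M) (m : M) : pform Om M :=
  ppure (1 - 'X) (D0 m) + ppure 'X (D1 m).

(* q (x) m (x) w |-> (q (x) m) (x) (1 (x) w) *)
Definition pform_cyl (y : pform Om M) : mform (cyl Om) (tmod M) :=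
  tlift (fun (q : {poly K}) (x : mform Om M) =>
    tlift (fun m (w : Om) =>
      mpure (cyl Om) (tmod_pure q m) (Cyl w%:P 0 : cyl Om)) x) y.

(* q (x) m |-> dq (x) m + q D(m) *)
Definition path_conn (D : M -> pform Om M) (x : tmod M) : mform (cyl Om) (tmod M) :=
  tlift (fun (q : {poly K}) m =>
    mpure (cyl Om) (tmod_pure 1 m)
      (Cyl 0 (map_poly (in_alg Om) (q^`())) : cyl Om) +
    pform_cyl (pmull q (D m))) x.

Definition KCS (D : M -> pform Om M) : Om := fiber_int (chKa (path_conn D)).

End Paths.

(* An abelian group presented as a subquotient of a type: its elements are the
   members gmem of the carrier, up to the relation geqv. Grothendieck groups of
   modules live in a larger universe than zmodType, hence this presentation. *)
Record pgroup := PGroup {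
  gcar :> Type;
  gmem : gcar -> Prop;
  geqv : gcar -> gcar -> Prop;
  gadd : gcar -> gcar -> gcar;
  gzero : gcar;
  gopp : gcar -> gcar
}.

Definition is_abgroup (G : pgroup) : Prop :=
  [/\ [/\ gmem (gzero G), forall x, gmem x -> gmem (gopp x :> G) &
          forall x y, gmem x -> gmem y -> gmem (gadd x y :> G)],
      [/\ forall x : G, gmem x -> geqv x x,
          forall x y : G, gmem x -> gmem y -> geqv x y -> geqv y x &
          forall x y z : G, gmem x -> gmem y -> gmem z ->
            geqv x y -> geqv y z -> geqv x z],
      (forall x x' y y' : G, gmem x -> gmem x' -> gmem y -> gmem y' ->
          geqv x x' -> geqv y y' -> geqv (gadd x y) (gadd x' y')) /\
      (forall x x' : G, gmem x -> gmem x' ->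
          geqv x x' -> geqv (gopp x) (gopp x')) &
      [/\ forall x y z : G, gmem x -> gmem y -> gmem z ->
            geqv (gadd x (gadd y z)) (gadd (gadd x y) z),
          forall x y : G, gmem x -> gmem y -> geqv (gadd x y) (gadd y x),
          forall x : G, gmem x -> geqv (gadd (gzero G) x) x &
          forall x : G, gmem x -> geqv (gadd (gopp x) x) (gzero G)]].

Definition is_hom (G H : pgroup) (f : G -> H) : Prop :=
  [/\ forall x, gmem x -> gmem (f x),
      forall x y, gmem x -> gmem y -> geqv x y -> geqv (f x) (f y) &
      forall x y, gmem x -> gmem y -> geqv (f (gadd x y)) (gadd (f x) (f y))].

Definition inj_hom (G H : pgroup) (f : G -> H) : Prop :=
  forall x, gmem x -> geqv (f x) (gzero H) -> geqv x (gzero G).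

Definition surj_hom (G H : pgroup) (f : G -> H) : Prop :=
  forall y, gmem y -> exists2 x, gmem x & geqv (f x) y.

Definition exact_at (G H L : pgroup) (f : G -> H) (g : H -> L) : Prop :=
  forall y, gmem y ->
    (geqv (g y) (gzero L) <-> exists2 x, gmem x & geqv (f x) y).

Definition short_exact (G H L : pgroup) (f : G -> H) (g : H -> L) : Prop :=
  [/\ inj_hom f, exact_at f g & surj_hom g].

Record pmonoid := PMonoid {
  mcar :> Type;
  mmem : mcar -> Prop;
  meqv : mcar -> mcar -> Prop;
  madd : mcar -> mcar -> mcar;
  mzero : mcar
}.

(* Grothendieck group: the pair (x, y) stands for [x] - [y]. *)
Definition groth (S : pmonoid) : pgroup := {|
  gcar := S * S;
  gmem := fun x => mmem x.1 /\ mmem x.2;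
  geqv := fun x y => exists2 z : S, mmem z &
    meqv (madd (madd x.1 y.2) z) (madd (madd y.1 x.2) z);
  gadd := fun x y => (madd x.1 y.1, madd x.2 y.2);
  gzero := (mzero S, mzero S);
  gopp := fun x => (x.2, x.1)
|}.

Section FgpModules.
Context (K : fieldType) (A : algType K).

Record fgpmod := FgpMod { fmod :> lmodType A^c; fmodP : fgproj fmod }.

Definition fgp_sum (M N : fgpmod) : fgpmod :=
  FgpMod (dsum_fgproj (fmodP M) (fmodP N)).

Definition fgp_zero : fgpmod := FgpMod (zero_fgproj A).

Definition fgp_iso (M N : fgpmod) : Prop :=
  exists (f : {linear M -> N}) (g : {linear N -> M}), cancel f g /\ cancel g f.

Definition Kzero : pgroup := groth {|
  mcar := fgpmod;
  mmem := fun=> True;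
  meqv := fgp_iso;
  madd := fgp_sum;
  mzero := fgp_zero
|}.

End FgpModules.

Section Hexagon.
Context (K : fieldType) (A : algType K) (Om : dga A).

(* Omega_even^ab is a direct sum and not a product: the series defining
   ch^Ka(D), for connections and for paths of connections, have to be finite. *)
Definition finite_chern : Prop :=
  (forall (M : fgpmod A) (D : M -> mform Om M),
     is_conn Om M D -> finite_ch D) /\
  (forall (M : fgpmod A) (D : M -> pform Om M),
     is_path D -> finite_ch (path_conn D)).

Definition form_group (P E : Om -> Prop) : pgroup := {|
  gcar := Om;
  gmem := P;
  geqv := fun u v => E (u - v);
  gadd := +%R;
  gzero := 0;
  gopp := -%R
|}.

Definition HdR_even : pgroup :=
  form_group (fun w => evenf w /\ closedf w) (exact_by (@oddf K A Om)).
Definition HdR_odd : pgroup :=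
  form_group (fun w => oddf w /\ closedf w) (exact_by (@evenf K A Om)).

Definition chK (x : Kzero A) : HdR_even :=
  let ch (M : fgpmod A) := chKa (choose_or (fun=> 0) (is_conn Om M)) in
  ch x.1 - ch x.2.

Definition Omega_ch0 : pgroup :=
  form_group (fun w => [/\ evenf w, closedf w &
      exists2 x : Kzero A, gmem x & geqv (chK x) (w : HdR_even)])
    (@gcomm K A Om).

Definition ch1 : Om -> Prop := gensub (fun w =>
  exact_by (@evenf K A Om) w \/
  exists (M : fgpmod A) (D : M -> mform Om M) (phi psi : {linear M -> M}),
    [/\ is_conn Om M D, cancel phi psi, cancel psi phi &
        w = KCS (affine_path D (pullback phi psi D))]).

(* Omega_odd^ab / Omega_ch1 *)
Definition Omega_odd_ch1 : pgroup := form_group (@oddf K A Om) ch1.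

(* KCS(D0, D1) = w modulo Im(d) *)
Definition KCS_class (M : lmodType A^c) (D0 D1 : M -> mform Om M) (w : Om) : Prop :=
  exists2 D, path_from_to D D0 D1 & exact_by (@evenf K A Om) (KCS D - w).

Record khat_gen := KhatGen {
  kmod : fgpmod A;
  kconn : kmod -> mform Om kmod;
  kconnP : is_conn Om kmod kconn;
  kform : Om
}.

Definition khat_sum (g h : khat_gen) : khat_gen :=
  @KhatGen (fgp_sum (kmod g) (kmod h)) (dsum (@kconn g) (@kconn h))
    (dsum_conn (kconnP g) (kconnP h)) (kform g + kform h).

(* (O, 0, w) *)
Definition khat_form (w : Om) : khat_gen :=
  @KhatGen (fgp_zero A) (fun=> 0) (zero_conn Om) w.

Definition khat_eqv (g0 g1 : khat_gen) : Prop :=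
  exists (N : fgpmod A) (D : N -> mform Om N)
      (phi : {linear (kmod g0 * N)%type -> (kmod g1 * N)%type})
      (psi : {linear (kmod g1 * N)%type -> (kmod g0 * N)%type}),
    [/\ is_conn Om N D, cancel phi psi, cancel psi phi &
        KCS_class (dsum (@kconn g0) D) (pullback phi psi (dsum (@kconn g1) D))
          (kform g0 - kform g1)].

Definition Khat : pgroup := groth {|
  mcar := khat_gen;
  mmem := fun g => oddf (kform g);
  meqv := khat_eqv;
  madd := khat_sum;
  mzero := khat_form 0
|}.

Definition hexI (x : Khat) : Kzero A := (kmod x.1, kmod x.2).

Definition hexR (x : Khat) : Omega_ch0 :=
  let R (g : khat_gen) := chKa (@kconn g) + ddiff Om (kform g) in
  R x.1 - R x.2.

Definition MK : pgroup := {|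
  gcar := Khat;
  gmem := fun x : Khat => gmem x /\ geqv (hexR x) (gzero Omega_ch0);
  geqv := @geqv Khat;
  gadd := @gadd Khat;
  gzero := gzero Khat;
  gopp := @gopp Khat
|}.

Definition hex_incl (x : MK) : Khat := x.

Definition hexa (w : Omega_odd_ch1) : Khat := (khat_form w, khat_form 0).

Definition hex_alpha (w : HdR_odd) : MK := (khat_form w, khat_form 0).

Definition hex_beta (x : MK) : Kzero A := (kmod x.1, kmod x.2).

Definition hex_r (w : HdR_odd) : Omega_odd_ch1 := w.

Definition hex_d (w : Omega_odd_ch1) : Omega_ch0 := ddiff Om w.

Definition hexPr (w : Omega_ch0) : HdR_even := w.

End Hexagon.

Arguments finite_chern {K A} Om.
Arguments HdR_even {K A} Om.
Arguments HdR_odd {K A} Om.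
Arguments chK {K A} Om.
Arguments Omega_ch0 {K A} Om.
Arguments Omega_odd_ch1 {K A} Om.
Arguments Khat {K A} Om.
Arguments MK {K A} Om.
Arguments hexI {K A} Om.
Arguments hexR {K A} Om.
Arguments hex_incl {K A} Om.
Arguments hexa {K A} Om.
Arguments hex_alpha {K A} Om.
Arguments hex_beta {K A} Om.
Arguments hex_r {K A} Om.
Arguments hex_d {K A} Om.
Arguments hexPr {K A} Om.

(* Main.v *)
(* Coordinates on M coming from a presentation of M as a direct summand of A^n turn a
   connection into a pair (e, Th) of an even idempotent matrix and an odd matrix of
   forms, with curvature matrix C = Th Th + e dTh; modulo graded commutators tr(D^2k)
   is tr(C^k e), which is closed by the Bianchi identity. A path of connections is a
   pair of this kind over the cylinder, so that Stokes' formula for the fibre integral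
   gives d KCS(P) = ch(P_1) - ch(P_0). Applying this again over the cylinder of the
   cylinder compares two paths with the same origin:
   KCS(P') - KCS(P) = KCS(P_1 -> P'_1) modulo exact forms, whence the independence of
   the path and the additivity of KCS under composition. So KCS behaves as a cocycle
   on isomorphisms of modules with connection, triples (M, D, w) form a commutative
   monoid up to isomorphisms with KCS = w_0 - w_1, and Omega_ch1 consists of the forms
   w such that (M, D, w + eta) is isomorphic to (M, D, eta) for some (M, D, eta). The
   exactness statements follow by unwinding the definitions. *)
From HB Require Import structures.
From mathcomp Require Import all_boot all_order all_algebra.
From mathcomp Require Import boolp.
Require Import Defs.

Set Implicit Arguments.
Unset Strict Implicit.
Unset Printing Implicit Defensive.

Import GRing.Theory.
Local Open Scope ring_scope.

(** * Graded commutators and exact forms *)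

(** No quotient of forms is constructed: a class modulo graded commutators is a representative in
    [Om], and a trace is picked by choice among all its presentations, so equalities of Chern forms
    hold only modulo [gcomm]. Each [chKa] is moreover cut off at an order chosen for its own
    connection; identities are proved for the k-th term of coordinate matrices and compared at an
    order beyond all the cut-offs involved. Signs are carried by the automorphism [sgnf], equal to
    (-1)^n in degree n: as 2 is invertible, even forms are exactly its fixed points, which replaces
    degree bookkeeping for matrices. Invertibility of i+1 is used in Stokes' formula. The cylinder
    of a [dga] is again a [dga], so one matrix calculus serves for forms, for paths and for
    homotopies of paths. There is no cancellation of modules: the stabilising summands of [khat_eqv]
    and of the Grothendieck construction are merged into one, so that an equality in [Khat] is
    witnessed by a single isomorphism, from which the kernels are read off. *)

Section GeneratedSubgroup.
Context (V : zmodType) (S : V -> Prop).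

Lemma gensubN x : gensub S x -> gensub S (- x).
Proof. by rewrite -sub0r; apply: gensubB; exact: gensub0. Qed.

Lemma gensubD x y : gensub S x -> gensub S y -> gensub S (x + y).
Proof. by move=> hx hy; rewrite -[y]opprK; apply/gensubB/gensubN. Qed.

Lemma gensub_sum I (r : seq I) (P : pred I) (F : I -> V) :
  (forall i, P i -> gensub S (F i)) -> gensub S (\sum_(i <- r | P i) F i).
Proof. by move=> h; elim/big_ind: _ => //; [exact: gensub0 | exact: gensubD]. Qed.

End GeneratedSubgroup.

Section Forms.
Context (K : fieldType) (A : algType K) (Om : dga A).
Implicit Types u v w h : Om.

Lemma gcommB u v : gcomm u -> gcomm v -> gcomm (u - v).
Proof. exact: gensubB. Qed.
Lemma gcommD u v : gcomm u -> gcomm v -> gcomm (u + v).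
Proof. exact: gensubD. Qed.
Lemma gcommN u : gcomm u -> gcomm (- u).
Proof. exact: gensubN. Qed.
Lemma gcomm0 : gcomm (0 : Om).
Proof. exact: gensub0. Qed.
Lemma gcomm_sum I (r : seq I) (P : pred I) (F : I -> Om) :
  (forall i, P i -> gcomm (F i)) -> gcomm (\sum_(i <- r | P i) F i).
Proof. exact: gensub_sum. Qed.

Lemma gcomm_comm i j u v : homog i u -> homog j v ->
  gcomm (u * v - (-1) ^+ (i * j) * (v * u)).
Proof.
by move=> hu hv; apply: gensub_mem; exists 1, i, j, u, v; rewrite scale1r.
Qed.

Lemma gcommZ (c : K) w : gcomm w -> gcomm (c *: w).
Proof.
elim=> {w} [w [a [i [j [u [v [hu hv ->]]]]]]||x y _ hx _ hy].
- by apply: gensub_mem; exists (c * a), i, j, u, v; rewrite scalerA.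
- by rewrite scaler0; exact: gcomm0.
by rewrite scalerBr; exact: gcommB.
Qed.

Lemma gcomm_sign n w : gcomm w -> gcomm ((-1) ^+ n * w).
Proof.
rewrite -signr_odd; case: odd; rewrite ?expr0 ?mul1r // expr1 mulN1r.
exact: gcommN.
Qed.

Lemma gcomm_trans v u w : gcomm (u - v) -> gcomm (v - w) -> gcomm (u - w).
Proof. by move=> h h'; rewrite -(subrKA v); exact: gcommD. Qed.

Lemma gcomm_sub2 u u' v v' :
  gcomm (u - u') -> gcomm (v - v') -> gcomm (u - v - (u' - v')).
Proof. by rewrite opprD addrACA -opprD; exact: gcommB. Qed.

Lemma gcomm_congr v u : gcomm (u - v) -> gcomm v -> gcomm u.
Proof. by move=> h hv; rewrite -(subrK v u); exact: gcommD. Qed.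

Lemma gcomm_sym u v : gcomm (u - v) -> gcomm (v - u).
Proof. by move/gcommN; rewrite opprB. Qed.

Lemma ddiff_sign n w : ddiff Om ((-1) ^+ n * w) = (-1) ^+ n * ddiff Om w.
Proof.
rewrite -signr_odd; case: odd; rewrite ?expr0 ?mul1r // expr1 !mulN1r.
exact: raddfN.
Qed.

Lemma homog_ddiff n w : homog n w -> homog n.+1 (ddiff Om w).
Proof. by rewrite /homog => <-; exact: ddiff_deg. Qed.

Lemma ddiffMh n u v : homog n u ->
  ddiff Om (u * v) = ddiff Om u * v + (-1) ^+ n * (u * ddiff Om v).
Proof. by move=> <-; exact: ddiffM. Qed.

Lemma ddiff1 : ddiff Om 1 = 0.
Proof.
have := ddiffMs (1 : Om) 1; rewrite sgnf1 !mulr1 mul1r => e.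
by apply: (addrI (ddiff Om 1)); rewrite -e addr0.
Qed.

Lemma demb_scal (c : K) : demb Om c%:A = c%:A.
Proof. by rewrite linearZ /= rmorph1. Qed.

Lemma ddiff_scal (c : K) : ddiff Om (demb Om c%:A) = 0.
Proof. by rewrite demb_scal linearZ /= ddiff1 scaler0. Qed.

Lemma homog0 n : homog n (0 : Om).
Proof. exact: raddf0. Qed.
Lemma homogD n u v : homog n u -> homog n v -> homog n (u + v).
Proof. by rewrite /homog => hu hv; rewrite raddfD /= hu hv. Qed.
Lemma homogZ n (c : K) u : homog n u -> homog n (c *: u).
Proof. by rewrite /homog => hu; rewrite linearZ /= hu. Qed.
Lemma homog_sum n I (r : seq I) (F : I -> Om) :
  (forall i, homog n (F i)) -> homog n (\sum_(i <- r) F i).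
Proof. by move=> h; elim/big_ind: _ => //; [exact: homog0 | exact: homogD]. Qed.

(** The Leibniz rule gives d[u, v] = [du, v] + (-1)^i [u, dv] for graded commutators with u of
    degree i, so [d] descends to the abelianization. *)
Lemma gcomm_ddiff w : gcomm w -> gcomm (ddiff Om w).
Proof.
elim=> {w} [w [c [i [j [u [v [hu hv ->]]]]]]||x y _ hx _ hy]; last 2 first.
- by rewrite raddf0; exact: gcomm0.
- by rewrite raddfB; exact: gcommB.
rewrite linearZ /= raddfB /= ddiff_sign (ddiffMh _ hu) (ddiffMh _ hv).
apply: gcommZ.
have h1 := gcomm_comm (homog_ddiff hu) hv.
have h2 := gcomm_sign i (gcomm_comm hu (homog_ddiff hv)).
(* The signs match because i + i(j+1) = 2i + ij. *)
have:= gcommD h1 h2; rewrite mulrBr (mulrA ((-1) ^+ i) _ (_ * u)) -exprD mulnS.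
rewrite addnA addnn exprD -[(-1) ^+ i.*2]signr_odd odd_double expr0 mul1r.
rewrite mulSnr exprD -[_ * _ * (v * _)]mulrA => h.
by rewrite mulrDr opprD [X in _ + X]addrC addrACA.
Qed.

Lemma dproj_ext u v : (forall n, dproj Om n u = dproj Om n v) -> u = v.
Proof.
move=> e; have [n -> ->] := dproj_fin2 u v.
by apply: eq_bigr => i _; rewrite e.
Qed.

Lemma homog_dproj n w : homog n (dproj Om n w).
Proof. by rewrite /homog dprojK eqxx. Qed.

(** The sign (-1)^(ij) is trivial for even i, whatever the degrees of the components of [v].
    Cyclicity of traces rests on this. *)
Lemma gcomm_even u v : evenf u -> gcomm (u * v - v * u).
Proof.
move=> eu; have [n -> ev] := dproj_fin2 u v.
rewrite mulr_suml mulr_sumr -sumrB; apply: gcomm_sum => i _.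
rewrite ev mulr_sumr mulr_suml -sumrB; apply: gcomm_sum => j _.
have [oi|ei] := boolP (odd i).
  by rewrite eu // mul0r mulr0 subrr; exact: gcomm0.
have := gcomm_comm (homog_dproj i u) (homog_dproj j v).
by rewrite -signr_odd oddM (negbTE ei) expr0 mul1r.
Qed.

Lemma homog_sgnf n w : homog n w -> sgnf w = (-1) ^+ n * w.
Proof. by move=> hw; rewrite -[in LHS]hw sgnf_dproj hw. Qed.

Lemma sgnf_even w : evenf w -> sgnf w = w.
Proof.
move=> ew; apply: dproj_ext => n; rewrite dproj_sgnf -signr_odd.
by have [/ew ->|_] := boolP (odd n); rewrite ?mulr0 // expr0 mul1r.
Qed.

Lemma evenf0 : evenf (0 : Om).
Proof. by move=> n _; rewrite raddf0. Qed.
Lemma evenfB u v : evenf u -> evenf v -> evenf (u - v).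
Proof. by move=> hu hv n on; rewrite raddfB /= hu // hv // subr0. Qed.
Lemma oddf0 : oddf (0 : Om).
Proof. by move=> n _; rewrite raddf0. Qed.
Lemma oddfB u v : oddf u -> oddf v -> oddf (u - v).
Proof. by move=> hu hv n on; rewrite raddfB /= hu // hv // subr0. Qed.
Lemma evenfD u v : evenf u -> evenf v -> evenf (u + v).
Proof. by move=> hu hv n on; rewrite raddfD /= hu // hv // addr0. Qed.
Lemma oddfD u v : oddf u -> oddf v -> oddf (u + v).
Proof. by move=> hu hv n on; rewrite raddfD /= hu // hv // addr0. Qed.
Lemma oddfN u : oddf u -> oddf (- u).
Proof. by rewrite -sub0r; apply: oddfB; exact: oddf0. Qed.
Lemma evenfZ (c : K) u : evenf u -> evenf (c *: u).
Proof. by move=> hu n on; rewrite linearZ /= hu // scaler0. Qed.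

Lemma evenf_sum I (r : seq I) (P : pred I) (F : I -> Om) :
  (forall i, P i -> evenf (F i)) -> evenf (\sum_(i <- r | P i) F i).
Proof. by move=> h; elim/big_ind: _ => //; [exact: evenf0 | exact: evenfD]. Qed.

Lemma dproj_ddiff_parity (b : bool) w :
  (forall i, odd i = b -> dproj Om i w = 0) ->
  forall i, odd i = ~~ b -> dproj Om i (ddiff Om w) = 0.
Proof.
move=> h i oi; have [n ->] := dproj_fin w; rewrite !raddf_sum /= big1 // => j _.
rewrite -ddiff_deg dprojK; case: eqP => // e; rewrite h ?raddf0 //.
by move: oi; rewrite e /= => /(congr1 negb); rewrite !negbK.
Qed.

Lemma evenf_ddiff w : oddf w -> evenf (ddiff Om w).
Proof.
move=> h i oi; apply: (@dproj_ddiff_parity false) => // j oj.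
by apply: h; rewrite oj.
Qed.

Lemma oddfZ (c : K) u : oddf u -> oddf (c *: u).
Proof. by move=> hu n on; rewrite linearZ /= hu // scaler0. Qed.

(** Abstracts the parity of primitives, so that exactness of odd forms (even primitives) and of even
    forms (odd primitives) is treated once. *)
Definition lin_closed (P : Om -> Prop) : Prop :=
  [/\ P 0, forall u v, P u -> P v -> P (u - v) & forall (c : K) u, P u -> P (c *: u)].

Lemma evenf_lin : lin_closed (@evenf K A Om).
Proof. split; [exact: evenf0 | exact: evenfB | exact: evenfZ]. Qed.
Lemma oddf_lin : lin_closed (@oddf K A Om).
Proof. split; [exact: oddf0 | exact: oddfB | exact: oddfZ]. Qed.

Section ExactForms.
Context (P : Om -> Prop) (linP : lin_closed P).

Lemma gcomm_exact w : gcomm w -> exact_by P w.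
Proof. by have [P0 _ _] := linP; exists 0 => //; rewrite raddf0 subr0. Qed.

Lemma exact0 : exact_by P 0.
Proof. exact/gcomm_exact/gcomm0. Qed.

Lemma exact_ddiff h : P h -> exact_by P (ddiff Om h).
Proof. by exists h => //; rewrite subrr; exact: gcomm0. Qed.

Lemma exact_byB u v : exact_by P u -> exact_by P v -> exact_by P (u - v).
Proof.
have [_ PB _] := linP.
move=> [h Ph uh] [h' Ph' vh']; exists (h - h'); first exact: PB.
by rewrite raddfB opprD addrACA -opprD; exact: gcommB.
Qed.

Lemma exact_sub2 u u' v v' : exact_by P (u - u') -> exact_by P (v - v') ->
  exact_by P (u - v - (u' - v')).
Proof. by rewrite opprD addrACA -opprD; exact: exact_byB. Qed.

Lemma exact_byN u : exact_by P u -> exact_by P (- u).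
Proof. by rewrite -sub0r; apply: exact_byB; exact: exact0. Qed.

Lemma exact_byD u v : exact_by P u -> exact_by P v -> exact_by P (u + v).
Proof. by move=> hu hv; rewrite -[v]opprK; apply/exact_byB/exact_byN. Qed.

Lemma exact_byZ (c : K) u : exact_by P u -> exact_by P (c *: u).
Proof.
have [_ _ PZ] := linP; move=> [h Ph uh]; exists (c *: h); first exact: PZ.
by rewrite linearZ /= -scalerBr; exact: gcommZ.
Qed.

Lemma exact_by_sum I (r : seq I) (F : I -> Om) :
  (forall i, exact_by P (F i)) -> exact_by P (\sum_(i <- r) F i).
Proof. by move=> h; elim/big_ind: _ => //; [exact: exact0 | exact: exact_byD]. Qed.

Lemma exact_trans v u w : exact_by P (u - v) -> exact_by P (v - w) -> exact_by P (u - w).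
Proof. by move=> h h'; rewrite -(subrKA v); exact: exact_byD. Qed.

Lemma exact_sym u v : exact_by P (u - v) -> exact_by P (v - u).
Proof. by move/exact_byN; rewrite opprB. Qed.

Lemma exact_subl u v : exact_by P (u - v) -> exact_by P v -> exact_by P u.
Proof. by move=> h hv; rewrite -(subrK v u); exact: exact_byD. Qed.

Lemma exact_congr u v : gcomm (u - v) -> exact_by P v -> exact_by P u.
Proof. by move=> h hv; rewrite -(subrK v u); apply: exact_byD => //; exact: gcomm_exact. Qed.

Lemma closed_exact w : exact_by P w -> closedf w.
Proof.
move=> [h _ hw]; have := gcomm_ddiff hw.
by rewrite raddfB /= ddiffK subr0.
Qed.

End ExactForms.

Hypothesis charK : [pchar K] =i pred0.

Lemma addself_eq0 w : w = - w -> w = 0.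
Proof.
move/eqP; rewrite -addr_eq0 -mulr2n -scaler_nat => /eqP h.
have u2 : (2%:R : K) != 0 by have := charK 2; rewrite !inE => /= ->.
by rewrite -[w]scale1r -(mulVf u2) -scalerA h scaler0.
Qed.

(** Odd components change sign under [sgnf] and 2 is invertible, so a fixed form has none. Evenness
    of products then follows from multiplicativity of [sgnf]. *)
Lemma evenfP w : evenf w <-> sgnf w = w.
Proof.
split=> [|e n on]; first exact: sgnf_even.
by apply: addself_eq0; rewrite -{1}e dproj_sgnf -signr_odd on expr1 mulN1r.
Qed.

End Forms.

(** * The cylinder: evaluations, functoriality, Stokes *)

Lemma comm_scal (R : pzRingType) (B : algType R) (c : R) (w : B) : c%:A * w = w * c%:A.
Proof. by rewrite -scalerAl -scalerAr mul1r mulr1. Qed.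

Section CylinderMaps.
Context (K : fieldType) (A : algType K) (Om : dga A).
Implicit Types x y : cylf Om.

(** Pullback of forms along the projection of the cylinder onto its base. *)
Definition cyl_cst (w : Om) : cylf Om := Cyl w%:P 0.

Lemma cyl_cst_linear : linear cyl_cst.
Proof.
move=> a u v; congr Cyl; last by rewrite [LHS](_ : _ = a *: (0 : tpoly Om) + 0) // scaler0 addr0.
rewrite polyCD; congr (_ + _); apply/polyP => i.
by rewrite tpoly_coefZ !coefC; case: eqP; rewrite ?scaler0.
Qed.
HB.instance Definition _ :=
  GRing.isLinear.Build K Om (cylf Om) *:%R cyl_cst cyl_cst_linear.

Lemma cyl_cst_monoid : monoid_morphism cyl_cst.
Proof. by split=> // u v; congr Cyl; rewrite /= ?polyCM // mul0r mulr0 addr0. Qed.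
HB.instance Definition _ :=
  GRing.isMonoidMorphism.Build Om (cylf Om) cyl_cst cyl_cst_monoid.

Lemma cyl_cst_ddiff w : cyl_cst (ddiff Om w) = ddiff (cyl Om) (cyl_cst w).
Proof.
have e : pdiff w%:P = (ddiff Om w)%:P.
  by apply/polyP => i; rewrite coef_pdiff !coefC; case: eqP; rewrite ?raddf0.
by rewrite [RHS](_ : _ = Cyl (pdiff w%:P) (w%:P^`() - pdiff 0)) // e derivC raddf0 subr0.
Qed.

(** Restriction to the slice t = c, which kills dt. It is multiplicative over the noncommutative
    [Om] because the point [c%:A] is central. *)
Definition cyl_eval (c : K) x : Om := (cylP x).[c%:A].

Lemma cyl_eval_linear c : linear (cyl_eval c).
Proof.
move=> a x y; rewrite /cyl_eval hornerD; congr (_ + _).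
rewrite [cylP _](_ : _ = a%:A *: cylP x) // hornerZ.
by rewrite -scalerAl mul1r.
Qed.
HB.instance Definition _ c :=
  GRing.isLinear.Build K (cylf Om) Om *:%R (cyl_eval c) (cyl_eval_linear c).

Lemma cyl_eval_monoid c : monoid_morphism (cyl_eval c).
Proof.
split=> [|x y]; first by rewrite /cyl_eval hornerC.
by rewrite /cyl_eval hornerM_comm // /comm_poly comm_scal.
Qed.
HB.instance Definition _ c :=
  GRing.isMonoidMorphism.Build (cylf Om) Om (cyl_eval c) (cyl_eval_monoid c).

Lemma horner_map_scal (f : {linear Om -> Om}) (c : K) (P : {poly Om}) :
  (map_poly f P).[c%:A] = f P.[c%:A].
Proof.
rewrite (@horner_coef_wide _ (size P)) ?size_poly // horner_coef raddf_sum.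
apply: eq_bigr => i _; rewrite coef_map /= -(rmorphXn (in_alg Om)) /=.
by rewrite -!scalerAr !mulr1 linearZ.
Qed.

Lemma cyl_eval_ddiff c x : cyl_eval c (ddiff (cyl Om) x) = ddiff Om (cyl_eval c x).
Proof. exact: horner_map_scal. Qed.

Lemma cyl_eval_dproj c n x :
  cyl_eval c (dproj (cyl Om) n x) = dproj Om n (cyl_eval c x).
Proof. exact: horner_map_scal. Qed.

Lemma cyl_eval_cst c w : cyl_eval c (cyl_cst w) = w.
Proof. exact: hornerC. Qed.

End CylinderMaps.

Section DgaMorphisms.
Context (K : fieldType) (A B : algType K) (Om : dga A) (Xi : dga B).
Variable f : {lrmorphism Om -> Xi}.
Hypothesis fproj : forall n w, f (dproj Om n w) = dproj Xi n (f w).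

Lemma sgnf_dga_map w : f (sgnf w) = sgnf (f w).
Proof.
elim/dproj_elim: w => [n w||x y hx hy].
- by rewrite fproj !sgnf_dproj rmorphM rmorph_sign /= fproj.
- by rewrite !raddf0.
by rewrite !raddfD /= hx hy.
Qed.

Hypothesis fdiff : forall w, f (ddiff Om w) = ddiff Xi (f w).

(** The map id (x) f on Lambda (x) Omega. It is applied to f = [cyl_eval c], to restrict the
    cylinder over a cylinder to a slice of the inner one. *)
Definition cyl_map (x : cylf Om) : cylf Xi :=
  Cyl (map_poly f (cylP x)) (map_poly f (cylQ x)).

Lemma cyl_map_zmod : zmod_morphism cyl_map.
Proof. by move=> x y; rewrite /cyl_map /= !raddfB. Qed.
HB.instance Definition _ :=
  GRing.isZmodMorphism.Build (cyl Om) (cyl Xi) cyl_map cyl_map_zmod.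

Lemma cyl_map_monoid : monoid_morphism cyl_map.
Proof.
split=> [|x y]; first by rewrite /cyl_map rmorph1 raddf0.
congr Cyl; rewrite /= ?rmorphM //= raddfD /= !rmorphM /=; congr (_ + _ * _).
by apply/polyP => i; rewrite !(coef_map, coef_psgn) /= sgnf_dga_map.
Qed.

(** Packed by hand, because multiplicativity depends on [fproj]: the product of the cylinder
    involves [sgnf]. *)
Definition cyl_rmorphism : {rmorphism cyl Om -> cyl Xi} :=
  HB.pack cyl_map (GRing.isMonoidMorphism.Build (cyl Om) (cyl Xi) cyl_map cyl_map_monoid).

Lemma cyl_map_ddiff x : cyl_map (ddiff (cyl Om) x) = ddiff (cyl Xi) (cyl_map x).
Proof.
rewrite [LHS](_ : _ = Cyl (map_poly f (pdiff (cylP x)))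
  (map_poly f ((cylP x)^`() - pdiff (cylQ x)))) //.
rewrite [RHS](_ : _ = Cyl (pdiff (map_poly f (cylP x)))
  ((map_poly f (cylP x))^`() - pdiff (map_poly f (cylQ x)))) //.
have e (P : {poly Om}) : map_poly f (pdiff P) = pdiff (map_poly f P).
  by apply/polyP => i; rewrite !(coef_map, coef_pdiff) /= fdiff.
by rewrite raddfB /= !e deriv_map.
Qed.

Lemma cyl_map_cst w : cyl_map (cyl_cst w) = cyl_cst (f w).
Proof. by rewrite /cyl_map /= map_polyC raddf0. Qed.

End DgaMorphisms.

(** * Integration along the fibre and Stokes' formula *)

Section FiberIntegral.
Context (K : fieldType) (charK : [pchar K] =i pred0) (A : algType K) (Om : dga A).
Implicit Types x y : cyl Om.

Lemma fiber_int_wide x n : (size (cylQ x) <= n)%N ->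
  fiber_int x = \sum_(i < n) (i.+1%:R : K)^-1 *: (cylQ x)`_i.
Proof.
move=> h; rewrite /fiber_int -(subnKC h) big_split_ord /= [X in _ + X]big1 ?addr0 // => i _.
by rewrite nth_default ?scaler0 // leq_addr.
Qed.

Lemma fiber_int_linear : linear (@fiber_int K A Om).
Proof.
move=> c x y; pose n := maxn (size (cylQ x)) (size (cylQ y)).
have hx : (size (cylQ x) <= n)%N by rewrite leq_maxl.
have hy : (size (cylQ y) <= n)%N by rewrite leq_maxr.
have cE i : (cylQ (c *: x + y))`_i = c *: (cylQ x)`_i + (cylQ y)`_i.
  by rewrite -tpoly_coefZ -coefD.
rewrite (fiber_int_wide hx) (fiber_int_wide hy) (@fiber_int_wide _ n); last first.
  by apply/leq_sizeP => j nj; rewrite cE !nth_default ?scaler0 ?addr0 //;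
    apply: leq_trans nj.
rewrite scaler_sumr -big_split; apply: eq_bigr => i _ /=.
by rewrite cE scalerDr !scalerA mulrC.
Qed.
HB.instance Definition _ :=
  GRing.isLinear.Build K (cyl Om) Om *:%R (@fiber_int K A Om) fiber_int_linear.

Lemma fiber_int_cst w : fiber_int (cyl_cst w : cyl Om) = 0.
Proof. by rewrite /fiber_int /= size_poly0 big_ord0. Qed.

(** In degree i+1 the coefficients of the dt part are forms of degree i, so integration exchanges
    parities; the boolean covers both cases. *)
Lemma fiber_int_parity x (b : bool) :
  (forall i, odd i = b -> dproj (cyl Om) i x = 0) ->
  forall i, odd i = ~~ b -> dproj Om i (fiber_int x) = 0.
Proof.
move=> h i oi; rewrite /fiber_int raddf_sum /= big1 // => j _.
have /(congr1 (fun y : cylf Om => (cylQ y)`_j)) : dproj (cyl Om) i.+1 x = 0.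
  by apply: h; rewrite /= oi negbK.
rewrite [(cylQ _)`_j](_ : _ = (pproj i (cylQ x))`_j) // coef_pproj coef0 => e.
by rewrite /= linearZ /= e scaler0.
Qed.

Lemma oddf_fiber_int x : evenf x -> oddf (fiber_int x).
Proof. by move=> h i oi; apply: (@fiber_int_parity _ true) => //; rewrite (negbTE oi). Qed.

Lemma evenf_fiber_int x : oddf x -> evenf (fiber_int x).
Proof.
move=> h i oi; apply: (@fiber_int_parity _ false) => // j oj.
by apply: h; rewrite oj.
Qed.

Lemma fiber_intZ (c : K) x : fiber_int (c *: x) = c *: fiber_int x.
Proof. by have := fiber_int_linear c x 0; rewrite !addr0 raddf0 addr0. Qed.

Lemma coef_gcomm_comm i j (P Q : {poly Om}) k :
  (forall l, homog i P`_l) -> (forall l, homog j Q`_l) ->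
  gcomm (P * Q - (-1) ^+ (i * j) * (Q * P))`_k.
Proof.
move=> hP hQ; rewrite coefB -[in X in _ - X]signr_odd.
have -> : ((-1) ^+ odd (i * j) * (Q * P))`_k = (-1) ^+ (i * j) * (Q * P)`_k.
  by rewrite -[in RHS]signr_odd; case: odd; rewrite ?expr1 ?expr0 ?mul1r // !mulN1r coefN.
rewrite coefM coefMr mulr_sumr -sumrB; apply: gcomm_sum => l _.
exact: gcomm_comm.
Qed.

Lemma coef_gcomm_comm_sign n i j (P Q : {poly Om}) k :
  (forall l, homog i P`_l) -> (forall l, homog j Q`_l) ->
  gcomm ((-1) ^+ n * (P * Q - (-1) ^+ (i * j) * (Q * P)))`_k.
Proof.
move=> hP hQ; rewrite -signr_odd; case: odd; rewrite ?expr0 ?mul1r ?expr1 ?mulN1r.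
  by rewrite coefN; apply: gcommN; exact: coef_gcomm_comm.
exact: coef_gcomm_comm.
Qed.

Lemma homog_cylP n x l : homog n x -> homog n (cylP x)`_l.
Proof. by move=> hx; rewrite -hx /homog coef_pproj dprojK eqxx. Qed.

Lemma homog_cylQ n x l : homog n.+1 x -> homog n (cylQ x)`_l.
Proof. by move=> hx; rewrite -hx /homog coef_pproj dprojK eqxx. Qed.

Lemma homog0_cylQ x : homog 0 x -> cylQ x = 0.
Proof. by move=> <-. Qed.

Lemma homog_psgn n x : homog n x -> psgn (cylP x) = (-1) ^+ n * cylP x.
Proof. by move=> <-; exact: psgn_pproj. Qed.

Lemma cylQ_sign n x : cylQ ((-1) ^+ n * x) = (-1) ^+ n * cylQ x.
Proof.
rewrite -signr_odd -[in RHS]signr_odd; case: odd; rewrite ?expr0 ?mul1r //.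
by rewrite !expr1 !mulN1r.
Qed.

(** For P + dt Q of degree i, the dt part of [P + dt Q, P' + dt Q'] is [Q, P'] + (-1)^i [P, Q'],
    coefficientwise in t. Hence integration descends to the abelianizations. *)
Lemma gcomm_fiber_int x : gcomm x -> gcomm (fiber_int x).
Proof.
elim=> {x} [w [c [i [j [u [v [hu hv ->]]]]]]||x y _ hx _ hy]; last 2 first.
- by rewrite raddf0; exact: gcomm0.
- by rewrite raddfB; exact: gcommB.
rewrite fiber_intZ; apply: gcommZ; rewrite /fiber_int; apply: gcomm_sum => k _.
apply: gcommZ; set z := cylQ _; move: (nat_of_ord k) => {}k.
have -> : z = (cylQ u * cylP v - (-1) ^+ (i * j + j) * (cylP v * cylQ u)) +
    ((-1) ^+ i * (cylP u * cylQ v) - (-1) ^+ (i * j) * (cylQ v * cylP u)).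
  have -> : z = cylQ (u * v) - cylQ ((-1) ^+ (i * j) * (v * u)) by [].
  rewrite cylQ_sign [cylQ (u * v)](_ : _ = cylQ u * cylP v + psgn (cylP u) * cylQ v) //.
  rewrite [cylQ (v * u)](_ : _ = cylQ v * cylP u + psgn (cylP v) * cylQ u) //.
  rewrite (homog_psgn hu) (homog_psgn hv) mulrDr opprD exprD !mulrA.
  by rewrite [X in _ + X]addrC addrACA.
rewrite coefD {z}; apply: gcommD.
  (* A form of degree 0 has no dt part; otherwise the degree of the dt part is one less, which
     explains the exponent ij + j. *)
  case: i hu => [|i] hu; first by rewrite (homog0_cylQ hu) !(mul0r, mulr0) subrr coef0; exact: gcomm0.
  rewrite mulSnr -addnA addnn exprD -[(-1) ^+ j.*2]signr_odd odd_double expr0 mulr1.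
  by apply: coef_gcomm_comm => l; [exact: homog_cylQ | exact: homog_cylP].
case: j hv => [|j] hv; first by rewrite (homog0_cylQ hv) !(mul0r, mulr0) subrr coef0; exact: gcomm0.
rewrite mulnS exprD -mulrA -mulrBr.
by apply: coef_gcomm_comm_sign => l; [exact: homog_cylP | exact: homog_cylQ].
Qed.

(** The fundamental theorem of calculus: (i+1)^-1 cancels the factor from the derivative, and the
    coefficients of positive order sum to P(1) - P(0). The last minus sign is that of moving d past
    dt. *)
Lemma fiber_int_ddiff x :
  fiber_int (ddiff (cyl Om) x) = cyl_eval 1 x - cyl_eval 0 x - ddiff Om (fiber_int x).
Proof.
have natK n : (n.+1%:R : K) != 0 by apply/negP => /natf0_pchar [//|p]; rewrite charK.
pose n := maxn (size (cylP x)) (size (cylQ x)).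
have hP : (size (cylP x) <= n.+1)%N by rewrite leqW ?leq_maxl.
have hQ : (size (cylQ x) <= n)%N by rewrite leq_maxr.
have cE i : (cylQ (ddiff (cyl Om) x))`_i =
    (cylP x)`_i.+1 *+ i.+1 - ddiff Om (cylQ x)`_i.
  by rewrite coefB coef_deriv coef_pdiff.
rewrite (@fiber_int_wide _ n); last first.
  apply/leq_sizeP => j nj; rewrite cE !nth_default ?mul0rn ?raddf0 ?addr0 //.
    exact: leq_trans hQ nj.
  by apply: leq_trans hP _; rewrite ltnS.
under eq_bigr do rewrite cE scalerBr -linearZ /= -scaler_nat scalerA mulVf // scale1r.
rewrite sumrB -raddf_sum /= -(fiber_int_wide hQ); congr (_ - _).
rewrite /cyl_eval !(horner_coef_wide _ hP) !big_ord_recl /= !expr0 !mulr1.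
rewrite [X in _ - (_ + X)]big1 ?addr0 => [|i _]; last first.
  by rewrite scale0r expr0n /= mulr0.
rewrite addrAC subrr add0r; apply: eq_bigr => i _.
by rewrite scale1r expr1n mulr1.
Qed.

End FiberIntegral.

Lemma fiber_int_cyl_map (K : fieldType) (A B : algType K) (Om : dga A) (Xi : dga B)
  (f : {lrmorphism Om -> Xi}) (x : cyl Om) :
  fiber_int (cyl_map f x : cyl Xi) = f (fiber_int x).
Proof.
rewrite (@fiber_int_wide _ _ _ _ (size (cylQ x))) ?size_poly // /fiber_int raddf_sum.
by apply: eq_bigr => i _; rewrite /= linearZ coef_map.
Qed.

(** * Connections and curvature in matrix form *)

Section MatrixConnections.
Context (K : fieldType) (A : algType K) (Om : dga A).

Lemma mxddiffM m n p (X : 'M[Om]_(m, n)) (Y : 'M[Om]_(n, p)) :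
  map_mx (ddiff Om) (X *m Y) =
  map_mx (ddiff Om) X *m Y + map_mx (@sgnf _ _ Om) X *m map_mx (ddiff Om) Y.
Proof.
apply/matrixP => i j; rewrite !mxE raddf_sum -big_split; apply: eq_bigr => k _.
by rewrite /= !mxE ddiffMs.
Qed.

Lemma mxddiffK m n (X : 'M[Om]_(m, n)) :
  map_mx (ddiff Om) (map_mx (ddiff Om) X) = 0.
Proof. by apply/matrixP => i j; rewrite !mxE ddiffK. Qed.

(** Only the entries of [X] need to commute with everything; [Y] may be odd, as connection matrices
    are. *)
Lemma gcomm_mxtrace_mulC m n (X : 'M[Om]_(m, n)) (Y : 'M[Om]_(n, m)) :
  (forall i j, evenf (X i j)) -> gcomm (\tr (X *m Y) - \tr (Y *m X)).
Proof.
move=> ev; rewrite /mxtrace; under eq_bigr do rewrite mxE.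
under [X in _ - X]eq_bigr do rewrite mxE.
rewrite exchange_big -sumrB; apply: gcomm_sum => i _; rewrite -sumrB.
by apply: gcomm_sum => j _; exact: gcomm_even.
Qed.

(* The operator v |-> Th v + e dv on the image of the idempotent e. *)
Definition mxconn n (e Th : 'M[Om]_n) : Prop :=
  [/\ map_mx (@sgnf _ _ Om) e = e, map_mx (@sgnf _ _ Om) Th = - Th,
      e *m e = e, e *m Th = Th & Th *m e + e *m map_mx (ddiff Om) e = Th].

Definition mxcurv n (e Th : 'M[Om]_n) : 'M[Om]_n :=
  Th *m Th + e *m map_mx (ddiff Om) Th.

(** The iteration starts from [e], the identity of the module, so that k = 0 yields the rank term tr
    e. *)
Definition mxcurv_iter n (e Th : 'M[Om]_n) (k : nat) : 'M[Om]_n :=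
  iter k (mulmx (mxcurv e Th)) e.

Section Curvature.
Context (n : nat) (e Th : 'M[Om]_n) (cTh : mxconn e Th).
Local Notation d := (map_mx (ddiff Om)).
Local Notation C := (mxcurv e Th).

(** Multiply de = de e + e de by e on the left. *)
Lemma mxconn_de : e *m d e *m e = 0.
Proof.
have [se _ ee _ _] := cTh.
have h := mxddiffM e e; rewrite ee se in h.
by apply: (addIr (e *m d e)); rewrite add0r {3}h mulmxDr !mulmxA ee.
Qed.

Lemma mxcurvE : e *m C = C.
Proof. by have [_ _ ee eT _] := cTh; rewrite /mxcurv mulmxDr !mulmxA eT ee. Qed.

Lemma mxconn_dTh : d Th = d Th *m e - Th *m d e + d e *m d e.
Proof.
have [se sT ee eT Te] := cTh.
rewrite -{1}Te raddfD /= !mxddiffM se sT mxddiffK mulmx0 addr0.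
by rewrite mulNmx.
Qed.

Lemma mxcurv_e : C *m e = C.
Proof.
have [se sT ee eT Te] := cTh.
have z : Th *m e *m d e + e *m d e *m d e = Th *m d e by rewrite -mulmxDl Te.
have q : - (Th *m d e) + e *m d e *m d e = - (Th *m e *m d e).
  by rewrite -z opprD addrNK.
rewrite /mxcurv mulmxDl -{5}Te mulmxDr [in RHS]mxconn_dTh !mulmxDr mulmxN !mulmxA eT.
by rewrite -[_ - Th *m d e + _]addrA q addrACA subrr addr0.
Qed.

(** Once the terms in de are absorbed by Th e + e de = Th, both sides equal (e dTh Th - Th e dTh)
    e. *)
Lemma mxcurv_bianchi : e *m d C *m e = (C *m Th - Th *m C) *m e.
Proof.
have [se sT ee eT Te] := cTh.
have dC : d C = d Th *m Th - Th *m d Th + d e *m d Th.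
  by rewrite raddfD /= !mxddiffM mxddiffK mulmx0 addr0 sT mulNmx.
have z : Th *m e *m d Th + e *m d e *m d Th = Th *m d Th by rewrite -mulmxDl Te.
have q : - (Th *m d Th) + e *m d e *m d Th = - (Th *m e *m d Th).
  by rewrite -z opprD addrNK.
congr (_ *m e); rewrite dC !mulmxDr mulmxN !mulmxA eT -addrA q.
rewrite /mxcurv mulmxDl opprD [in RHS]addrA.
by rewrite [_ + _ - Th *m Th *m Th]addrAC subrr add0r.
Qed.

Lemma mxcurv_iter_el k : e *m mxcurv_iter e Th k = mxcurv_iter e Th k.
Proof. by have [_ _ ee _ _] := cTh; case: k => [|k] //=; rewrite mulmxA mxcurvE. Qed.

Lemma mxcurv_iter_er k : mxcurv_iter e Th k *m e = mxcurv_iter e Th k.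
Proof.
have [_ _ ee _ _] := cTh.
by elim: k => [|k IH] //=; rewrite -mulmxA IH.
Qed.

Lemma mxcurv_even : map_mx (@sgnf _ _ Om) C = C.
Proof.
have [se sT _ _ _] := cTh.
rewrite raddfD /= !map_mxM /= se sT mulmxN mulNmx opprK; congr (_ + _ *m _).
by apply/matrixP => i j; rewrite !mxE sgnf_ddiff; move/matrixP/(_ i j): sT;
  rewrite !mxE => ->; rewrite raddfN opprK.
Qed.

Lemma mxcurv_iter_even k : map_mx (@sgnf _ _ Om) (mxcurv_iter e Th k) = mxcurv_iter e Th k.
Proof.
have [se _ _ _ _] := cTh.
by elim: k => [|k IH] //=; rewrite map_mxM /= IH mxcurv_even.
Qed.

(** In d(C X) the first factor is handled by [mxcurv_bianchi], the second by induction, and the two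
    middle terms C Th X cancel. *)
Lemma mxcurv_iter_bianchi k :
  e *m d (mxcurv_iter e Th k) *m e =
  mxcurv_iter e Th k *m Th *m e - Th *m mxcurv_iter e Th k.
Proof.
have [_ _ ee eT _] := cTh.
elim: k => [|k IH] /=; first by rewrite mxconn_de eT subrr.
set X := mxcurv_iter e Th k in IH *.
rewrite mxddiffM mxcurv_even mulmxDr mulmxDl !mulmxA.
have -> : e *m d C *m X *m e = (C *m Th - Th *m C) *m X.
  rewrite -mulmxA mxcurv_iter_er -[X in _ *m X]mxcurv_iter_el mulmxA mxcurv_bianchi.
  by rewrite -mulmxA mxcurv_iter_el.
have -> : e *m C *m d X *m e = C *m (X *m Th *m e - Th *m X).
  by rewrite -IH !mulmxA mxcurvE mxcurv_e.
by rewrite mulmxBl mulmxBr !mulmxA [LHS]addrC subrKA.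
Qed.

Hypothesis charK : [pchar K] =i pred0.

(** Since X = e X e, one has dX = de X + e dX e + X de. The middle term has the trace of a
    commutator with Th, by the Bianchi identity. For the outer ones, cyclicity with e gives tr(X de)
    = tr(X de e) modulo [gcomm], and X de e = X (e de e) = 0. *)
Lemma mxtrace_closed k : gcomm (ddiff Om (\tr (mxcurv_iter e Th k))).
Proof.
have [se sT ee eT _] := cTh.
set X := mxcurv_iter e Th k.
have eX : e *m X = X := mxcurv_iter_el k.
have Xe : X *m e = X := mxcurv_iter_er k.
have evX i j : evenf (X i j).
  by apply/evenfP => //; have /matrixP/(_ i j) := mxcurv_iter_even k; rewrite mxE.
have eve i j : evenf (e i j).
  by apply/evenfP => //; move/matrixP/(_ i j): se; rewrite mxE.
have -> : ddiff Om (\tr X) = \tr (d X).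
  by rewrite raddf_sum; apply: eq_bigr => i _; rewrite mxE.
have sX : map_mx (@sgnf _ _ Om) X = X := mxcurv_iter_even k.
have -> : d X = d e *m X + (e *m d X *m e + X *m d e).
  rewrite -{1}Xe mxddiffM sX addrA; congr (_ + _).
  by rewrite -{1}eX mxddiffM se mulmxDl -mulmxA Xe.
have gXde : gcomm (\tr (X *m d e)).
  have := gcomm_mxtrace_mulC (X *m d e) eve.
  by rewrite mulmxA eX -{2}Xe -!mulmxA (mulmxA e) mxconn_de mulmx0 mxtrace0 subr0.
rewrite mxcurv_iter_bianchi -/X !mxtraceD raddfN /=; apply: gcommD; last apply: gcommD => //.
  rewrite -[X in gcomm X](subrK (\tr (X *m d e))); apply: gcommD => //.
  exact/gcomm_sym/gcomm_mxtrace_mulC.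
apply: (@gcomm_trans _ _ _ (\tr (X *m Th))); last exact: gcomm_mxtrace_mulC.
by apply: gcomm_sym; rewrite -{1}eX -[e *m X *m Th]mulmxA; exact: gcomm_mxtrace_mulC.
Qed.

Lemma evenf_mxtrace k : evenf (\tr (mxcurv_iter e Th k)).
Proof.
apply: evenf_sum => i _; apply/evenfP => //.
by have /matrixP/(_ i i) := mxcurv_iter_even k; rewrite mxE.
Qed.

End Curvature.

End MatrixConnections.

Section Naturality.
Context (K : fieldType) (A B : algType K) (Om : dga A) (Xi : dga B) (f : {rmorphism Om -> Xi}).
Hypothesis fdiff : forall w, f (ddiff Om w) = ddiff Xi (f w).

Lemma map_mxcurv_iter n (e Th : 'M[Om]_n) k :
  map_mx f (mxcurv_iter e Th k) = mxcurv_iter (map_mx f e) (map_mx f Th) k.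
Proof.
have fd (X : 'M[Om]_n) : map_mx f (map_mx (ddiff Om) X) = map_mx (ddiff Xi) (map_mx f X).
  by apply/matrixP => i j; rewrite !mxE fdiff.
by elim: k => //= k IH; rewrite map_mxM IH raddfD /= !map_mxM /= fd.
Qed.

Lemma map_mxtrace_curv n (e Th : 'M[Om]_n) k :
  f (\tr (mxcurv_iter e Th k)) = \tr (mxcurv_iter (map_mx f e) (map_mx f Th) k).
Proof.
rewrite -map_mxcurv_iter raddf_sum.
by apply: eq_bigr => i _; rewrite [RHS]mxE.
Qed.

End Naturality.

(** * Affine homotopies *)

Section AffineHomotopy.
Context (K : fieldType) (A : algType K) (Om : dga A) (n : nat).
Implicit Types e T : 'M[Om]_n.

Definition mxcst e : 'M[cyl Om]_n := map_mx (@cyl_cst K A Om) e.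
Definition cyl_t : cyl Om := (Cyl 'X 0 : cylf Om).
Definition mxaff T0 T1 : 'M[cyl Om]_n := mxcst T0 + cyl_t *: mxcst (T1 - T0).

Lemma cyl_tC (x : cyl Om) : x * cyl_t = cyl_t * x.
Proof.
case: x => P Q; congr Cyl; first exact: commr_polyX.
by rewrite /= mulr0 mul0r addr0 add0r /psgn map_polyX; exact: commr_polyX.
Qed.

Lemma mxcst_zmod : zmod_morphism mxcst.
Proof. by move=> e T; apply/matrixP => i j; rewrite !mxE raddfB. Qed.
HB.instance Definition _ := GRing.isZmodMorphism.Build _ _ mxcst mxcst_zmod.

Lemma mxcstM e T : mxcst (e *m T) = mxcst e *m mxcst T.
Proof. exact: map_mxM. Qed.

Lemma mxcst_ddiff e : map_mx (ddiff (cyl Om)) (mxcst e) = mxcst (map_mx (ddiff Om) e).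
Proof. by apply/matrixP => i j; rewrite !mxE -cyl_cst_ddiff. Qed.

Lemma cyl_cst_dproj m w : cyl_cst (dproj Om m w) = dproj (cyl Om) m (cyl_cst w).
Proof.
congr Cyl; last by case: m => //= m; rewrite raddf0.
by apply/polyP => i; rewrite coef_pproj !coefC; case: eqP; rewrite ?raddf0.
Qed.

Lemma sgnf_cyl_cst w : sgnf (cyl_cst w : cyl Om) = cyl_cst (sgnf w).
Proof. by rewrite (@sgnf_dga_map _ _ _ Om (cyl Om) (@cyl_cst K A Om) cyl_cst_dproj). Qed.

Lemma mxcst_sgnf e : map_mx (@sgnf _ _ (cyl Om)) (mxcst e) = mxcst (map_mx (@sgnf _ _ Om) e).
Proof. by apply/matrixP => i j; rewrite !mxE sgnf_cyl_cst. Qed.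

Lemma sgnf_cyl_t : sgnf cyl_t = cyl_t.
Proof.
rewrite (@homog_sgnf _ _ _ 0) ?expr0 ?mul1r //.
by rewrite /homog; apply/(@demb_im _ _ (cyl Om)); exists ('X : {poly A}); congr Cyl; exact: map_polyX.
Qed.

Lemma mxcyl_t_mul (X Y : 'M[cyl Om]_n) : X *m (cyl_t *: Y) = cyl_t *: (X *m Y).
Proof.
apply/matrixP => i j; rewrite !mxE mulr_sumr; apply: eq_bigr => k _.
by rewrite !mxE !mulrA cyl_tC.
Qed.

(** For a fixed idempotent the conditions on the connection matrix are affine, and the differential
    of the constant [mxcst e] has no dt part. *)
Lemma mxconn_aff e T0 T1 : mxconn e T0 -> mxconn e T1 ->
  mxconn (mxcst e) (mxaff T0 T1).
Proof.
move=> [se s0 ee e0 h0] [_ s1 _ e1 h1]; split.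
- by rewrite mxcst_sgnf se.
- rewrite /mxaff raddfD /= mxcst_sgnf s0 raddfN opprD -scalerN -raddfN /=.
  congr (_ + _); apply/matrixP => i j; rewrite !mxE rmorphM /= sgnf_cyl_t sgnf_cyl_cst.
  move/matrixP/(_ i j): s0; move/matrixP/(_ i j): s1; rewrite !mxE => h h'.
  by rewrite [sgnf _]raddfB /= h h' -opprD [cyl_cst (- _)]raddfN.
- by rewrite -mxcstM ee.
- by rewrite /mxaff mulmxDr mxcyl_t_mul -!mxcstM mulmxBr e0 e1.
rewrite /mxaff mxcst_ddiff mulmxDl -scalemxAl -!mxcstM addrAC -raddfD /= h0.
congr (_ + _ *: mxcst _).
by rewrite mulmxBl -[in RHS]h0 -[in RHS]h1 opprD addrACA subrr addr0.
Qed.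

Lemma mxaff_diag T : mxaff T T = mxcst T.
Proof. by rewrite /mxaff subrr raddf0 scaler0 addr0. Qed.

Lemma map_eval_mxcst c e : map_mx (@cyl_eval _ _ Om c) (mxcst e) = e.
Proof. by apply/matrixP => i j; rewrite !mxE cyl_eval_cst. Qed.

(* The degree 2k-1 part of the secondary form of the affine path. *)
Definition mxcs e T0 T1 k : Om :=
  fiber_int (\tr (mxcurv_iter (mxcst e) (mxaff T0 T1) k)).

(** The character form of a constant path is pulled back from the base, hence has no dt part. *)
Lemma mxcs_diag e T k : mxcs e T T k = 0.
Proof.
rewrite /mxcs mxaff_diag -(@map_mxtrace_curv _ _ _ Om (cyl Om) (@cyl_cst K A Om) (@cyl_cst_ddiff _ _ _)).
exact: fiber_int_cst.
Qed.

Lemma fiber_int_transgression (charK : [pchar K] =i pred0) (e T : 'M[cyl Om]_n) k :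
  mxconn e T ->
  gcomm (\tr (mxcurv_iter (map_mx (@cyl_eval _ _ Om 1) e) (map_mx (@cyl_eval _ _ Om 1) T) k)
    - \tr (mxcurv_iter (map_mx (@cyl_eval _ _ Om 0) e) (map_mx (@cyl_eval _ _ Om 0) T) k)
    - ddiff Om (fiber_int (\tr (mxcurv_iter e T k)))).
Proof.
move=> cT; have := gcomm_fiber_int (mxtrace_closed cT charK k).
rewrite (fiber_int_ddiff charK).
by rewrite !(@map_mxtrace_curv _ _ _ (cyl Om) Om (@cyl_eval K A Om _) (@cyl_eval_ddiff _ _ _ _)).
Qed.

End AffineHomotopy.

Section AffineNaturality.
Context (K : fieldType) (A B : algType K) (Om : dga A) (Xi : dga B).
Context (f : {lrmorphism Om -> Xi}) (n : nat).
Hypothesis fproj : forall m w, f (dproj Om m w) = dproj Xi m (f w).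
Hypothesis fdiff : forall w, f (ddiff Om w) = ddiff Xi (f w).

Lemma map_cyl_map_cst (T : 'M[Om]_n) :
  map_mx (cyl_map f) (mxcst T) = mxcst (map_mx f T).
Proof. by apply/matrixP => i j; rewrite !mxE cyl_map_cst. Qed.

Lemma map_cyl_map_aff (T0 T1 : 'M[Om]_n) :
  map_mx (cyl_map f) (mxaff T0 T1) = mxaff (map_mx f T0) (map_mx f T1).
Proof.
have ft : cyl_map f (@cyl_t _ _ Om) = @cyl_t _ _ Xi.
  by congr Cyl; rewrite /= ?map_polyX ?raddf0.
have fD : {morph cyl_map f : x y / x + y} := raddfD (cyl_rmorphism fproj).
have fM : {morph cyl_map f : x y / x * y} := rmorphM (cyl_rmorphism fproj).
by apply/matrixP => i j; rewrite !mxE fD fM ft !cyl_map_cst !raddfB.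
Qed.

Lemma mxcs_dga_map (e T0 T1 : 'M[Om]_n) k :
  f (mxcs e T0 T1 k) = mxcs (map_mx f e) (map_mx f T0) (map_mx f T1) k.
Proof.
rewrite /mxcs -fiber_int_cyl_map; congr fiber_int.
rewrite -map_cyl_map_cst -map_cyl_map_aff.
exact: (map_mxtrace_curv (f := cyl_rmorphism fproj) (cyl_map_ddiff fdiff)).
Qed.

End AffineNaturality.

Section TwoParameters.
Context (K : fieldType) (charK : [pchar K] =i pred0).
Context (A : algType K) (Om : dga A) (n : nat).

Lemma map_eval1_mxaff (T0 T1 : 'M[Om]_n) :
  map_mx (@cyl_eval _ _ Om 1) (mxaff T0 T1) = T1.
Proof.
apply/matrixP => i j; rewrite !mxE raddfD /= rmorphM /= !cyl_eval_cst.
by rewrite /cyl_eval hornerX scale1r mul1r subrKC.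
Qed.

Lemma map_eval0_mxaff (T0 T1 : 'M[Om]_n) :
  map_mx (@cyl_eval _ _ Om 0) (mxaff T0 T1) = T0.
Proof.
apply/matrixP => i j; rewrite !mxE raddfD /= rmorphM /= !cyl_eval_cst.
by rewrite /cyl_eval hornerX scale0r mul0r addr0.
Qed.

Lemma mxcs_transgression (e T0 T1 : 'M[Om]_n) k : mxconn e T0 -> mxconn e T1 ->
  gcomm (\tr (mxcurv_iter e T1 k) - \tr (mxcurv_iter e T0 k) - ddiff Om (mxcs e T0 T1 k)).
Proof.
move=> c0 c1; have := fiber_int_transgression charK k (mxconn_aff c0 c1).
by rewrite !map_eval_mxcst map_eval1_mxaff map_eval0_mxaff.
Qed.

Lemma oddf_mxcs (e T0 T1 : 'M[Om]_n) k : mxconn e T0 -> mxconn e T1 ->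
  oddf (mxcs e T0 T1 k).
Proof. by move=> c0 c1; apply: oddf_fiber_int; apply: evenf_mxtrace (mxconn_aff c0 c1) charK _. Qed.

End TwoParameters.

(* Stokes' formula on the cylinder, applied to the transgression form of the affine
   path from T0 to T1 on the cylinder over the cylinder. *)
Lemma fiber_int_homotopy (K : fieldType) (charK : [pchar K] =i pred0)
    (A : algType K) (Om : dga A) n (e : 'M[Om]_n) (T0 T1 : 'M[cyl Om]_n) k
    (at_ := fun c (T : 'M[cyl Om]_n) => map_mx (@cyl_eval _ _ Om c) T) :
  mxconn (mxcst e) T0 -> mxconn (mxcst e) T1 ->
  exact_by (@evenf _ _ Om)
    (fiber_int (\tr (mxcurv_iter (mxcst e) T1 k)) - fiber_int (\tr (mxcurv_iter (mxcst e) T0 k))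
     - (mxcs e (at_ 1 T0) (at_ 1 T1) k - mxcs e (at_ 0 T0) (at_ 0 T1) k)).
Proof.
(* Only the homotopy parameter is integrated in [y]; the path parameter t survives, and [y] is a
   form on the cylinder. *)
move=> c0 c1; pose y := mxcs (mxcst e) T0 T1 k.
have ev c : cyl_eval c y = mxcs e (at_ c T0) (at_ c T1) k.
  rewrite (@mxcs_dga_map _ _ _ (cyl Om) Om (@cyl_eval K A Om c)) ?map_eval_mxcst //.
    exact: cyl_eval_dproj.
  exact: cyl_eval_ddiff.
(* The primitive is minus the double integral: Stokes' formula contributes - d of the integral of
   [y]. It is even because [y] is odd. *)
exists (- fiber_int y); first by rewrite -sub0r; apply/evenfB/evenf_fiber_int/oddf_mxcs => //; exact: evenf0.
have := gcomm_fiber_int (mxcs_transgression charK k c0 c1).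
rewrite 2!raddfB /= (fiber_int_ddiff charK) !ev.
by rewrite [ddiff Om (- _)]raddfN opprK opprD opprK addrA.
Qed.

(** * Coordinates on finitely generated projective modules *)

Section Coordinates.
Context (K : fieldType) (A : algType K) (Om : dga A) (M : lmodType A^c) (n : nat).
Context (i : {linear M -> 'rV[A^c]_n}) (p : {linear 'rV[A^c]_n -> M}).
Hypothesis ipK : cancel i p.
Implicit Types (m : M) (x y : mform Om M) (w : Om).

Definition gen (j : 'I_n) : M := p (delta_mx 0 j).

Definition coord (j : 'I_n) (x : mform Om M) : Om :=
  tlift (fun m w => demb Om (i m 0 j : A) * w) x.

Lemma coord_rmul m (a : A) j :
  (i (rmul m a) 0 j : A) = (i m 0 j : A) * a.
Proof. by rewrite /rmul linearZ mxE. Qed.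

Lemma coord_balanced j :
  balanced (@rmul A M) (fun (a : A) (w : Om) => demb Om a * w)
    (fun m (w : Om) => demb Om (i m 0 j : A) * w).
Proof.
split=> [m m' w|m w w'|m b w]; rewrite ?mulrDr //.
  by rewrite raddfD mxE [demb Om _]raddfD mulrDl.
by rewrite coord_rmul rmorphM mulrA.
Qed.

Lemma coord_pure j m w : coord j (mpure Om m w) = demb Om (i m 0 j : A) * w.
Proof. exact: tlift_pure (coord_balanced j). Qed.

Lemma coord_zmod j : zmod_morphism (coord j).
Proof.
have cD : {morph coord j : x y / x + y} := tliftD (coord_balanced j).
by move=> x y; apply: (addIr (coord j y)); rewrite -cD !subrK.
Qed.
HB.instance Definition _ j :=
  GRing.isZmodMorphism.Build (mform Om M) Om (coord j) (coord_zmod j).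

Lemma rmul_pure m w r : rmul (mpure Om m w) r = mpure Om m (w * r).
Proof. exact: mform_scale_pure. Qed.

Lemma coordZ j x r : coord j (rmul x r) = coord j x * r.
Proof.
pose g x := coord j (rmul x r); pose h x := coord j x * r.
rewrite -/(g x) -/(h x); apply: tens_lin_ext x => [x y|x y|m w]; rewrite /g /h.
- by rewrite rmulDl raddfD.
- by rewrite raddfD mulrDl.
by rewrite -/(mpure Om m w) rmul_pure !coord_pure mulrA.
Qed.

Lemma gen_sum m : m = \sum_j rmul (gen j) (i m 0 j).
Proof.
rewrite -[LHS]ipK {1}(row_sum_delta (i m)) raddf_sum.
by apply: eq_bigr => j _; rewrite /= linearZ.
Qed.

Lemma mpureDl m m' w : mpure Om (m + m') w = mpure Om m w + mpure Om m' w.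
Proof. by have [h _ _] := mpure_balanced Om M; exact: h. Qed.
Lemma mpureDr m w w' : mpure Om m (w + w') = mpure Om m w + mpure Om m w'.
Proof. by have [_ h _] := mpure_balanced Om M; exact: h. Qed.
Lemma mpureA m (a : A) w : mpure Om (rmul m a) w = mpure Om m (demb Om a * w).
Proof. by have [_ _ h] := mpure_balanced Om M; exact: h. Qed.
Lemma mpure0l w : mpure Om (0 : M) w = 0.
Proof. exact: balanced0l (mpure_balanced Om M). Qed.
Lemma mpure0r m : mpure Om m 0 = 0.
Proof. exact: balanced0r (mpure_balanced Om M). Qed.

Lemma coord_sum x : x = \sum_j mpure Om (gen j) (coord j x).
Proof.
pose h x := \sum_j mpure Om (gen j) (coord j x).
rewrite -/(h x); apply: (@tens_lin_ext _ _ _ _ _ _ id h) x => [//|x y|m w].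
  by rewrite /h -big_split; apply: eq_bigr => j _; rewrite raddfD mpureDr.
rewrite /h -/(mpure Om m w) {1}(gen_sum m).
rewrite (big_morph (fun m => mpure Om m w) (fun m m' => mpureDl m m' w) (mpure0l w)).
by apply: eq_bigr => j _; rewrite mpureA coord_pure.
Qed.

Lemma coord_inj x y : (forall j, coord j x = coord j y) -> x = y.
Proof. by move=> h; rewrite (coord_sum x) (coord_sum y); apply: eq_bigr => j _; rewrite h. Qed.

Lemma mform_in_coord (P : Om -> Prop) x : (forall j, P (coord j x)) -> mform_in P x.
Proof.
move=> h; exists [seq (gen j, coord j x) | j <- enum 'I_n]; split.
  by move=> _ /mapP [j _ ->] /=.
by rewrite big_map big_enum /= -coord_sum.
Qed.

Lemma coord_mform_in (P : Om -> Prop) x j :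
  P 0 -> (forall u v, P u -> P v -> P (u + v)) ->
  (forall a u, P u -> P (demb Om a * u)) ->
  mform_in P x -> P (coord j x).
Proof.
move=> P0 PD PM [s [sP ->]]; rewrite raddf_sum big_seq.
elim/big_ind: _ => // -[m w] /sP Pw; rewrite /= coord_pure; exact: PM.
Qed.

Lemma homog_demb (a : A) : homog 0 (demb Om a).
Proof. by apply/demb_im; exists a. Qed.

Lemma dproj_dembM (a : A) k w : dproj Om k (demb Om a * w) = demb Om a * dproj Om k w.
Proof.
elim/dproj_elim: w => [l w||x y hx hy].
- have e : dproj Om l (demb Om a * dproj Om l w) = demb Om a * dproj Om l w.
    by rewrite -{1 2}(homog_demb a) -{1}[l]add0n dproj_mul.
  by rewrite -e !dprojK; case: eqP; rewrite ?mulr0.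
- by rewrite mulr0 !raddf0 mulr0.
by rewrite mulrDr !raddfD /= hx hy mulrDr.
Qed.

Lemma evenf_coord x j : mform_in (@evenf K A Om) x -> evenf (coord j x).
Proof.
apply: coord_mform_in => [|u v|a u hu k ok]; [exact: evenf0|exact: evenfD|].
by rewrite dproj_dembM hu ?mulr0.
Qed.

Lemma homog_coord x j k : mform_in (homog k) x -> homog k (coord j x).
Proof.
apply: coord_mform_in => [|u v hu hv|a u hu]; rewrite /homog ?raddf0 //.
  by rewrite raddfD /= hu hv.
by rewrite dproj_dembM hu.
Qed.

(** The matrix of [i \o p]. Scalars act on the right, so matrices act from the left on columns of
    coordinates. *)
Definition idem_mx : 'M[Om]_n := \matrix_(a, b) demb Om (i (gen b) 0 a : A).

Definition coord_col x : 'cV[Om]_n := \col_a coord a x.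

Lemma coord_col_zmod : zmod_morphism coord_col.
Proof. by move=> x y; apply/colP => a; rewrite !mxE raddfB. Qed.
HB.instance Definition _ :=
  GRing.isZmodMorphism.Build (mform Om M) 'cV[Om]_n coord_col coord_col_zmod.

Lemma coord_col_inj : injective coord_col.
Proof. by move=> x y /colP e; apply: coord_inj => j; have := e j; rewrite !mxE. Qed.

Lemma idem_mx_coord x : idem_mx *m coord_col x = coord_col x.
Proof.
apply/colP => a; rewrite !mxE [in RHS](coord_sum x) raddf_sum.
by apply: eq_bigr => b _; rewrite !mxE /= coord_pure.
Qed.

Section Connection.
Context (D : M -> mform Om M) (cD : is_conn Om M D).

Definition conn_mx : 'M[Om]_n := \matrix_(a, b) coord a (D (gen b)).

Lemma conn_add : {morph D : m m' / m + m'}. Proof. by case: cD. Qed.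
Lemma conn_leibniz m (a : A) :
  D (rmul m a) = rmul (D m) (demb Om a) + mpure Om m (ddiff Om (demb Om a)).
Proof. by case: cD. Qed.

Lemma conn0 : D 0 = 0.
Proof. by apply: (addrI (D 0)); rewrite -conn_add !addr0. Qed.

Lemma cext_balanced :
  balanced (@rmul A M) (fun (a : A) (w : Om) => demb Om a * w)
    (fun m (w : Om) => rmul (D m) w + mpure Om m (ddiff Om w)).
Proof.
split=> [m m' w|m w w'|m b w].
- by rewrite conn_add rmulDl mpureDl addrACA.
- by rewrite rmulDr raddfD /= mpureDr addrACA.
rewrite conn_leibniz rmulDl rmulA rmul_pure ddiffMs sgnf_demb mpureDr mpureA.
by rewrite addrA.
Qed.

Lemma cext_pure m w : cext D (mpure Om m w) = rmul (D m) w + mpure Om m (ddiff Om w).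
Proof. exact: tlift_pure cext_balanced. Qed.

Lemma cext_sum I (r : seq I) (F : I -> mform Om M) :
  cext D (\sum_(l <- r) F l) = \sum_(l <- r) cext D (F l).
Proof. exact: tlift_sum cext_balanced. Qed.

Lemma coord_cext x :
  coord_col (cext D x) = conn_mx *m coord_col x + idem_mx *m map_mx (ddiff Om) (coord_col x).
Proof.
apply/colP => a; rewrite !mxE [in LHS](coord_sum x) cext_sum raddf_sum -big_split.
by apply: eq_bigr => b _; rewrite /= cext_pure raddfD /= coordZ coord_pure !mxE.
Qed.

Lemma mxconn_conn_mx : mxconn idem_mx conn_mx.
Proof.
have idE m a : demb Om (i m 0 a : A) =
    \sum_b demb Om (i (gen b) 0 a : A) * demb Om (i m 0 b : A).
  rewrite {1}(gen_sum m) raddf_sum summxE raddf_sum.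
  by apply: eq_bigr => b _; rewrite coord_rmul [LHS]rmorphM.
split.
- by apply/matrixP => a b; rewrite !mxE sgnf_demb.
- apply/matrixP => a b; rewrite !mxE (@homog_sgnf _ _ _ 1) ?expr1 ?mulN1r //.
  by apply: homog_coord; case: cD.
- by apply/matrixP => a b; rewrite !mxE [RHS]idE; apply: eq_bigr => c _; rewrite !mxE.
- apply/matrixP => a b; rewrite !mxE [in RHS](coord_sum (D (gen b))) raddf_sum.
  by apply: eq_bigr => c _; rewrite !mxE /= coord_pure.
(* The last condition is the Leibniz rule applied to the expansion of [gen b] in the generators,
   whose coefficients form column b of the idempotent. *)
apply/matrixP => a b; rewrite !mxE -big_split {1}(gen_sum (gen b)) /=.
rewrite (big_morph D conn_add conn0) raddf_sum.
apply: eq_bigr => c _; rewrite !mxE conn_leibniz raddfD /= coordZ coord_pure.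
by [].
Qed.

Let e := idem_mx.
Let C := mxcurv idem_mx conn_mx.

(** In D(Dv) the terms containing dv add up to (Th e + e de - Th) dv, which vanishes by the last
    condition of [mxconn]. *)
Lemma coord_curv x : coord_col (curv D x) = C *m coord_col x.
Proof.
have [se sT ee eT Te] := mxconn_conn_mx.
rewrite /curv !coord_cext; move: (coord_col x) (idem_mx_coord x) => v ev.
have z : conn_mx *m e *m map_mx (ddiff Om) v + e *m map_mx (ddiff Om) e *m map_mx (ddiff Om) v
   = conn_mx *m map_mx (ddiff Om) v by rewrite -mulmxDl Te.
have q : - (conn_mx *m map_mx (ddiff Om) v) + e *m map_mx (ddiff Om) e *m map_mx (ddiff Om) v
   = - (conn_mx *m e *m map_mx (ddiff Om) v) by rewrite -z opprD addrNK.
rewrite map_mxD !mxddiffM se sT mxddiffK mulmx0 addr0 mulNmx.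
rewrite !mulmxDr !mulmxA mulmxN !mulmxA eT /C /mxcurv mulmxDl -[_ *m v - _ + _]addrA.
by rewrite q addrACA subrr addr0.
Qed.

Lemma coord_curv_iter k x :
  coord_col (iter k (curv D) x) = mxcurv_iter idem_mx conn_mx k *m coord_col x.
Proof.
elim: k => [|k IH] /=; first by rewrite idem_mx_coord.
by rewrite coord_curv IH mulmxA.
Qed.

Lemma coord_gen j : coord_col (mpure Om (gen j) 1) = col j idem_mx.
Proof. by apply/colP => a; rewrite !mxE coord_pure mulr1. Qed.

Hypothesis charK : [pchar K] =i pred0.

Lemma even_functional_coord j : even_functional (coord j).
Proof.
split=> [x hx|x y _ _|x r _ _]; [exact: evenf_coord | exact: raddfD | exact: coordZ].
Qed.

Lemma is_trace_mxcurv k : is_trace (iter k (curv D)) (\tr (mxcurv_iter idem_mx conn_mx k)).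
Proof.
have cT := mxconn_conn_mx.
have cE j a : coord a (iter k (curv D) (mpure Om (gen j) 1)) = mxcurv_iter idem_mx conn_mx k a j.
  have := coord_curv_iter k (mpure Om (gen j) 1); rewrite coord_gen => /colP /(_ a).
  by rewrite mxE => ->; rewrite colE mulmxA (mxcurv_iter_er cT) -colE mxE.
(* Dual basis presentation: images of the generators, paired with the coordinate functionals. *)
exists n, (fun j => iter k (curv D) (mpure Om (gen j) 1)), coord; split.
- move=> j; apply: mform_in_coord => a; rewrite cE; apply/evenfP => //.
  by have /matrixP/(_ a j) := mxcurv_iter_even cT k; rewrite mxE.
- exact: even_functional_coord.
- move=> y _; apply: coord_col_inj; rewrite coord_curv_iter raddf_sum.
  apply/colP => a; rewrite mxE summxE; apply: eq_bigr => j _.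
  by rewrite !mxE coordZ cE.
by apply: eq_bigr => j _; rewrite cE.
Qed.

End Connection.

(* Expanding each functional on the generators and commuting even forms turns any
   presentation of the trace into the one by the generators. *)
Lemma is_trace_coord (f : mform Om M -> mform Om M) t :
  is_trace f t -> gcomm (t - \sum_j coord j (f (mpure Om (gen j) 1))).
Proof.
case=> m [x [mu [xE muE fE ->]]].
have mu0 l : mu l 0 = 0.
  have [_ h _] := muE l; have e0 : mform_in (@evenf K A Om) (0 : mform Om M).
    by exists [::]; split=> //; rewrite big_nil.
  by apply: (addrI (mu l 0)); rewrite -h // !addr0.
have h1 : dproj Om 0 1 = 1 by rewrite -(rmorph1 (demb Om)); exact: homog_demb.
have e1 : evenf (1 : Om) by move=> l ol; rewrite -h1 dprojK; case: eqP ol => // ->.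
have genE j (r : Om) : evenf r -> mform_in (@evenf K A Om) (mpure Om (gen j) r).
  by move=> er; exists [:: (gen j, r)]; split=> [l|]; rewrite ?big_seq1 // inE => /eqP ->.
have muS l : mu l (x l) = \sum_j mu l (mpure Om (gen j) 1) * coord j (x l).
  rewrite {1}(coord_sum (x l)).
  (* An [even_functional] is additive on even elements only, so the induction carries along the
     evenness of the partial sums. *)
  have hs (r : seq 'I_n) : mform_in (@evenf K A Om) (\sum_(j <- r) mpure Om (gen j) (coord j (x l)))
     /\ mu l (\sum_(j <- r) mpure Om (gen j) (coord j (x l))) =
     \sum_(j <- r) mu l (mpure Om (gen j) 1) * coord j (x l).
    have [_ hD hZ] := muE l.
    elim: r => [|j r [IH1 IH2]].
      by rewrite !big_nil mu0; split=> //; exists [::]; split=> //; rewrite big_nil.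
    have ec : evenf (coord j (x l)) by exact: evenf_coord.
    rewrite !big_cons; split; first by apply: mform_inD => //; exact: genE.
    rewrite hD ?IH2 //; last exact: genE.
    by rewrite -[in LHS](mul1r (coord j (x l))) -rmul_pure hZ //; exact: genE.
  by have [] := hs (index_enum 'I_n).
under eq_bigr do rewrite muS.
have fS j : coord j (f (mpure Om (gen j) 1)) =
    \sum_l coord j (x l) * mu l (mpure Om (gen j) 1).
  rewrite fE; last exact: genE.
  by rewrite raddf_sum; apply: eq_bigr => l _; rewrite /= coordZ.
under [X in _ - X]eq_bigr do rewrite fS.
rewrite [X in _ - X]exchange_big -sumrB; apply: gcomm_sum => l _.
rewrite -sumrB; apply: gcomm_sum => j _; apply: gcomm_even.
by have [h _ _] := muE l; apply: h; exact: genE.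
Qed.

End Coordinates.

Section TraceOfPowers.
Context (K : fieldType) (charK : [pchar K] =i pred0).
Context (A : algType K) (Om : dga A) (M : lmodType A^c) (n : nat).
Context (i : {linear M -> 'rV[A^c]_n}) (p : {linear 'rV[A^c]_n -> M}).
Hypothesis ipK : cancel i p.
Context (D : M -> mform Om M) (cD : is_conn Om M D).

Lemma is_trace_trpow k : is_trace (iter k (curv D)) (trpow D k).
Proof. by apply: choose_orP; eexists; exact: (is_trace_mxcurv ipK). Qed.

(** The chosen representative [trpow] and the matrix trace both present the trace of the same
    endomorphism, and [is_trace_coord] compares each with the same sum. *)
Lemma trpow_mxcurv k :
  gcomm (trpow D k - \tr (mxcurv_iter (idem_mx Om i p) (conn_mx i p D) k)).
Proof.
have h1 := is_trace_coord ipK (is_trace_trpow k).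
have h2 := is_trace_coord ipK (is_trace_mxcurv ipK cD charK k).
exact: gcomm_trans h1 (gcomm_sym h2).
Qed.

Lemma evenf_trpow k : evenf (trpow D k).
Proof.
case: (is_trace_trpow k) => m [x [mu [xE muE _ ->]]].
by apply: evenf_sum => l _; have [h _ _] := muE l; exact: h.
Qed.

End TraceOfPowers.

(** * Isomorphisms and direct sums in coordinates *)

Section Pullback.
Context (K : fieldType) (A : algType K) (Om : dga A) (M L : lmodType A^c).
Context (phi : {linear M -> L}) (psi : {linear L -> M}).
Hypotheses (phiK : cancel phi psi) (psiK : cancel psi phi).
Context (D : L -> mform Om L).

Lemma pullback_conn : is_conn Om L D -> is_conn Om M (pullback phi psi D).
Proof.
move=> [D1 D2 D3 D4]; split=> [m m'|c m|m|m a]; rewrite /pullback.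
- by rewrite raddfD D1 mform_mapD.
- by rewrite /rmul linearZ D2 mform_mapZ.
- exact: mform_map_in.
by rewrite [phi _]linearZ D4 mform_mapD mform_mapZ mform_map_pure phiK.
Qed.

Context (n : nat) (i : {linear L -> 'rV[A^c]_n}) (p : {linear 'rV[A^c]_n -> L}).

(** In coordinates transported along the isomorphism, a connection and its pullback have literally
    the same matrices; this reduces invariance of Chern and secondary forms to independence of the
    coordinates. *)
Lemma idem_mx_pullback : idem_mx Om (i \o phi) (psi \o p) = idem_mx Om i p.
Proof. by apply/matrixP => a b; rewrite !mxE /gen /= psiK. Qed.

Lemma coord_pullback a (x : mform Om L) :
  coord (i \o phi) a (mform_map psi x) = coord i a x.
Proof.
apply: (@tens_lin_ext _ _ _ _ _ _ (fun x => coord (i \o phi) a (mform_map psi x)) (coord i a)) x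
  => [x y|x y|m w].
- by rewrite mform_mapD raddfD.
- by rewrite raddfD.
by rewrite -/(mpure Om m w) mform_map_pure !coord_pure /= psiK.
Qed.

Lemma conn_mx_pullback :
  conn_mx (i \o phi) (psi \o p) (pullback phi psi D) = conn_mx i p D.
Proof. by apply/matrixP => a b; rewrite !mxE /pullback /gen /= psiK coord_pullback. Qed.

End Pullback.

Section BlockMatrices.
Context (K : fieldType) (A : algType K) (Om : dga A) (m n : nat).
Implicit Types (e T : 'M[Om]_m) (f U : 'M[Om]_n).

Definition diag2_mx e f : 'M[Om]_(m + n) := block_mx e 0 0 f.

Lemma mxcurv_iter_diag2 e T f U k :
  mxcurv_iter (diag2_mx e f) (diag2_mx T U) k =
  diag2_mx (mxcurv_iter e T k) (mxcurv_iter f U k).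
Proof.
rewrite /diag2_mx; elim: k => //= k ->.
rewrite /mxcurv map_block_mx !map_mx0 !mulmx_block !(mul0mx, mulmx0, addr0, add0r).
rewrite add_block_mx addr0 mulmx_block.
by rewrite !(mul0mx, mulmx0, addr0, add0r).
Qed.

Lemma mxtrace_diag2 e f : \tr (diag2_mx e f) = \tr e + \tr f.
Proof. exact: mxtrace_block. Qed.

End BlockMatrices.

Lemma mxcs_diag2 (K : fieldType) (A : algType K) (Om : dga A) (m n : nat)
    (e T0 T1 : 'M[Om]_m) (f U0 U1 : 'M[Om]_n) k :
  mxcs (diag2_mx e f) (diag2_mx T0 U0) (diag2_mx T1 U1) k =
  mxcs e T0 T1 k + mxcs f U0 U1 k.
Proof.
have cst0 (a b : nat) : map_mx (@cyl_cst K A Om) (0 : 'M[Om]_(a, b)) = 0.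
  by apply/matrixP => i j; rewrite !mxE raddf0.
have cstE a b : mxcst (@diag2_mx K A Om m n a b) = @diag2_mx _ _ (cyl Om) _ _ (mxcst a) (mxcst b).
  by rewrite /mxcst map_block_mx !cst0.
have affE : mxaff (@diag2_mx K A Om m n T0 U0) (diag2_mx T1 U1) =
    @diag2_mx _ _ (cyl Om) _ _ (mxaff T0 T1) (mxaff U0 U1).
  have dB : diag2_mx T1 U1 - diag2_mx T0 U0 = diag2_mx (T1 - T0) (U1 - U0).
    by rewrite /diag2_mx opp_block_mx add_block_mx !subr0.
  by rewrite /mxaff dB !cstE /diag2_mx scale_block_mx add_block_mx !scaler0 !addr0.
by rewrite /mxcs cstE affE mxcurv_iter_diag2 mxtrace_diag2 raddfD.
Qed.

Section DirectSum.
Context (K : fieldType) (A : algType K) (Om : dga A) (M N : lmodType A^c) (m n : nat).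
Context (i : {linear M -> 'rV[A^c]_m}) (p : {linear 'rV[A^c]_m -> M}).
Context (i' : {linear N -> 'rV[A^c]_n}) (p' : {linear 'rV[A^c]_n -> N}).

(** With [dsum_out], the presentation used in [dsum_fgproj], named here because block matrices are
    computed in it and the existential of [fgproj] hides it. *)
Definition dsum_in (x : M * N) : 'rV[A^c]_(m + n) := row_mx (i x.1) (i' x.2).
Definition dsum_out (v : 'rV[A^c]_(m + n)) : M * N := (p (lsubmx v), p' (rsubmx v)).

Lemma dsum_in_linear : linear dsum_in.
Proof. by move=> a x y; rewrite /dsum_in scale_row_mx add_row_mx !linearP. Qed.
HB.instance Definition _ := GRing.isLinear.Build A^c (M * N)%type 'rV[A^c]_(m + n) *:%R
  dsum_in dsum_in_linear.

Lemma dsum_out_linear : linear dsum_out.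
Proof. by move=> a x y; rewrite /dsum_out; congr (_, _); rewrite linearP /= linearP. Qed.
HB.instance Definition _ := GRing.isLinear.Build A^c 'rV[A^c]_(m + n) (M * N)%type *:%R
  dsum_out dsum_out_linear.

Lemma dsum_inK : cancel i p -> cancel i' p' -> cancel dsum_in dsum_out.
Proof.
by move=> ipK ipK' [x y]; rewrite /dsum_out /dsum_in row_mxKl row_mxKr /= ipK ipK'.
Qed.

Lemma gen_lshift b : gen dsum_out (lshift n b) = pinl _ (gen p b).
Proof.
rewrite /gen /dsum_out; congr (p _, _); first by apply/rowP => c; rewrite !mxE /= eq_lshift.
by rewrite [rsubmx _](_ : _ = 0) ?raddf0 //; apply/rowP => c; rewrite !mxE /= eq_rlshift.
Qed.

Lemma gen_rshift b : gen dsum_out (rshift m b) = pinr _ (gen p' b).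
Proof.
rewrite /gen /dsum_out; congr (_, p' _); last by apply/rowP => c; rewrite !mxE /= eq_rshift.
by rewrite [lsubmx _](_ : _ = 0) ?raddf0 //; apply/rowP => c; rewrite !mxE /= eq_lrshift.
Qed.

Lemma coord_map_pinl a (x : mform Om M) :
  coord dsum_in a (mform_map (@pinl _ M N) x) =
  if split a is inl b then coord i b x else 0.
Proof.
pose h (x : mform Om M) : Om := if split a is inl b then coord i b x else 0.
pose g (x : mform Om M) := coord dsum_in a (mform_map (@pinl _ M N) x).
rewrite -/(g x) -/(h x); apply: tens_lin_ext x => [x y|x y|u w]; rewrite /g.
- by rewrite mform_mapD raddfD.
- by rewrite /h; case: (split a) => b; rewrite ?raddfD ?addr0.
rewrite -/(mpure Om u w) mform_map_pure coord_pure /h /= /dsum_in mxE.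
by case: (split a) => b; rewrite ?coord_pure // raddf0 mxE [demb Om _]raddf0 mul0r.
Qed.

Lemma coord_map_pinr a (x : mform Om N) :
  coord dsum_in a (mform_map (@pinr _ M N) x) =
  if split a is inr b then coord i' b x else 0.
Proof.
pose h (x : mform Om N) : Om := if split a is inr b then coord i' b x else 0.
pose g (x : mform Om N) := coord dsum_in a (mform_map (@pinr _ M N) x).
rewrite -/(g x) -/(h x); apply: tens_lin_ext x => [x y|x y|u w]; rewrite /g.
- by rewrite mform_mapD raddfD.
- by rewrite /h; case: (split a) => b; rewrite ?raddfD ?addr0.
rewrite -/(mpure Om u w) mform_map_pure coord_pure /h /= /dsum_in mxE.
by case: (split a) => b; rewrite ?coord_pure // raddf0 mxE [demb Om _]raddf0 mul0r.
Qed.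

Lemma idem_mx_dsum : idem_mx Om dsum_in dsum_out = diag2_mx (idem_mx Om i p) (idem_mx Om i' p').
Proof.
apply/matrixP => a b; rewrite [LHS]mxE /diag2_mx.
case: (split_ordP b) => c ->; case: (split_ordP a) => d ->;
  rewrite ?gen_lshift ?gen_rshift /= /dsum_in ?row_mxEl ?row_mxEr
    ?block_mxEul ?block_mxEur ?block_mxEdl ?block_mxEdr /= ?raddf0 !mxE //;
  exact: raddf0.
Qed.

Lemma conn_mx_dsum (D : M -> mform Om M) (E : N -> mform Om N) :
  is_conn Om M D -> is_conn Om N E ->
  conn_mx dsum_in dsum_out (dsum D E) = diag2_mx (conn_mx i p D) (conn_mx i' p' E).
Proof.
move=> cD cE; apply/matrixP => a b; rewrite [LHS]mxE /dsum raddfD.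
rewrite [X in X + _]coord_map_pinl [X in _ + X]coord_map_pinr /diag2_mx.
case: (split_ordP b) => c ->; case: (split_ordP a) => d ->;
  rewrite ?gen_lshift ?gen_rshift /= ?(conn0 cD) ?(conn0 cE) ?(unsplitK (inl _)) ?(unsplitK (inr _))
    ?block_mxEul ?block_mxEur ?block_mxEdl ?block_mxEdr !mxE ?raddf0 ?addr0 ?add0r //.
Qed.

End DirectSum.

(** * Paths of connections in coordinates *)

Lemma poly_monomial_ind (R : nzRingType) (P : {poly R} -> Prop) :
  (forall a k, P (a%:P * 'X^k)) -> P 0 ->
  (forall p q, P p -> P q -> P (p + q)) -> forall p, P p.
Proof.
move=> h h0 hD p; rewrite -[p]coefK poly_def; elim/big_ind: _ => // i _.
by rewrite -mul_polyC.
Qed.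

Section ScalarPolynomials.
Context (K : fieldType) (A : algType K).

Definition scpoly (q : {poly K}) : {poly A} := map_poly (in_alg A) q.
HB.instance Definition _ := GRing.RMorphism.copy scpoly (map_poly (in_alg A)).

Lemma scpolyZ (c : K) q : scpoly (c *: q) = scpoly q * (c%:A)%:P.
Proof.
rewrite /scpoly map_polyZ; apply/polyP => k; rewrite coefMC coefZ coef_map /=.
exact: comm_scal.
Qed.

Lemma scpoly_comm q (r : {poly A}) : scpoly q * r = r * scpoly q.
Proof.
apply/polyP => k; rewrite coefM coefMr; apply: eq_bigr => j _.
by rewrite coef_map /= comm_scal.
Qed.

Lemma scpolyC (c : K) : scpoly c%:P = (c%:A)%:P.
Proof. exact: map_polyC. Qed.

Lemma scpolyX : scpoly 'X = 'X.
Proof. exact: map_polyX. Qed.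

Lemma scpoly_deriv q : scpoly q^`() = (scpoly q)^`().
Proof. exact/esym/deriv_map. Qed.

End ScalarPolynomials.

Section PolynomialModule.
Context (K : fieldType) (A : algType K) (M : lmodType A^c) (n : nat).
Context (i : {linear M -> 'rV[A^c]_n}) (p : {linear 'rV[A^c]_n -> M}).
Hypothesis ipK : cancel i p.
Local Notation tmod_pure := (@tmod_pure K A M).

Definition tmod_coord (q : {poly K}) (m : M) : 'rV[(tpoly A)^c]_n :=
  \row_j (scpoly A q * ((i m 0 j : A)%:P) : tpoly A).

Definition tmod_in (x : tmod M) : 'rV[(tpoly A)^c]_n := tlift tmod_coord x.

Lemma tmod_coord_balanced : balanced (fun (q : {poly K}) (c : K) => c *: q)
  (fun (c : K) (m : M) => rmul m (c%:A : A)) tmod_coord.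
Proof.
split=> [q q' m|q m m'|q c m]; apply/rowP => j; rewrite !mxE.
- by rewrite raddfD mulrDl.
- by rewrite raddfD mxE polyCD mulrDr.
by rewrite coord_rmul -comm_scal polyCM scpolyZ mulrA.
Qed.

Lemma tmod_in_pure q m : tmod_in (tmod_pure q m) = tmod_coord q m.
Proof. exact: tlift_pure tmod_coord_balanced. Qed.

Lemma tmod_in_pureE q m j :
  tmod_in (tmod_pure q m) 0 j = scpoly A q * ((i m 0 j : A)%:P) :> tpoly A.
Proof. by rewrite tmod_in_pure mxE. Qed.

Lemma tmod_inD : {morph tmod_in : x y / x + y}.
Proof. exact: tliftD tmod_coord_balanced. Qed.

(** By additivity the scalar may be taken to be a monomial a t^k, whose action is explicit; t is
    central and can be moved past the coefficients. *)
Lemma tmod_inZ (r : (tpoly A)^c) x : tmod_in (r *: x) = r *: tmod_in x.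
Proof.
pose g x := tmod_in (r *: x); pose h x := r *: tmod_in x.
rewrite -/(g x) -/(h x); apply: tens_lin_ext x => [x y|x y|q m]; rewrite /g /h.
- by rewrite scalerDr tmod_inD.
- by rewrite tmod_inD scalerDr.
rewrite -/(tmod_pure q m) {g h}; elim/poly_monomial_ind: r => [a k||r s hr hs].
- rewrite [_ *: _]tmod_scaleC; apply/rowP => j; rewrite mxE !tmod_in_pureE.
  rewrite [RHS](_ : _ = scpoly A q * (i m 0 j : A)%:P * (a%:P * 'X^k)) //.
  rewrite coord_rmul rmorphM /= rmorphXn /= scpolyX polyCM.
  rewrite -!mulrA; congr (_ * _); rewrite [RHS]mulrA; exact/esym/commr_polyXn.
- by rewrite !scale0r; apply: (addrI (tmod_in 0)); rewrite -tmod_inD !addr0.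
by rewrite !scalerDl tmod_inD hr hs.
Qed.

Lemma tmod_in_linear : linear tmod_in.
Proof. by move=> r x y; rewrite tmod_inD tmod_inZ. Qed.
HB.instance Definition _ := GRing.isLinear.Build (tpoly A)^c (tmod M) 'rV[(tpoly A)^c]_n *:%R
  tmod_in tmod_in_linear.

Definition tmod_out (v : 'rV[(tpoly A)^c]_n) : tmod M :=
  \sum_j v 0 j *: tmod_pure (1 : {poly K}) (gen p j).

Lemma tmod_out_linear : linear tmod_out.
Proof.
move=> r u v; rewrite /tmod_out scaler_sumr -big_split; apply: eq_bigr => j _.
by rewrite !mxE scalerDl scalerA.
Qed.
HB.instance Definition _ := GRing.isLinear.Build (tpoly A)^c 'rV[(tpoly A)^c]_n (tmod M) *:%R
  tmod_out tmod_out_linear.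

Lemma gen_tmod_out j : gen tmod_out j = tmod_pure (1 : {poly K}) (gen p j).
Proof.
rewrite /gen /= /tmod_out (bigD1 j) //= mxE !eqxx scale1r big1 ?addr0 // => k kj.
by rewrite mxE (negbTE kj) andbF scale0r.
Qed.

Lemma tmod_pureDl (q q' : {poly K}) m : tmod_pure (q + q') m = tmod_pure q m + tmod_pure q' m.
Proof. by have [h _ _] := tmod_pure_balanced M; exact: h. Qed.
Lemma tmod_pureDr (q : {poly K}) m m' : tmod_pure q (m + m') = tmod_pure q m + tmod_pure q m'.
Proof. by have [_ h _] := tmod_pure_balanced M; exact: h. Qed.
Lemma tmod_pureA q (c : K) m : tmod_pure (c *: q) m = tmod_pure q (rmul m (c%:A : A)).
Proof. by have [_ _ h] := tmod_pure_balanced M; exact: h. Qed.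

Lemma tmod_scale_scpoly q (a : A) m :
  (scpoly A q * a%:P : (tpoly A)^c) *: tmod_pure (1 : {poly K}) m = tmod_pure q (rmul m a).
Proof.
elim/poly_monomial_ind: q => [c k||q r hq hr].
- rewrite rmorphM /= rmorphXn /= scpolyC scpolyX -mulrA -commr_polyXn mulrA -polyCM.
  rewrite [LHS]tmod_scaleC mul1r -rmulA mul_polyC tmod_pureA.
  by rewrite !rmulA comm_scal.
- rewrite raddf0 mul0r scale0r; apply/esym.
  exact: (balanced0l _ (@tmod_pure_balanced K A M)).
by rewrite raddfD mulrDl scalerDl hq hr tmod_pureDl.
Qed.

Lemma tmod_inK : cancel tmod_in tmod_out.
Proof.
move=> x; pose g x := tmod_out (tmod_in x).
rewrite -/(g x); apply: (@tens_lin_ext _ _ _ _ _ _ g id) x => [x y|//|q m].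
  by rewrite /g tmod_inD raddfD.
rewrite /g -/(tmod_pure q m) /tmod_out [in RHS](gen_sum ipK m).
rewrite (big_morph (tmod_pure q) (tmod_pureDr q) (balanced0r q (@tmod_pure_balanced K A M))).
by apply: eq_bigr => j _; rewrite tmod_in_pureE tmod_scale_scpoly.
Qed.

End PolynomialModule.

Section PathConnection.
Context (K : fieldType) (A : algType K) (Om : dga A) (M : lmodType A^c) (n : nat).
Context (i : {linear M -> 'rV[A^c]_n}) (p : {linear 'rV[A^c]_n -> M}).
Hypothesis ipK : cancel i p.
Local Notation tmod_pure := (@tmod_pure K A M).
Local Notation ppure := (@ppure K A Om M).
Implicit Types (q : {poly K}) (x : mform Om M) (y : pform Om M).

Lemma ppure_balanced : balanced (fun (q : {poly K}) (c : K) => c *: q)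
  (fun (c : K) x => rmul x (c%:A : Om)) ppure.
Proof. exact: balanced_tpure. Qed.

Lemma ppureDl q q' x : ppure (q + q') x = ppure q x + ppure q' x.
Proof. by have [h _ _] := ppure_balanced; exact: h. Qed.
Lemma ppureDr q x x' : ppure q (x + x') = ppure q x + ppure q x'.
Proof. by have [_ h _] := ppure_balanced; exact: h. Qed.
Lemma ppureA q (c : K) x : ppure (c *: q) x = ppure q (rmul x (c%:A : Om)).
Proof. by have [_ _ h] := ppure_balanced; exact: h. Qed.

Lemma pmull_balanced q : balanced (fun (q : {poly K}) (c : K) => c *: q)
  (fun (c : K) x => rmul x (c%:A : Om)) (fun r x => ppure (q * r) x).
Proof.
split=> [r r' x|r x x'|r c x]; rewrite ?mulrDr ?ppureDl ?ppureDr //.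
by rewrite -scalerAr ppureA.
Qed.

Lemma pmull_pure q r x : pmull q (ppure r x) = ppure (q * r) x.
Proof. exact: tlift_pure (pmull_balanced q). Qed.
Lemma pmullD q : {morph pmull (M := M) (Om := Om) q : y y' / y + y'}.
Proof. exact: tliftD (pmull_balanced q). Qed.

Lemma pmulr_balanced w : balanced (fun (q : {poly K}) (c : K) => c *: q)
  (fun (c : K) x => rmul x (c%:A : Om)) (fun r x => ppure r (rmul x w)).
Proof.
split=> [r r' x|r x x'|r c x]; rewrite ?rmulDl ?ppureDl ?ppureDr //.
by rewrite ppureA !rmulA comm_scal.
Qed.

Lemma pmulr_pure r x w : pmulr (ppure r x) w = ppure r (rmul x w).
Proof. exact: tlift_pure (pmulr_balanced w). Qed.
Lemma pmulrD w : {morph (fun y => pmulr y w) : y y' / y + y'}.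
Proof. exact: tliftD (pmulr_balanced w). Qed.

Lemma peval_balanced c : balanced (fun (q : {poly K}) (c : K) => c *: q)
  (fun (c : K) x => rmul x (c%:A : Om)) (fun (q : {poly K}) x => rmul x (q.[c]%:A : Om)).
Proof.
split=> [r r' x|r x x'|r b x]; rewrite ?rmulDl //.
  by rewrite hornerD scalerDl rmulDr.
by rewrite rmulA hornerZ -scalerAl mul1r scalerA.
Qed.

Lemma peval_pure c q x : peval c (ppure q x) = rmul x (q.[c]%:A : Om).
Proof. exact: tlift_pure (peval_balanced c). Qed.
Lemma pevalD c : {morph peval (M := M) (Om := Om) c : y y' / y + y'}.
Proof. exact: tliftD (peval_balanced c). Qed.

Definition pcoord (a : 'I_n) (y : pform Om M) : {poly Om} :=
  tlift (fun q x => scpoly Om q * (coord i a x)%:P) y.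

Lemma pcoord_balanced a : balanced (fun (q : {poly K}) (c : K) => c *: q)
  (fun (c : K) x => rmul x (c%:A : Om)) (fun q x => scpoly Om q * (coord i a x)%:P).
Proof.
split=> [r r' x|r x x'|r c x]; rewrite ?raddfD ?mulrDl ?polyCD ?mulrDr //.
by rewrite scpolyZ coordZ -comm_scal polyCM mulrA.
Qed.

Lemma pcoord_pure a q x : pcoord a (ppure q x) = scpoly Om q * (coord i a x)%:P.
Proof. exact: tlift_pure (pcoord_balanced a). Qed.
Lemma pcoordD a : {morph pcoord a : y y' / y + y'}.
Proof. exact: tliftD (pcoord_balanced a). Qed.

Lemma pcoord_pmull a q y : pcoord a (pmull q y) = scpoly Om q * pcoord a y.
Proof.
apply: (@tens_lin_ext _ _ _ _ _ _ (fun y => pcoord a (pmull q y))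
  (fun y => scpoly Om q * pcoord a y)) y => [x y|x y|r x].
- by rewrite pmullD pcoordD.
- by rewrite pcoordD mulrDr.
by rewrite -/(ppure r x) pmull_pure !pcoord_pure rmorphM mulrA.
Qed.

Lemma pcoord_pmulr a y w : pcoord a (pmulr y w) = pcoord a y * w%:P.
Proof.
apply: (@tens_lin_ext _ _ _ _ _ _ (fun y => pcoord a (pmulr y w))
  (fun y => pcoord a y * w%:P)) y => [x y|x y|r x].
- by rewrite pmulrD pcoordD.
- by rewrite pcoordD mulrDl.
by rewrite -/(ppure r x) pmulr_pure !pcoord_pure coordZ polyCM mulrA.
Qed.

Lemma coord_peval a c y : coord i a (peval c y) = (pcoord a y).[c%:A].
Proof.
apply: (@tens_lin_ext _ _ _ _ _ _ (fun y => coord i a (peval c y))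
  (fun y => (pcoord a y).[c%:A])) y => [x y|x y|r x].
- by rewrite pevalD raddfD.
- by rewrite pcoordD hornerD.
rewrite -/(ppure r x) peval_pure pcoord_pure coordZ hornerM_comm ?hornerC; last first.
  exact: comm_scal.
by rewrite /scpoly (horner_map (in_alg Om)) /= comm_scal.
Qed.

Definition tcoord (a : 'I_n) (u : mform (cyl Om) (tmod M)) : cyl Om :=
  @coord K (tpoly A) (cyl Om) (tmod M) n (tmod_in i) a u.

Lemma tcoordD a : {morph tcoord a : u v / u + v}.
Proof. exact: raddfD. Qed.

(** Identities in the iterated tensor product, balancedness above all, are checked through
    coordinates, where they become identities between pairs of polynomials. *)
Lemma tcoord_inj u v : (forall a, tcoord a u = tcoord a v) -> u = v.
Proof. exact: (coord_inj (tmod_inK ipK)). Qed.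

Lemma coord_tmod_pure a q m (P Q : {poly Om}) :
  tcoord a (mpure (cyl Om) (tmod_pure q m) (Cyl P Q : cyl Om)) =
  (Cyl (scpoly Om q * (demb Om (i m 0 a : A))%:P * P)
       (scpoly Om q * (demb Om (i m 0 a : A))%:P * Q) : cyl Om).
Proof.
rewrite /tcoord coord_pure tmod_in_pureE.
have e : map_poly (demb Om) (scpoly A q * (i m 0 a : A)%:P) =
    scpoly Om q * (demb Om (i m 0 a : A))%:P.
  rewrite rmorphM /= map_polyC; congr (_ * _); apply/polyP => k.
  by rewrite !coef_map /= [LHS]linearZ /= rmorph1.
congr Cyl; rewrite /= ?e // mul0r add0r -e /cyl_emb /=.
by rewrite psgn_emb.
Qed.

Let pform_cyl_pure (q : {poly K}) m (w : Om) :=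
  mpure (cyl Om) (tmod_pure q m) (Cyl w%:P 0 : cyl Om).

Lemma pform_cyl_pure_balanced q :
  balanced (@rmul A M) (fun (a : A) (w : Om) => demb Om a * w) (pform_cyl_pure q).
Proof.
split=> [m m' w|m w w'|m b w]; apply: tcoord_inj => a; rewrite ?tcoordD /= !coord_tmod_pure.
- by rewrite raddfD mxE [demb Om _]raddfD polyCD; congr Cyl; rewrite /= mulrDr mulrDl.
- by congr Cyl; rewrite /= ?polyCD ?mulr0 ?addr0 ?mulrDr.
rewrite coord_rmul; congr Cyl; rewrite /= ?mulr0 //.
by rewrite rmorphM !polyCM !mulrA.
Qed.

Lemma coord_pform_cyl_inner a q x :
  tcoord a (tlift (pform_cyl_pure q) x) =
  (Cyl (scpoly Om q * (coord i a x)%:P) 0 : cyl Om).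
Proof.
pose h x : cyl Om := Cyl (scpoly Om q * (coord i a x)%:P) 0.
apply: (@tens_lin_ext _ _ _ _ _ _
  (fun x => tcoord a (tlift (pform_cyl_pure q) x)) h) x => [x y|x y|m w].
- by rewrite (tliftD (pform_cyl_pure_balanced q)) tcoordD.
- by rewrite /h raddfD polyCD mulrDr; congr Cyl; rewrite /= addr0.
rewrite (tlift_pure _ _ (pform_cyl_pure_balanced q)) coord_tmod_pure /h mulr0.
by rewrite -/(mpure Om m w) coord_pure polyCM mulrA.
Qed.

Lemma pform_cyl_balanced : balanced (fun (q : {poly K}) (c : K) => c *: q)
  (fun (c : K) x => rmul x (c%:A : Om)) (fun q x => tlift (pform_cyl_pure q) x).
Proof.
split=> [r r' x|r x x'|r c x]; apply: tcoord_inj => a;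
  rewrite ?tcoordD /= !coord_pform_cyl_inner.
- by rewrite raddfD mulrDl; congr Cyl; rewrite /= addr0.
- by rewrite raddfD polyCD mulrDr; congr Cyl; rewrite /= addr0.
by rewrite scpolyZ coordZ -comm_scal polyCM mulrA.
Qed.

Lemma pform_cylD : {morph pform_cyl (Om := Om) (M := M) : y y' / y + y'}.
Proof. exact: tliftD pform_cyl_balanced. Qed.

Lemma coord_pform_cyl a y :
  tcoord a (pform_cyl y) = (Cyl (pcoord a y) 0 : cyl Om).
Proof.
pose h y : cyl Om := Cyl (pcoord a y) 0.
apply: (@tens_lin_ext _ _ _ _ _ _ (fun y => tcoord a (pform_cyl y)) h) y => [x y|x y|q x].
- by rewrite pform_cylD tcoordD.
- by rewrite /h pcoordD; congr Cyl; rewrite /= addr0.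
rewrite /pform_cyl (tlift_pure _ _ pform_cyl_balanced) coord_pform_cyl_inner.
by rewrite /h -/(ppure q x) pcoord_pure.
Qed.

End PathConnection.

(** * A path of connections as a connection over the cylinder *)

Section CylinderConnection.
Context (K : fieldType) (A : algType K) (Om : dga A) (M : lmodType A^c) (n : nat).
Context (i : {linear M -> 'rV[A^c]_n}) (p : {linear 'rV[A^c]_n -> M}).
Hypothesis ipK : cancel i p.
Context (P : M -> pform Om M) (pathP : is_path P).
Local Notation tmod_pure := (@tmod_pure K A M).
Local Notation scO := (scpoly Om).

Let im m a : Om := demb Om (i m 0 a : A).

Let path_conn_pure (q : {poly K}) m :=
  mpure (cyl Om) (tmod_pure 1 m) (Cyl 0 (map_poly (in_alg Om) (q^`())) : cyl Om) +
  pform_cyl (pmull q (P m)).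

Lemma coord_path_conn_pure a q m : tcoord i a (path_conn_pure q m) =
  (Cyl (scO q * pcoord i a (P m)) ((im m a)%:P * (scO q)^`()) : cyl Om).
Proof.
rewrite tcoordD coord_tmod_pure (coord_pform_cyl ipK) pcoord_pmull -scpoly_deriv.
rewrite /scpoly rmorph1 mul1r mulr0.
by congr Cyl; rewrite /= ?add0r ?addr0.
Qed.

Lemma path_conn_balanced : balanced (fun (q : {poly K}) (c : K) => c *: q)
  (fun (c : K) (m : M) => rmul m (c%:A : A)) path_conn_pure.
Proof.
have [PD PK _ _] := pathP.
have imD a : {morph im^~ a : m m' / m + m'}.
  by move=> m m'; rewrite /im raddfD mxE [LHS]raddfD.
split=> [q q' m|q m m'|q c m]; apply: (tcoord_inj ipK) => a; rewrite coord_path_conn_pure.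
- rewrite [RHS]tcoordD !coord_path_conn_pure.
  by rewrite raddfD derivD mulrDl mulrDr.
- rewrite [RHS]tcoordD !coord_path_conn_pure.
  by rewrite PD pcoordD imD polyCD mulrDl mulrDr.
have imZ : im (rmul m (c%:A : A)) a = c%:A * im m a.
  by rewrite /im coord_rmul -comm_scal rmorphM /= linearZ /= rmorph1.
rewrite coord_path_conn_pure PK pcoord_pmull scpolyC scpolyZ derivM derivC mulr0 addr0.
congr Cyl; first by rewrite mulrA.
by rewrite imZ polyCM -(scpolyC Om) -[in RHS]mulrA [in RHS]scpoly_comm mulrA.
Qed.

Lemma path_connD : {morph path_conn P : u v / u + v}.
Proof. exact: tliftD path_conn_balanced. Qed.

Lemma tcoord_path_conn a q m : tcoord i a (path_conn P (tmod_pure q m)) =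
  (Cyl (scO q * pcoord i a (P m)) ((im m a)%:P * (scO q)^`()) : cyl Om).
Proof.
by rewrite /path_conn (tlift_pure _ _ path_conn_balanced) coord_path_conn_pure.
Qed.

Lemma homog1_pcoord a m k : homog 1 (pcoord i a (P m))`_k.
Proof.
have [_ _ PS _] := pathP; have [s [sP ->]] := PS m.
rewrite (big_morph _ (pcoordD i a) (_ : pcoord i a 0 = 0)); last first.
  by apply: (addrI (pcoord i a 0)); rewrite -pcoordD !addr0.
rewrite coef_sum big_seq; apply: big_ind => [|u v|q /sP hq].
- by rewrite /homog raddf0.
- by rewrite /homog => hu hv; rewrite raddfD /= hu hv.
rewrite pcoord_pure coefMC coef_map /= -scalerAl mul1r /homog linearZ /=.
by rewrite (homog_coord i a hq).
Qed.

Lemma pcoord_path_leibniz b m (a : A) :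
  pcoord i b (P (rmul m a)) =
  (im m b * ddiff Om (demb Om a))%:P + pcoord i b (P m) * (demb Om a)%:P.
Proof.
have [_ _ _ PL] := pathP.
by rewrite PL pcoordD pcoord_pmulr pcoord_pure coord_pure /scpoly rmorph1 mul1r.
Qed.

Lemma cyl_emb_monomial (a : A) k :
  demb (cyl Om) (a%:P * 'X^k : {poly A}) = (Cyl ((demb Om a)%:P * 'X^k) 0 : cyl Om).
Proof. by congr Cyl; rewrite rmorphM /= map_polyC map_polyXn. Qed.

Lemma ddiff_cyl_monomial (w : Om) k :
  ddiff (cyl Om) (Cyl (w%:P * 'X^k) 0 : cyl Om) =
  (Cyl ((ddiff Om w)%:P * 'X^k) (w%:P * ('X^k)^`()) : cyl Om).
Proof.
have e : pdiff (w%:P * 'X^k) = (ddiff Om w)%:P * 'X^k.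
  apply/polyP => l; rewrite coef_pdiff !coefCM !coefXn.
  by case: eqP; rewrite ?mulr1 // !mulr0 raddf0.
by congr Cyl; rewrite /= ?e // raddf0 subr0 derivM derivC mul0r add0r.
Qed.

Lemma tcoord_leibniz_pure b q m (a : A) k (r : tpoly A := a%:P * 'X^k : {poly A}) :
  tcoord i b (path_conn P (rmul (tmod_pure q m) r)) =
  tcoord i b (path_conn P (tmod_pure q m)) * demb (cyl Om) r +
  tcoord i b (mpure (cyl Om) (tmod_pure q m) (ddiff (cyl Om) (demb (cyl Om) r))).
Proof.
rewrite {1}/r [rmul _ _]tmod_scaleC !tcoord_path_conn cyl_emb_monomial.
rewrite ddiff_cyl_monomial coord_tmod_pure pcoord_path_leibniz.
have qX : scO (q * 'X^k) = scO q * 'X^k by rewrite rmorphM /= rmorphXn /= scpolyX.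
have Xc (R : {poly Om}) : 'X^k * R = R * 'X^k by rewrite commr_polyXn.
have imr : im (rmul m a) b = im m b * demb Om a.
  by rewrite /im coord_rmul rmorphM.
congr Cyl.
- rewrite /= qX mulrDr addrC; congr (_ + _).
    by rewrite -!mulrA Xc !mulrA.
  by rewrite polyCM -!mulrA Xc !mulrA.
rewrite /= mulr0 addr0 imr qX derivM mulrDr polyCM; congr (_ + _).
  by rewrite -!mulrA [(demb Om a)%:P * _]mulrA -scpoly_deriv -scpoly_comm scpoly_deriv !mulrA.
by rewrite -!mulrA [(demb Om a)%:P * _]mulrA -scpoly_comm !mulrA -scpoly_comm.
Qed.

Lemma path_conn0 : path_conn P 0 = 0.
Proof. exact: tlift0 path_conn_balanced. Qed.

(** Both sides are additive in [u] and in [r], which leaves pure tensors and monomial scalars. *)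
Lemma path_conn_leibniz u (r : tpoly A) :
  path_conn P (rmul u r) =
  rmul (path_conn P u) (demb (cyl Om) r) +
  mpure (cyl Om) u (ddiff (cyl Om) (demb (cyl Om) r)).
Proof.
apply: (tcoord_inj ipK) => b; rewrite tcoordD.
rewrite [X in _ = X + _](coordZ (tmod_in i)) -/(tcoord i b _).
pose g u := tcoord i b (path_conn P (rmul u r)).
pose h u := tcoord i b (path_conn P u) * demb (cyl Om) r +
  tcoord i b (mpure (cyl Om) u (ddiff (cyl Om) (demb (cyl Om) r))).
rewrite -/(g u) -/(h u); apply: tens_lin_ext u => [u v|u v|q m]; rewrite /g /h {g h}.
- by rewrite rmulDl path_connD tcoordD.
- by rewrite path_connD tcoordD mulrDl mpureDl tcoordD addrACA.
rewrite -/(tmod_pure q m); elim/poly_monomial_ind: r => [a k||r s hr hs].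
- exact: tcoord_leibniz_pure.
- rewrite /rmul scale0r raddf0 path_conn0 raddf0 mulr0 mpure0r.
  by apply: (addrI (tcoord i b 0)); rewrite -tcoordD !addr0 add0r -tcoordD addr0.
rewrite rmulDr path_connD tcoordD hr hs raddfD mulrDr raddfD mpureDr tcoordD.
by rewrite addrACA.
Qed.

Lemma homog_cyl (Q R : {poly Om}) k :
  (forall l, homog k.+1 Q`_l) -> (forall l, homog k R`_l) ->
  homog k.+1 (Cyl Q R : cyl Om).
Proof.
by move=> hQ hR; congr Cyl; apply/polyP => l; rewrite coef_pproj; [exact: hQ|exact: hR].
Qed.

Lemma homog_coef_scpoly q (R : {poly Om}) k l :
  (forall l, homog k R`_l) -> homog k (scO q * R)`_l.
Proof.
move=> hR; rewrite coefM; apply: homog_sum => j.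
by rewrite coef_map /= -scalerAl mul1r; exact: homogZ.
Qed.

Lemma is_conn_path_conn : is_conn (cyl Om) (tmod M) (path_conn P).
Proof.
split; [exact: path_connD| | |exact: path_conn_leibniz].
  move=> c u; rewrite path_conn_leibniz.
  by rewrite ddiff_scal demb_scal mpure0r addr0.
move=> u; apply: (mform_in_coord (tmod_inK ipK)) => b; rewrite -/(tcoord i b _).
elim/tens_ind: u => [q m||u v hu hv].
- rewrite -/(tmod_pure q m) tcoord_path_conn; apply: homog_cyl => l.
    by apply: homog_coef_scpoly => {}l; exact: homog1_pcoord.
  rewrite -scpoly_deriv -scpoly_comm; apply: homog_coef_scpoly => {}l.
  by rewrite coefC; case: eqP => _; [exact: homog_demb | exact: homog0].
- rewrite path_conn0 (_ : tcoord i b 0 = 0); first exact: homog0.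
  by apply: (addrI (tcoord i b 0)); rewrite -tcoordD !addr0.
by rewrite path_connD tcoordD; exact: homogD.
Qed.

Lemma idem_mx_tmod : idem_mx (cyl Om) (tmod_in i) (tmod_out p) = mxcst (idem_mx Om i p).
Proof.
apply/matrixP => a b; rewrite !mxE gen_tmod_out tmod_in_pureE /scpoly rmorph1 mul1r.
by congr Cyl; exact: map_polyC.
Qed.

Definition path_conn_mx : 'M[cyl Om]_n := conn_mx (tmod_in i) (tmod_out p) (path_conn P).

(** On a generator 1 (x) gen b the dt part is a multiple of the derivative of 1, so the connection
    matrix of a path has no dt part. *)
Lemma path_conn_mxE a b : path_conn_mx a b = (Cyl (pcoord i a (P (gen p b))) 0 : cyl Om).
Proof.
rewrite mxE gen_tmod_out -/(tcoord i a _) tcoord_path_conn /scpoly rmorph1 mul1r derivC.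
by rewrite mulr0.
Qed.

Lemma mxconn_path_conn_mx : mxconn (mxcst (idem_mx Om i p)) path_conn_mx.
Proof. rewrite -idem_mx_tmod; exact: (mxconn_conn_mx (tmod_inK ipK) is_conn_path_conn). Qed.

End CylinderConnection.

Section AffinePath.
Context (K : fieldType) (A : algType K) (Om : dga A) (M : lmodType A^c).
Context (D0 D1 : M -> mform Om M) (c0 : is_conn Om M D0) (c1 : is_conn Om M D1).

Lemma is_path_affine : is_path (affine_path D0 D1).
Proof.
have [d0 z0 h0 l0] := c0; have [d1 z1 h1 l1] := c1.
split=> [m m'|c m|m|m a]; rewrite /affine_path.
- by rewrite d0 d1 !ppureDr addrACA.
- by rewrite pmullD !pmull_pure z0 z1 -!ppureA !mul_polyC.
- exists [:: (1 - 'X, D0 m); ('X, D1 m)]; split; last by rewrite big_cons big_seq1.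
  by move=> x; rewrite !inE => /orP [] /eqP -> /=; [exact: h0|exact: h1].
rewrite l0 l1 !ppureDr pmulrD !pmulr_pure addrACA [RHS]addrC -ppureDl.
by rewrite subrK.
Qed.

Lemma path_from_to_affine : path_from_to (affine_path D0 D1) D0 D1.
Proof.
split=> [|m|m]; first exact: is_path_affine.
  rewrite pevalD !peval_pure !hornerE /= subr0 scale1r scale0r.
  by rewrite rmul1 /rmul scale0r addr0.
rewrite pevalD !peval_pure !hornerE /= subrr scale1r scale0r.
by rewrite rmul1 /rmul scale0r add0r.
Qed.

Context (n : nat) (i : {linear M -> 'rV[A^c]_n}) (p : {linear 'rV[A^c]_n -> M}).
Hypothesis ipK : cancel i p.

Lemma path_conn_mx_affine :
  path_conn_mx i p (affine_path D0 D1) = mxaff (conn_mx i p D0) (conn_mx i p D1).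
Proof.
apply/matrixP => a b; rewrite (path_conn_mxE ipK is_path_affine) !mxE.
rewrite pcoordD !pcoord_pure raddfB /= scpolyX /scpoly rmorph1.
congr Cyl; last by rewrite /= mulr0 mul0r !addr0.
rewrite /= mulrBl mul1r polyCB mulrBr -addrA; congr (_ + _); exact: addrC.
Qed.

End AffinePath.

(** * Chern character forms and their secondary forms *)

Section ExponentialSum.
Context (K : fieldType) (V : lmodType K).

(* Truncations at N; all identities between Chern forms are proved degree by
   degree, so only the truncation order needs to be adjusted. *)
Definition exp_sum (N : nat) (F : nat -> V) : V :=
  \sum_(k < N) (k`!%:R : K)^-1 *: F k.

Lemma exp_sumB N F G : exp_sum N F - exp_sum N G = exp_sum N (fun k => F k - G k).
Proof. by rewrite -sumrB; apply: eq_bigr => k _; rewrite scalerBr. Qed.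

Lemma exp_sumD N F G : exp_sum N F + exp_sum N G = exp_sum N (fun k => F k + G k).
Proof. by rewrite -big_split; apply: eq_bigr => k _; rewrite scalerDr. Qed.

End ExponentialSum.

Section Chern.
Context (K : fieldType) (charK : [pchar K] =i pred0).
Context (A : algType K) (Om : dga A).

Lemma gcomm_exp_sum N (F : nat -> Om) : (forall k, gcomm (F k)) -> gcomm (exp_sum N F).
Proof. by move=> h; apply: gcomm_sum => k _; exact: gcommZ. Qed.

Lemma exact_exp_sum (P : Om -> Prop) N (F : nat -> Om) : lin_closed P ->
  (forall k, exact_by P (F k)) -> exact_by P (exp_sum N F).
Proof. by move=> lP h; apply: exact_by_sum => // k; exact: exact_byZ. Qed.

Lemma ddiff_exp_sum N (F : nat -> Om) :
  ddiff Om (exp_sum N F) = exp_sum N (fun k => ddiff Om (F k)).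
Proof. by rewrite raddf_sum; apply: eq_bigr => k _; rewrite /= linearZ. Qed.

Context (M : lmodType A^c) (n : nat).
Context (i : {linear M -> 'rV[A^c]_n}) (p : {linear 'rV[A^c]_n -> M}).
Hypothesis ipK : cancel i p.
Context (D : M -> mform Om M) (cD : is_conn Om M D).

(** Terms beyond the chosen cut-off are commutators, and [trpow] agrees with the matrix trace term
    by term. The bound holds for all large N, so that several connections can share one order of
    truncation. *)
Lemma chKa_trunc : finite_ch D -> exists N0, forall N, (N0 <= N)%N ->
  gcomm (chKa D - exp_sum N (fun k => \tr (mxcurv_iter (idem_mx Om i p) (conn_mx i p D) k))).
Proof.
move=> fD; pose N0 := choose_or 0 (finite_from D); exists N0 => N N0N.
have fN : finite_from D N0 by exact: choose_orP.
apply: (@gcomm_trans _ _ _ (exp_sum N (trpow D))); last first.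
  by rewrite exp_sumB; apply: gcomm_exp_sum => k; exact: trpow_mxcurv.
rewrite /exp_sum -(subnKC N0N) big_split_ord /= opprD addrA subrr add0r.
by apply/gcommN/gcomm_sum => k _; apply/gcommZ/fN; rewrite leq_addr.
Qed.

Lemma evenf_chKa : evenf (chKa D).
Proof. by apply: evenf_sum => k _; apply: evenfZ; exact: (evenf_trpow charK ipK). Qed.

Lemma closedf_chKa : finite_ch D -> closedf (chKa D).
Proof.
move=> fD; have [N0 /(_ N0 (leqnn _)) /gcomm_ddiff] := chKa_trunc fD.
rewrite raddfB /= => h.
apply: gcomm_congr h _; rewrite ddiff_exp_sum; apply: gcomm_exp_sum => k.
apply: mxtrace_closed => //; exact: mxconn_conn_mx.
Qed.

End Chern.

(** * Properties of KCS: transgression, independence of the path, functoriality, additivity *)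

Section SecondaryForms.
Context (K : fieldType) (charK : [pchar K] =i pred0).
Context (A : algType K) (Om : dga A) (finOm : finite_chern Om).

Section Module.
Context (M : fgpmod A) (n : nat).
Context (i : {linear M -> 'rV[A^c]_n}) (p : {linear 'rV[A^c]_n -> M}).
Hypothesis ipK : cancel i p.
Local Notation e := (idem_mx Om i p).

Lemma fiber_int_exp_sum N (F : nat -> cyl Om) :
  fiber_int (exp_sum N F) = exp_sum N (fun k => fiber_int (F k)).
Proof. rewrite raddf_sum; apply: eq_bigr => k _; exact: fiber_intZ. Qed.

Lemma KCS_trunc (P : M -> pform Om M) : is_path P ->
  exists N0, forall N, (N0 <= N)%N ->
  gcomm (KCS P - exp_sum N (fun k => fiber_int (\tr (mxcurv_iter (mxcst e)
    (path_conn_mx i p P) k)))).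
Proof.
move=> pP; have [_ /(_ M P pP) fP] := finOm.
have [N0 hN] := chKa_trunc charK (tmod_inK ipK) (is_conn_path_conn ipK pP) fP.
exists N0 => N /hN /gcomm_fiber_int.
by rewrite idem_mx_tmod raddfB [X in _ - X]fiber_int_exp_sum.
Qed.

Lemma oddf_KCS (P : M -> pform Om M) : is_path P -> oddf (KCS P).
Proof.
move=> pP; apply: oddf_fiber_int.
exact: (evenf_chKa charK (tmod_inK ipK) (is_conn_path_conn ipK pP)).
Qed.

Lemma KCS_affine_trunc (D0 D1 : M -> mform Om M) :
  is_conn Om M D0 -> is_conn Om M D1 ->
  exists N0, forall N, (N0 <= N)%N ->
  gcomm (KCS (affine_path D0 D1) - exp_sum N (mxcs e (conn_mx i p D0) (conn_mx i p D1))).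
Proof.
move=> c0 c1; have [N0 hN] := KCS_trunc (is_path_affine c0 c1).
by exists N0 => N /hN; rewrite (path_conn_mx_affine c0 c1 ipK).
Qed.

Lemma KCS_affine_transgression (D0 D1 : M -> mform Om M) :
  is_conn Om M D0 -> is_conn Om M D1 ->
  gcomm (chKa D1 - chKa D0 - ddiff Om (KCS (affine_path D0 D1))).
Proof.
move=> c0 c1; have [f _] := finOm.
have [N0 h0] := chKa_trunc charK ipK c0 (f M D0 c0).
have [N1 h1] := chKa_trunc charK ipK c1 (f M D1 c1).
have [N2 h2] := KCS_affine_trunc c0 c1.
pose N := maxn N0 (maxn N1 N2).
have {}h0 := h0 N (leq_maxl _ _).
have {}h1 : gcomm _ := h1 N (leq_trans (leq_maxl _ _) (leq_maxr _ _)).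
have {}h2 : gcomm _ := h2 N (leq_trans (leq_maxr _ _) (leq_maxr _ _)).
have {}h2 := gcomm_ddiff h2; rewrite raddfB /= in h2.
apply: gcomm_congr (gcomm_sub2 (gcomm_sub2 h1 h0) h2) _.
rewrite ddiff_exp_sum !exp_sumB; apply: gcomm_exp_sum => k.
by apply: mxcs_transgression => //; exact: mxconn_conn_mx.
Qed.

Lemma map_eval_path (P : M -> pform Om M) (D : M -> mform Om M) c : is_path P ->
  (forall m, peval c (P m) = D m) ->
  map_mx (@cyl_eval _ _ Om c) (path_conn_mx i p P) = conn_mx i p D.
Proof.
move=> pP e; apply/matrixP => a b; rewrite [LHS]mxE (path_conn_mxE ipK pP) !mxE.
by rewrite -e coord_peval.
Qed.

(** The boundary terms of [fiber_int_homotopy] are the secondary forms between the endpoints: at t =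
    0 both paths are at [D0] and the term vanishes, at t = 1 it is that of the affine path from [D1]
    to [D2]. *)
Lemma KCS_paths (P P' : M -> pform Om M) (D0 D1 D2 : M -> mform Om M) :
  is_conn Om M D0 -> is_conn Om M D1 -> is_conn Om M D2 ->
  path_from_to P D0 D1 -> path_from_to P' D0 D2 ->
  exact_by (@evenf K A Om) (KCS P' - KCS P - KCS (affine_path D1 D2)).
Proof.
move=> c0 c1 c2 [pP e0 e1] [pP' e0' e2].
have [N0 h0] := KCS_trunc pP; have [N1 h1] := KCS_trunc pP'.
have [N2 h2] := KCS_affine_trunc c1 c2.
pose N := maxn N0 (maxn N1 N2).
have {}h0 := h0 N (leq_maxl _ _).
have {}h1 : gcomm _ := h1 N (leq_trans (leq_maxl _ _) (leq_maxr _ _)).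
have {}h2 : gcomm _ := h2 N (leq_trans (leq_maxr _ _) (leq_maxr _ _)).
apply: (exact_congr (evenf_lin Om) (gcomm_sub2 (gcomm_sub2 h1 h0) h2)).
rewrite !exp_sumB; apply: (exact_exp_sum _ (evenf_lin Om)) => k.
have := fiber_int_homotopy charK k (mxconn_path_conn_mx ipK pP) (mxconn_path_conn_mx ipK pP').
rewrite (map_eval_path pP e0) (map_eval_path pP e1).
by rewrite (map_eval_path pP' e0') (map_eval_path pP' e2)
  (mxcs_diag e (conn_mx i p D0)) [X in _ - X]subr0.
Qed.

(** The Grassmann connection p d i; it provides every finitely generated projective module with a
    connection. *)
Definition grassmann_conn (m : M) : mform Om M :=
  \sum_j mpure Om (gen p j) (ddiff Om (demb Om (i m 0 j : A))).

Lemma is_conn_grassmann : is_conn Om M grassmann_conn.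
Proof.
have gL m (a : A) : grassmann_conn (rmul m a) =
    rmul (grassmann_conn m) (demb Om a) + mpure Om m (ddiff Om (demb Om a)).
  rewrite {3}(gen_sum ipK m) (big_morph _ (fun m m' => mpureDl m m' _) (mpure0l _ _)).
  rewrite (big_morph (fun x => rmul x (demb Om a)) (fun x y => rmulDl x y _) (scaler0 _ _)).
  rewrite -big_split; apply: eq_bigr => j _ /=.
  by rewrite coord_rmul rmorphM ddiffMs sgnf_demb mpureDr mpureA rmul_pure.
split=> [m m'|c m|m|//].
- rewrite -big_split; apply: eq_bigr => j _.
  by rewrite raddfD mxE [demb Om _]raddfD raddfD mpureDr.
- by rewrite gL ddiff_scal demb_scal mpure0r addr0.
exists [seq (gen p j, ddiff Om (demb Om (i m 0 j : A))) | j <- enum 'I_n]; split.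
  by move=> _ /mapP [j _ ->] /=; apply/homog_ddiff/homog_demb.
by rewrite big_map big_enum.
Qed.

End Module.

Local Notation dexact := (exact_by (@evenf K A Om)).

Lemma fgpmod_has_conn (M : fgpmod A) : exists D, is_conn Om M D.
Proof.
have [n [i [p ipK]]] := fmodP M.
by exists (grassmann_conn i p); exact: is_conn_grassmann.
Qed.

Section OneModule.
Context (M : fgpmod A).
Implicit Types D : M -> mform Om M.

Lemma evenf_chern D : is_conn Om M D -> evenf (chKa D).
Proof. by move=> cD; have [n [i [p ipK]]] := fmodP M; exact: evenf_chKa. Qed.

Lemma closedf_chern D : is_conn Om M D -> closedf (chKa D).
Proof.
move=> cD; have [f _] := finOm; have [n [i [p ipK]]] := fmodP M.
by apply: (closedf_chKa charK ipK) => //; exact: f.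
Qed.

Lemma oddf_KCS_affine D0 D1 : is_conn Om M D0 -> is_conn Om M D1 ->
  oddf (KCS (affine_path D0 D1)).
Proof.
move=> c0 c1; have [n [i [p ipK]]] := fmodP M.
by apply: (oddf_KCS ipK); exact: is_path_affine.
Qed.

Lemma chern_transgression D0 D1 : is_conn Om M D0 -> is_conn Om M D1 ->
  gcomm (chKa D1 - chKa D0 - ddiff Om (KCS (affine_path D0 D1))).
Proof.
by have [n [i [p ipK]]] := fmodP M; exact: KCS_affine_transgression.
Qed.

Lemma KCS_affine_diag D : is_conn Om M D -> gcomm (KCS (affine_path D D)).
Proof.
move=> cD; have [n [i [p ipK]]] := fmodP M.
have [N /(_ N (leqnn N)) h] := KCS_affine_trunc ipK cD cD.
by apply: gcomm_congr h _; apply: gcomm_exp_sum => k; rewrite mxcs_diag; exact: gcomm0.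
Qed.

Lemma KCS_affine_trans D0 D1 D2 :
  is_conn Om M D0 -> is_conn Om M D1 -> is_conn Om M D2 ->
  dexact (KCS (affine_path D0 D2) - KCS (affine_path D0 D1) - KCS (affine_path D1 D2)).
Proof.
move=> c0 c1 c2; have [n [i [p ipK]]] := fmodP M.
by apply: (KCS_paths ipK c0 c1 c2); exact: path_from_to_affine.
Qed.

(** An arbitrary path and the affine one have the same endpoints, so [KCS_paths] leaves only the
    secondary form from [D1] to itself. *)
Lemma KCS_class_affine D0 D1 w : is_conn Om M D0 -> is_conn Om M D1 ->
  KCS_class D0 D1 w <-> dexact (KCS (affine_path D0 D1) - w).
Proof.
move=> c0 c1; split=> [[P hP e]|]; last first.
  by exists (affine_path D0 D1) => //; exact: path_from_to_affine.
have [n [i [p ipK]]] := fmodP M; have linE := evenf_lin Om.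
have h := KCS_paths ipK c0 c1 c1 hP (path_from_to_affine c0 c1).
apply: (exact_trans linE _ e); apply: (exact_subl linE h).
exact: (gcomm_exact linE (KCS_affine_diag c1)).
Qed.

End OneModule.

Section Pullback.
Context (M L : fgpmod A) (phi : {linear M -> L}) (psi : {linear L -> M}).
Hypotheses (phiK : cancel phi psi) (psiK : cancel psi phi).

Lemma chern_pullback D : is_conn Om L D -> gcomm (chKa (pullback phi psi D) - chKa D).
Proof.
move=> cD; have cD' := pullback_conn phiK cD; have [f _] := finOm.
have [n [i [p ipK]]] := fmodP L.
have ipK' : cancel (i \o phi) (psi \o p) by move=> m /=; rewrite ipK phiK.
have [N0 h0] := chKa_trunc charK ipK cD (f L D cD).
have [N1 h1] := chKa_trunc charK ipK' cD' (f M _ cD').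
have {}h0 := h0 (maxn N0 N1) (leq_maxl _ _).
have := h1 (maxn N0 N1) (leq_maxr _ _).
rewrite (idem_mx_pullback _ psiK) (conn_mx_pullback psiK) => {}h1.
exact: gcomm_trans h1 (gcomm_sym h0).
Qed.

Lemma KCS_affine_pullback D0 D1 : is_conn Om L D0 -> is_conn Om L D1 ->
  gcomm (KCS (affine_path (pullback phi psi D0) (pullback phi psi D1)) -
         KCS (affine_path D0 D1)).
Proof.
move=> c0 c1; have c0' := pullback_conn phiK c0; have c1' := pullback_conn phiK c1.
have [n [i [p ipK]]] := fmodP L.
have ipK' : cancel (i \o phi) (psi \o p) by move=> m /=; rewrite ipK phiK.
have [N0 h0] := KCS_affine_trunc ipK c0 c1.
have [N1 h1] := KCS_affine_trunc ipK' c0' c1'.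
have {}h0 := h0 (maxn N0 N1) (leq_maxl _ _).
have := h1 (maxn N0 N1) (leq_maxr _ _).
rewrite (idem_mx_pullback _ psiK) !(conn_mx_pullback psiK) => {}h1.
exact: gcomm_trans h1 (gcomm_sym h0).
Qed.

End Pullback.

Section DirectSum.
Context (M N : fgpmod A).

Lemma chern_dsum D E : is_conn Om M D -> is_conn Om N E ->
  gcomm (chKa (dsum D E : fgp_sum M N -> mform Om (fgp_sum M N)) - (chKa D + chKa E)).
Proof.
move=> cD cE; have cDE : is_conn Om (fgp_sum M N) (dsum D E) := dsum_conn cD cE.
have [f _] := finOm; have [n [i [p ipK]]] := fmodP M; have [n' [i' [p' ipK']]] := fmodP N.
have [N0 h0] := chKa_trunc charK ipK cD (f M D cD).
have [N1 h1] := chKa_trunc charK ipK' cE (f N E cE).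
have [N2 h2] := chKa_trunc charK (dsum_inK ipK ipK') cDE (f _ _ cDE).
pose B := maxn N0 (maxn N1 N2).
have {}h0 : gcomm _ := h0 B (leq_maxl _ _).
have {}h1 : gcomm _ := h1 B (leq_trans (leq_maxl _ _) (leq_maxr _ _)).
have := h2 B (leq_trans (leq_maxr _ _) (leq_maxr _ _)).
rewrite idem_mx_dsum (conn_mx_dsum _ _ _ _ cD cE) => {}h2.
apply: gcomm_trans h2 _.
have e : exp_sum B (fun k => \tr (mxcurv_iter (diag2_mx (idem_mx Om i p) (idem_mx Om i' p'))
      (diag2_mx (conn_mx i p D) (conn_mx i' p' E)) k)) =
    exp_sum B (fun k => \tr (mxcurv_iter (idem_mx Om i p) (conn_mx i p D) k)) +
    exp_sum B (fun k => \tr (mxcurv_iter (idem_mx Om i' p') (conn_mx i' p' E) k)).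
  rewrite exp_sumD; apply: eq_bigr => k _.
  by rewrite mxcurv_iter_diag2 mxtrace_diag2.
by rewrite e opprD addrACA; apply: gcommD; exact: gcomm_sym.
Qed.

Lemma KCS_affine_dsum D0 D1 E0 E1 :
  is_conn Om M D0 -> is_conn Om M D1 -> is_conn Om N E0 -> is_conn Om N E1 ->
  gcomm (KCS (affine_path (dsum D0 E0) (dsum D1 E1) : fgp_sum M N -> pform Om (fgp_sum M N)) -
    (KCS (affine_path D0 D1) + KCS (affine_path E0 E1))).
Proof.
move=> c0 c1 d0 d1.
have cd0 : is_conn Om (fgp_sum M N) (dsum D0 E0) := dsum_conn c0 d0.
have cd1 : is_conn Om (fgp_sum M N) (dsum D1 E1) := dsum_conn c1 d1.
have [n [i [p ipK]]] := fmodP M; have [n' [i' [p' ipK']]] := fmodP N.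
have [N0 h0] := KCS_affine_trunc ipK c0 c1.
have [N1 h1] := KCS_affine_trunc ipK' d0 d1.
pose I : {linear fgp_sum M N -> 'rV[A^c]_(n + n')} := dsum_in i i'.
pose P : {linear 'rV[A^c]_(n + n') -> fgp_sum M N} := dsum_out p p'.
have IPK : cancel I P := dsum_inK ipK ipK'.
have [N2 h2] := KCS_affine_trunc IPK cd0 cd1.
pose B := maxn N0 (maxn N1 N2).
have {}h0 : gcomm _ := h0 B (leq_maxl _ _).
have {}h1 : gcomm _ := h1 B (leq_trans (leq_maxl _ _) (leq_maxr _ _)).
have := h2 B (leq_trans (leq_maxr _ _) (leq_maxr _ _)).
rewrite idem_mx_dsum (conn_mx_dsum _ _ _ _ c0 d0) (conn_mx_dsum _ _ _ _ c1 d1) => {}h2.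
apply: gcomm_trans h2 _.
have e : exp_sum B (mxcs (diag2_mx (idem_mx Om i p) (idem_mx Om i' p'))
      (diag2_mx (conn_mx i p D0) (conn_mx i' p' E0))
      (diag2_mx (conn_mx i p D1) (conn_mx i' p' E1))) =
    exp_sum B (mxcs (idem_mx Om i p) (conn_mx i p D0) (conn_mx i p D1)) +
    exp_sum B (mxcs (idem_mx Om i' p') (conn_mx i' p' E0) (conn_mx i' p' E1)).
  by rewrite exp_sumD; apply: eq_bigr => k _; rewrite mxcs_diag2.
by rewrite e opprD addrACA; apply: gcommD; exact: gcomm_sym.
Qed.

End DirectSum.
End SecondaryForms.

(** * Grothendieck groups *)

(* Isomorphism classes of modules live in too large a universe for nmodType and
   zmodType, so that monoids are handled up to an equivalence relation; sums are
   rearranged by reflection (meval_perm). *)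
Record com_monoid (T : Type) (R : T -> T -> Prop) (add : T -> T -> T) (z : T) : Prop := {
  cm_refl : forall x, R x x;
  cm_sym : forall x y, R x y -> R y x;
  cm_trans : forall x y u, R x y -> R y u -> R x u;
  cm_add : forall x x' y y', R x x' -> R y y' -> R (add x y) (add x' y');
  cm_assoc : forall x y u, R (add x (add y u)) (add (add x y) u);
  cm_comm : forall x y, R (add x y) (add y x);
  cm_unit : forall x, R (add z x) x
}.

Inductive mterm := MVar of nat | MAdd of mterm & mterm.
Coercion MVar : nat >-> mterm.
Bind Scope nat_scope with mterm.
Arguments MAdd (_ _)%_N.
Local Notation "s '+m' t" := (MAdd s t) (at level 50, left associativity).

Fixpoint mflatten (t : mterm) : seq nat :=
  match t with MVar n => [:: n] | MAdd s u => mflatten s ++ mflatten u end.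

Section Reflection.
Context (T : Type) (R : T -> T -> Prop) (add : T -> T -> T) (z : T).
Hypothesis mon : com_monoid R add z.

Fixpoint meval (env : seq T) (t : mterm) : T :=
  match t with
  | MVar n => nth z env n
  | MAdd s u => add (meval env s) (meval env u)
  end.

Let tr := cm_trans mon.
Let sy := cm_sym mon.
Let rf := cm_refl mon.
Let ad := cm_add mon.

Definition msum (s : seq T) : T := foldr add z s.

Lemma msum_cat s t : R (msum (s ++ t)) (add (msum s) (msum t)).
Proof.
elim: s => [|x s IH] /=; first exact/sy/(cm_unit mon).
by apply: tr (ad (rf x) IH) _; exact: (cm_assoc mon).
Qed.

Lemma meval_msum env t : R (meval env t) (msum [seq nth z env n | n <- mflatten t]).
Proof.
elim: t => [n|s IHs t IHt] /=.
  by apply: tr (sy (cm_unit mon _)) _; exact: (cm_comm mon).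
by rewrite map_cat; apply: tr (ad IHs IHt) _; exact/sy/msum_cat.
Qed.

Lemma msum_middle x s t : R (add x (msum (s ++ t))) (msum (s ++ x :: t)).
Proof.
elim: s => [|y s IH] /=; first exact: rf.
apply: tr (cm_assoc mon _ _ _) _; apply: tr (ad (cm_comm mon _ _) (rf _)) _.
by apply: tr (sy (cm_assoc mon _ _ _)) _; exact: ad.
Qed.

Lemma msum_perm (f : nat -> T) s t : perm_eq s t -> R (msum (map f s)) (msum (map f t)).
Proof.
elim: s t => [|x s IH] t pst; first by rewrite perm_sym in pst; rewrite (perm_small_eq _ pst).
have xt : x \in t by rewrite -(perm_mem pst) mem_head.
case/splitPr: xt pst => t1 t2 pst.
have : perm_eq s (t1 ++ t2).
  rewrite -(perm_cons x); apply: perm_trans pst _.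
  by rewrite -cat1s -[x :: _ ++ _]cat1s perm_catCA.
by move=> /IH h; rewrite map_cat /=; apply: tr (msum_middle _ _ _); rewrite -map_cat; exact: ad.
Qed.

Lemma meval_perm env s t : perm_eq (mflatten s) (mflatten t) ->
  R (meval env s) (meval env t).
Proof.
move=> p; apply: tr (meval_msum env s) _; apply: tr (msum_perm _ p) _.
exact/sy/meval_msum.
Qed.

End Reflection.

Section StableClosure.
Context (T : Type) (R : T -> T -> Prop) (add : T -> T -> T) (z : T).
Hypothesis mon : com_monoid R add z.

(** Equality in the Grothendieck group of the monoid. It is again the equivalence of a commutative
    monoid, so [groth] can be applied to it. *)
Definition stably (x y : T) : Prop := exists u, R (add x u) (add y u).

Let tr := cm_trans mon.
Let ad := cm_add mon.
Let rf := cm_refl mon.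

Lemma stablyW x y : R x y -> stably x y.
Proof. by move=> h; exists z; exact: ad. Qed.

Lemma com_monoid_stably : com_monoid stably add z.
Proof.
split=> [x|x y [u /(cm_sym mon)]|x y v [u h] [u' h']|x x' y y' [u h] [u' h']|x y u|x y|x].
- exact/stablyW/rf.
- by exists u.
- exists (add u u').
  apply: tr (meval_perm mon [:: x; u; u'] (s := 0 +m (1 +m 2)) (t := 0 +m 1 +m 2) erefl) _.
  apply: tr (ad h (rf u')) _.
  apply: tr (meval_perm mon [:: y; u; u'] (s := 0 +m 1 +m 2) (t := 0 +m 2 +m 1) erefl) _.
  apply: tr (ad h' (rf u)) _.
  exact: (meval_perm mon [:: v; u; u'] (s := 0 +m 2 +m 1) (t := 0 +m (1 +m 2)) erefl).
- exists (add u u').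
  apply: tr (meval_perm mon [:: x; y; u; u'] (s := 0 +m 1 +m (2 +m 3)) (t := 0 +m 2 +m (1 +m 3)) erefl) _.
  apply: tr (ad h h') _.
  exact: (meval_perm mon [:: x'; y'; u; u'] (s := 0 +m 2 +m (1 +m 3)) (t := 0 +m 1 +m (2 +m 3)) erefl).
- exact/stablyW/(cm_assoc mon).
- exact/stablyW/(cm_comm mon).
exact/stablyW/(cm_unit mon).
Qed.

End StableClosure.

Section Grothendieck.
Context (S : pmonoid) (mon : com_monoid (@meqv S) (@madd S) (mzero S)).
Hypotheses (mem0 : mmem (mzero S)) (memD : forall x y : S, mmem x -> mmem y -> mmem (madd x y)).

Let tr := cm_trans mon.
Let ad := cm_add mon.
Let rf := cm_refl mon.

Lemma groth_abgroup : is_abgroup (groth S).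
Proof.
have W (x y : S * S) : meqv (madd x.1 y.2) (madd y.1 x.2) -> @geqv (groth S) x y.
  by move=> h; exists (mzero S) => //; exact: ad.
split.
- by split=> [|x [h h']|x y [h h'] [k k']]; split=> //; exact: memD.
- split=> [x _|x y _ _ [v mv h]|x y u _ [m1 m2] _ [v mv h] [v' mv' h']].
  + exact/W/rf.
  + by exists v => //; exact: (cm_sym mon).
  (* Without cancellation, both components of the middle element have to join the stabilising
     summand. *)
  exists (madd (madd y.2 y.1) (madd v v')); first by do !apply: memD.
  apply: tr (meval_perm mon [:: x.1; u.2; y.2; y.1; v; v']
    (s := 0 +m 1 +m (2 +m 3 +m (4 +m 5))) (t := 0 +m 2 +m 4 +m (3 +m 1 +m 5)) erefl) _.
  apply: tr (ad h h') _.
  exact: (meval_perm mon [:: u.1; x.2; y.2; y.1; v; v']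
    (s := 3 +m 1 +m 4 +m (0 +m 2 +m 5)) (t := 0 +m 1 +m (2 +m 3 +m (4 +m 5))) erefl).
- split=> [x x' y y' _ _ _ _ [u mu h] [v mv k]|x x' _ _ [u mu h]].
    exists (madd u v); first exact: memD.
    apply: tr (meval_perm mon [:: x.1; y.1; x'.2; y'.2; u; v]
      (s := 0 +m 1 +m (2 +m 3) +m (4 +m 5)) (t := 0 +m 2 +m 4 +m (1 +m 3 +m 5)) erefl) _.
    apply: tr (ad h k) _.
    exact: (meval_perm mon [:: x'.1; y'.1; x.2; y.2; u; v]
      (s := 0 +m 2 +m 4 +m (1 +m 3 +m 5)) (t := 0 +m 1 +m (2 +m 3) +m (4 +m 5)) erefl).
  exists u => //; apply: tr (ad (cm_comm mon _ _) (rf u)) _.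
  by apply: tr (cm_sym mon h) _; apply: ad (rf u); exact: (cm_comm mon).
split=> [x y u _ _ _|x y _ _|x _|x _]; apply: W => /=.
- exact: (meval_perm mon [:: x.1; y.1; u.1; x.2; y.2; u.2]
    (s := 0 +m (1 +m 2) +m (3 +m 4 +m 5)) (t := 0 +m 1 +m 2 +m (3 +m (4 +m 5))) erefl).
- by apply: ad; exact: (cm_comm mon).
- exact: (meval_perm mon [:: mzero S; x.1; x.2]
    (s := 0 +m 1 +m 2) (t := 1 +m (0 +m 2)) erefl).
exact: (meval_perm mon [:: mzero S; x.1; x.2]
    (s := 2 +m 1 +m 0) (t := 0 +m (1 +m 2)) erefl).
Qed.

End Grothendieck.

Section FormGroups.
Context (K : fieldType) (A : algType K) (Om : dga A).
Context (P E : Om -> Prop).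
Hypotheses (P0 : P 0) (PB : forall u v, P u -> P v -> P (u - v)).
Hypotheses (E0 : E 0) (EB : forall u v, E u -> E v -> E (u - v)).

Lemma form_group_abgroup : is_abgroup (form_group P E).
Proof.
have PN u : P u -> P (- u) by rewrite -sub0r; exact: PB.
have EN u : E u -> E (- u) by rewrite -sub0r; exact: EB.
have ED u v : E u -> E v -> E (u + v) by move=> hu hv; rewrite -[v]opprK; apply/EB/EN.
have ER (u v : Om) : u = v -> E (u - v) by move=> ->; rewrite subrr.
split.
- by split=> // x y hx hy; rewrite -[y]opprK; apply/PB/PN.
- split=> [x _|x y _ _ h|x y u _ _ _ h h'] /=; first exact: ER.
    by rewrite -opprB; exact: EN.
  by rewrite -(subrKA y); exact: ED.
- split=> [x x' y y' _ _ _ _ h h'|x x' _ _ h] /=; first by rewrite opprD addrACA; exact: ED.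
  by rewrite -opprD; exact: EN.
split=> [x y u _ _ _|x y _ _|x _|x _]; apply: ER => /=.
- exact: addrA.
- exact: addrC.
- exact: add0r.
exact: addNr.
Qed.

End FormGroups.

(** * Differential K-theory classes *)

Section ProductMaps.
Context (R : pzRingType).

Section Two.
Context (M N M' N' : lmodType R) (f : {linear M -> M'}) (g : {linear N -> N'}).

Definition prod_map (x : M * N) : M' * N' := (f x.1, g x.2).
Lemma prod_map_linear : linear prod_map.
Proof. by move=> a x y; rewrite /prod_map !linearP. Qed.
HB.instance Definition _ := GRing.isLinear.Build R (M * N)%type (M' * N')%type *:%R
  prod_map prod_map_linear.

Definition prod_swap (x : M * N) : N * M := (x.2, x.1).
Lemma prod_swap_linear : linear prod_swap. Proof. by []. Qed.
HB.instance Definition _ := GRing.isLinear.Build R (M * N)%type (N * M)%type *:%R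
  prod_swap prod_swap_linear.
End Two.

Section Three.
Context (M N L : lmodType R).
Definition prod_assocr (x : M * N * L) : M * (N * L) := (x.1.1, (x.1.2, x.2)).
Definition prod_assocl (x : M * (N * L)) : M * N * L := (x.1, x.2.1, x.2.2).
Lemma prod_assocr_linear : linear prod_assocr. Proof. by []. Qed.
Lemma prod_assocl_linear : linear prod_assocl. Proof. by []. Qed.
HB.instance Definition _ := GRing.isLinear.Build R (M * N * L)%type (M * (N * L))%type *:%R
  prod_assocr prod_assocr_linear.
HB.instance Definition _ := GRing.isLinear.Build R (M * (N * L))%type (M * N * L)%type *:%R
  prod_assocl prod_assocl_linear.
End Three.

Section Zero.
Context (M : lmodType R).
Definition zero_inr (x : M) : 'rV[R]_0 * M := (0, x).
Definition zero_outr (x : 'rV[R]_0 * M) : M := x.2.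
Lemma zero_inr_linear : linear zero_inr.
Proof. by move=> a x y; rewrite /zero_inr; congr (_, _); rewrite /= scaler0 addr0. Qed.
Lemma zero_outr_linear : linear zero_outr. Proof. by []. Qed.
HB.instance Definition _ := GRing.isLinear.Build R M ('rV[R]_0 * M)%type *:%R
  zero_inr zero_inr_linear.
HB.instance Definition _ := GRing.isLinear.Build R ('rV[R]_0 * M)%type M *:%R
  zero_outr zero_outr_linear.
Lemma zero_outrK : cancel zero_outr zero_inr.
Proof. by move=> [u x]; congr (_, _); apply/rowP => -[]. Qed.
End Zero.

End ProductMaps.

Lemma com_monoid_fgpmod (K : fieldType) (A : algType K) :
  com_monoid (@fgp_iso K A) (@fgp_sum K A) (fgp_zero A).
Proof.
split.
- by move=> M; exists idfun, idfun.
- by move=> M N [f [g [fK gK]]]; exists g, f.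
- move=> M N L [f [g [fK gK]]] [f' [g' [fK' gK']]].
  exists (f' \o f), (g \o g'); split=> x /=; first by rewrite fK' fK.
  by rewrite gK gK'.
- move=> M M' N N' [f [g [fK gK]]] [f' [g' [fK' gK']]].
  exists (prod_map f f'), (prod_map g g'); split=> -[x y].
    by congr (_, _); [exact: fK | exact: fK'].
  by congr (_, _); [exact: gK | exact: gK'].
- move=> M N L; exists (@prod_assocl _ M N L), (@prod_assocr _ M N L).
  by split=> [[x [y u]]|[[x y] u]].
- by move=> M N; exists (@prod_swap _ M N), (@prod_swap _ N M); split=> -[x y].
by move=> M; exists (@zero_outr _ M), (@zero_inr _ M); split=> //; exact: zero_outrK.
Qed.

Section MapComposition.
Context (K : fieldType) (A : algType K) (Om : dga A).

Lemma mform_map_comp (M N L : lmodType A^c) (f : {linear M -> N}) (g : {linear N -> L})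
  (x : mform Om M) : mform_map g (mform_map f x) = mform_map (g \o f) x.
Proof.
pose lhs (x : mform Om M) := mform_map g (mform_map f x).
rewrite -/(lhs x); apply: tens_lin_ext x => [x y|x y|m w]; rewrite /lhs.
- by rewrite !mform_mapD.
- exact: mform_mapD.
by rewrite -/(mpure Om m w) !mform_map_pure.
Qed.

Lemma mform_map_id (M : lmodType A^c) (x : mform Om M) : mform_map idfun x = x.
Proof.
apply: (@tens_lin_ext _ _ _ _ _ _ (mform_map idfun) id) x => [x y|//|m w].
  exact: mform_mapD.
exact: mform_map_pure.
Qed.

End MapComposition.

Section KhatMonoid.
Context (K : fieldType) (charK : [pchar K] =i pred0).
Context (A : algType K) (Om : dga A) (finOm : finite_chern Om).
Implicit Types g h : khat_gen Om.
Local Notation dexact := (exact_by (@evenf K A Om)).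
Let linE := evenf_lin Om.

(** The relation [khat_eqv] without stabilisation, with the affine path representing the class
    KCS(D0, D1). *)
Definition khat_iso g0 g1 : Prop :=
  exists (phi : {linear kmod g0 -> kmod g1}) (psi : {linear kmod g1 -> kmod g0}),
  [/\ cancel phi psi, cancel psi phi &
   dexact (KCS (affine_path (@kconn _ _ _ g0) (pullback phi psi (@kconn _ _ _ g1)))
     - (kform g0 - kform g1))].

(** An isomorphism preserving the connection has secondary form KCS(D, D) = 0. The monoid laws are
    witnessed by isomorphisms of this kind. *)
Lemma khat_isometry g0 g1 (phi : {linear kmod g0 -> kmod g1}) (psi : {linear kmod g1 -> kmod g0}) :
  cancel phi psi -> cancel psi phi -> pullback phi psi (@kconn _ _ _ g1) =1 @kconn _ _ _ g0 ->
  kform g0 = kform g1 -> khat_iso g0 g1.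
Proof.
move=> phiK psiK /funext e ew; exists phi, psi; split=> //.
rewrite e ew subrr subr0; apply: (gcomm_exact linE).
by apply: (KCS_affine_diag charK finOm); exact: kconnP.
Qed.

Lemma khat_iso_refl g : khat_iso g g.
Proof.
apply: (@khat_isometry g g idfun idfun) => // m.
by rewrite /pullback /= mform_map_id.
Qed.

(** Modulo exact forms, 0 = KCS(D0, D0) = KCS(D0, phi^* D1) + KCS(phi^* D1, D0), and pulling back
    along psi turns the last term into KCS(D1, psi^* D0). *)
Lemma khat_iso_sym g0 g1 : khat_iso g0 g1 -> khat_iso g1 g0.
Proof.
move=> [phi [psi [phiK psiK h]]]; exists psi, phi; split=> //.
have c0 := kconnP g0; have c1 := kconnP g1.
have c1' := pullback_conn phiK c1.
have e : pullback psi phi (pullback phi psi (@kconn _ _ _ g1)) = @kconn _ _ _ g1.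
  apply: funext => m; rewrite /pullback psiK mform_map_comp.
  rewrite [X in mform_map X](_ : _ = idfun) ?mform_map_id //.
  by apply: funext => x /=; rewrite psiK.
have h1 := KCS_affine_pullback charK finOm psiK phiK c1' c0; rewrite e in h1.
have h2 := KCS_affine_trans charK finOm c0 c1' c0.
have h3 := gcomm_exact linE (KCS_affine_diag charK finOm c0).
apply: (exact_trans linE (gcomm_exact linE h1)).
have {h2 h3} := exact_byB linE h3 h2; rewrite -addrA -opprD subKr => h2.
rewrite -[X in dexact X](subrKA (- KCS (affine_path (@kconn _ _ _ g0) (pullback phi psi (@kconn _ _ _ g1))))).
apply: (exact_byD linE); first by rewrite opprK addrC.
by have := exact_byN linE h; rewrite !opprB addrC.
Qed.

(** The path from D0 to phi^* phi'^* D2 is broken at phi^* D1, and invariance under pullback removes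
    phi from the second half. *)
Lemma khat_iso_trans g0 g1 g2 : khat_iso g0 g1 -> khat_iso g1 g2 -> khat_iso g0 g2.
Proof.
move=> [phi [psi [phiK psiK h]]] [phi' [psi' [phiK' psiK' h']]].
exists (phi' \o phi), (psi \o psi'); split=> [x|x|] /=; rewrite ?phiK' ?psiK //.
have c0 := kconnP g0; have c1 := pullback_conn phiK (kconnP g1).
have c2 := pullback_conn phiK' (kconnP g2); have c2' := pullback_conn phiK c2.
have -> : pullback (phi' \o phi) (psi \o psi') (@kconn _ _ _ g2) =
    pullback phi psi (pullback phi' psi' (@kconn _ _ _ g2)).
  by apply: funext => m; rewrite /pullback mform_map_comp.
have h1 := KCS_affine_pullback charK finOm phiK psiK (kconnP g1) c2.
have := KCS_affine_trans charK finOm c0 c1 c2'; rewrite -addrA -opprD => h2.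
apply: (exact_trans linE h2); rewrite -[kform g0 - kform g2](subrKA (kform g1)) opprD addrACA.
by apply: (exact_byD linE) => //; apply: (exact_trans linE _ h'); exact: gcomm_exact.
Qed.

Lemma khat_iso_sum g g' h h' : khat_iso g g' -> khat_iso h h' ->
  khat_iso (khat_sum g h) (khat_sum g' h').
Proof.
move=> [phi [psi [phiK psiK e]]] [phi' [psi' [phiK' psiK' e']]].
exists (prod_map phi phi'), (prod_map psi psi'); split=> [[x y]|[x y]|].
- by congr (_, _); [exact: phiK | exact: phiK'].
- by congr (_, _); [exact: psiK | exact: psiK'].
have -> : pullback (prod_map phi phi') (prod_map psi psi') (@kconn _ _ _ (khat_sum g' h')) =
    dsum (pullback phi psi (@kconn _ _ _ g')) (pullback phi' psi' (@kconn _ _ _ h')).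
  apply: funext => -[x y]; rewrite /pullback /dsum /= mform_mapD !mform_map_comp.
  by congr (_ + _); congr tlift; apply: funext => u; apply: funext => w; congr (mpure _ (_, _) _);
    exact: raddf0.
have c := KCS_affine_dsum charK finOm (kconnP g) (pullback_conn phiK (kconnP g'))
  (kconnP h) (pullback_conn phiK' (kconnP h')).
apply: (exact_trans linE (gcomm_exact linE c)) => /=.
rewrite [X in _ - X](_ : _ = (kform g - kform g') + (kform h - kform h')); last first.
  by rewrite opprD addrACA.
by rewrite opprD addrACA; exact: exact_byD.
Qed.

Lemma khat_iso_assoc g h k :
  khat_iso (khat_sum g (khat_sum h k)) (khat_sum (khat_sum g h) k).
Proof.
apply: (@khat_isometry (khat_sum g (khat_sum h k)) (khat_sum (khat_sum g h) k)
  (@prod_assocl _ (kmod g) (kmod h) (kmod k)) (@prod_assocr _ (kmod g) (kmod h) (kmod k))) => /=.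
- by move=> [x [y u]].
- by move=> [[x y] u].
- move=> [x [y u]]; rewrite /pullback /dsum /= !mform_mapD !mform_map_comp.
  by rewrite -addrA.
exact: addrA.
Qed.

Lemma khat_iso_comm g h : khat_iso (khat_sum g h) (khat_sum h g).
Proof.
apply: (@khat_isometry (khat_sum g h) (khat_sum h g)
  (@prod_swap _ (kmod g) (kmod h)) (@prod_swap _ (kmod h) (kmod g))) => /=.
- by move=> [x y].
- by move=> [x y].
- move=> [x y]; rewrite /pullback /dsum /= !mform_mapD !mform_map_comp.
  by rewrite addrC.
exact: addrC.
Qed.

Definition khat_shift (w : Om) g : khat_gen Om := KhatGen (kconnP g) (w + kform g).

Lemma khat_iso_shift (w : Om) g : khat_iso (khat_sum (khat_form w) g) (khat_shift w g).
Proof.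
apply: (@khat_isometry (khat_sum (khat_form w) g) (khat_shift w g)
  (@zero_outr _ (kmod g)) (@zero_inr _ (kmod g))) => //=.
- exact: zero_outrK.
move=> [x y]; rewrite /pullback /dsum /= mform_map0 add0r.
by [].
Qed.

Lemma com_monoid_khat_iso : com_monoid khat_iso (@khat_sum K A Om) (khat_form (0 : Om)).
Proof.
split.
- exact: khat_iso_refl.
- exact: khat_iso_sym.
- exact: khat_iso_trans.
- by move=> *; exact: khat_iso_sum.
- exact: khat_iso_assoc.
- exact: khat_iso_comm.
move=> g; apply: khat_iso_trans (khat_iso_shift 0 g) _.
apply: (@khat_isometry (khat_shift 0 g) g idfun idfun) => //= [m|].
  by rewrite /pullback /= mform_map_id.
exact: add0r.
Qed.

Lemma khat_eqvE g0 g1 : khat_eqv g0 g1 <-> stably khat_iso (@khat_sum K A Om) g0 g1.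
Proof.
split=> [[N [D [phi [psi [cD phiK psiK h]]]]]|[u [phi [psi [phiK psiK h]]]]].
  (* The form carried by the stabilising generator cancels in the difference, so 0 will do. *)
  exists (KhatGen cD 0), phi, psi; split=> //=.
  have c0 : is_conn Om (fgp_sum (kmod g0) N) (dsum (@kconn _ _ _ g0) D) :=
    dsum_conn (kconnP g0) cD.
  have c1 : is_conn Om (fgp_sum (kmod g1) N) (dsum (@kconn _ _ _ g1) D) :=
    dsum_conn (kconnP g1) cD.
  rewrite !addr0; apply/(KCS_class_affine charK finOm (M := fgp_sum (kmod g0) N)) => //.
  exact: (pullback_conn (M := fgp_sum (kmod g0) N) (L := fgp_sum (kmod g1) N)).
exists (kmod u), (@kconn _ _ _ u), phi, psi; split=> //; first exact: kconnP.
apply/(KCS_class_affine charK finOm (M := fgp_sum (kmod g0) (kmod u))).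
- exact: dsum_conn (kconnP g0) (kconnP u).
- apply: (pullback_conn (M := fgp_sum (kmod g0) (kmod u)) (L := fgp_sum (kmod g1) (kmod u))) => //.
  exact: dsum_conn (kconnP g1) (kconnP u).
have <- : kform (khat_sum g0 u) - kform (khat_sum g1 u) = kform g0 - kform g1.
  by rewrite opprD addrACA subrr addr0.
exact: h.
Qed.

End KhatMonoid.

(** * The hexagon *)

Section AdditiveInvariants.
Context (T : Type) (R : T -> T -> Prop) (add : T -> T -> T) (z : T).
Context (V : zmodType) (E : V -> Prop) (r : T -> V).
Hypothesis EB : forall u v, E u -> E v -> E (u - v).
Hypothesis rD : forall x y, E (r (add x y) - (r x + r y)).
Hypothesis rR : forall x y, R x y -> E (r x - r y).

Let Esub u v s t : E (u - v) -> E (u - s) -> E (v - t) -> E (s - t).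
Proof.
move=> h hs ht; have := EB h (EB hs ht).
have -> : u - s - (v - t) = u - v - (s - t) by rewrite [in LHS]opprD addrACA -opprD.
by rewrite subKr.
Qed.

Lemma invariant_stably x y : stably R add x y -> E (r x - r y).
Proof.
move=> [u /rR h]; have := Esub h (rD x u) (rD y u).
by rewrite opprD addrACA subrr addr0.
Qed.

Lemma invariant_groth x y x' y' : stably R add (add x y') (add x' y) ->
  E (r x - r y - (r x' - r y')).
Proof.
move=> /invariant_stably h; have := Esub h (rD x y') (rD x' y).
by rewrite opprB addrACA -opprD [r y + _]addrC.
Qed.

Lemma invariant_groth_add x y x' y' :
  E (r (add x x') - r (add y y') - ((r x - r y) + (r x' - r y'))).
Proof.
have -> : r x - r y + (r x' - r y') = (r x + r x') - (r y + r y') by rewrite addrACA -opprD.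
have e (a b c d : V) : a - b - (c - d) = a - c - (b - d) by rewrite opprD addrACA -opprD.
by rewrite e; exact: EB.
Qed.

End AdditiveInvariants.

Section Hexagon.
Context (K : fieldType) (charK : [pchar K] =i pred0).
Context (A : algType K) (Om : dga A) (finOm : finite_chern Om).
Local Notation dexact := (exact_by (@evenf K A Om)).
Local Notation oexact := (exact_by (@oddf K A Om)).
Local Notation "g +k h" := (@khat_sum K A Om g h) (at level 50, left associativity).
Let evE := evenf_lin Om.
Let odE := oddf_lin Om.
Implicit Types (g h : khat_gen Om) (u v w : Om) (M N : fgpmod A).

Let mon := com_monoid_khat_iso charK finOm.
Let tr := cm_trans mon.
Let sy := cm_sym mon.
Let ad := cm_add mon.
Let rf := cm_refl mon.

Lemma khat_eqv_stably : @khat_eqv K A Om = stably (@khat_iso K A Om) (@khat_sum K A Om).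
Proof.
apply: funext => g; apply: funext => h; apply: propext.
exact: khat_eqvE.
Qed.

Lemma com_monoid_khat : com_monoid (@khat_eqv K A Om) (@khat_sum K A Om) (khat_form (0 : Om)).
Proof. by rewrite khat_eqv_stably; exact: com_monoid_stably. Qed.

Lemma Khat_abgroup : is_abgroup (Khat Om).
Proof.
by apply: groth_abgroup => [||g h] /=; [exact: com_monoid_khat | exact: oddf0 | exact: oddfD].
Qed.

Lemma Kzero_abgroup : is_abgroup (Kzero A).
Proof. by apply: groth_abgroup => //; exact: com_monoid_fgpmod. Qed.

(** The summand of the Grothendieck construction and that of [khat_eqv] are added into one;
    conversely [khat_form 0] serves as the former. *)
Lemma Khat_geqvE (x y : Khat Om) :
  geqv x y <-> stably (@khat_iso K A Om) (@khat_sum K A Om) (x.1 +k y.2) (y.1 +k x.2).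
Proof.
split=> [[z _ /=]|h]; last first.
  exists (khat_form (0 : Om)); first exact: oddf0.
  rewrite /= khat_eqv_stably; apply: (cm_add (com_monoid_stably mon)) => //.
  exact: (cm_refl (com_monoid_stably mon)).
rewrite khat_eqv_stably => -[u h]; exists (z +k u).
exact: tr (cm_assoc mon _ _ _) (tr h (sy (cm_assoc mon _ _ _))).
Qed.

Lemma Kzero_geqvE (x y : Kzero A) :
  geqv x y <-> stably (@fgp_iso K A) (@fgp_sum K A) (fgp_sum x.1 y.2) (fgp_sum y.1 x.2).
Proof. by split=> [[z _ h]|[z h]]; exists z. Qed.

(** The same choice as in [chK], so that [chern_of] unfolds to its two terms. *)
Definition some_conn M : M -> mform Om M := choose_or (fun=> 0) (is_conn Om M).
Arguments some_conn : clear implicits.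

Lemma some_connP M : is_conn Om M (some_conn M).
Proof. by apply: choose_orP; have [D cD] := fgpmod_has_conn Om M; exists D. Qed.

Lemma chern_indep M (D D' : M -> mform Om M) :
  is_conn Om M D -> is_conn Om M D' -> oexact (chKa D - chKa D').
Proof.
move=> cD cD'; exists (KCS (affine_path D' D)); first exact: oddf_KCS_affine.
exact: chern_transgression.
Qed.

Definition chern_of M : Om := chKa (some_conn M).

Lemma chern_of_sum M N : oexact (chern_of (fgp_sum M N) - (chern_of M + chern_of N)).
Proof.
have c := dsum_conn (some_connP M) (some_connP N).
apply: (exact_trans odE (chern_indep (M := fgp_sum M N) (some_connP _) c)).
by apply: gcomm_exact => //; exact: chern_dsum (some_connP _) (some_connP _).
Qed.

Lemma chern_of_iso M N : fgp_iso M N -> oexact (chern_of M - chern_of N).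
Proof.
move=> [phi [psi [phiK psiK]]]; have c := pullback_conn phiK (some_connP N).
apply: (exact_trans odE (chern_indep (some_connP _) c)).
by apply: gcomm_exact => //; apply: chern_pullback (some_connP _).
Qed.

Lemma chK_congr (x y : Kzero A) : geqv x y -> oexact (chK Om x - chK Om y).
Proof.
move/Kzero_geqvE; apply: (invariant_groth (E := exact_by (@oddf K A Om)) (r := chern_of)).
- exact: exact_byB odE.
- exact: chern_of_sum.
exact: chern_of_iso.
Qed.

Lemma chK_add (x y : Kzero A) : oexact (chK Om (gadd x y) - (chK Om x + chK Om y)).
Proof.
apply: (invariant_groth_add (E := exact_by (@oddf K A Om)) (r := chern_of) (add := @fgp_sum K A)).
- exact: exact_byB odE.
exact: chern_of_sum.
Qed.

Definition curvature_form g : Om := chKa (@kconn _ _ _ g) + ddiff Om (kform g).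

Lemma curvature_form_sum g h :
  gcomm (curvature_form (g +k h) - (curvature_form g + curvature_form h)).
Proof.
have e (a b c d f : Om) : a + (d + f) - (b + d + (c + f)) = a - (b + c).
  by rewrite [b + d + _]addrACA opprD addrACA subrr addr0.
rewrite /curvature_form raddfD e; exact (chern_dsum charK finOm (kconnP g) (kconnP h)).
Qed.

(** Transgression gives d KCS = ch(phi^* D1) - ch(D0), while d KCS = d(w0 - w1) because KCS and w0 -
    w1 differ by an exact form. *)
Lemma curvature_form_iso g h : khat_iso g h -> gcomm (curvature_form g - curvature_form h).
Proof.
move=> [phi [psi [phiK psiK e]]]; have c := pullback_conn phiK (kconnP h).
have h1 := chern_transgression charK finOm (kconnP g) c.
have h2 := chern_pullback charK finOm phiK psiK (kconnP h).
have h3 := closed_exact e; rewrite /closedf raddfB /= raddfB /= in h3.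
have e1 (a b c' d : Om) : a - b - (a - c' - d) = c' + d - b.
  by rewrite -[a - c' - d]addrA -opprD opprB addrC subrKA.
have e2 (b c' d s t : Om) : c' + d - b - (d - (s - t)) = c' + s - (b + t).
  by rewrite opprB [c' + d - b]addrAC addrACA subrr addr0 addrACA -opprD.
by have := gcommB (gcommB h2 h1) h3; rewrite e1 e2.
Qed.

Lemma hexR_congr (x y : Khat Om) : geqv x y -> gcomm (hexR Om x - hexR Om y).
Proof.
move/Khat_geqvE; apply: (invariant_groth (E := @gcomm K A Om) (r := curvature_form)).
- exact: gcommB.
- exact: curvature_form_sum.
exact: curvature_form_iso.
Qed.

Lemma hexR_add (x y : Khat Om) : gcomm (hexR Om (gadd x y) - (hexR Om x + hexR Om y)).
Proof.
apply: (invariant_groth_add (E := @gcomm K A Om) (r := curvature_form) (add := @khat_sum K A Om)).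
- exact: gcommB.
exact: curvature_form_sum.
Qed.

(** R differs from the Chern form of the chosen connections by a change of connection and by d of an
    odd form. Besides the square Pr R = ch I, this yields the closedness of the values of R. *)
Lemma chK_hexI (x : Khat Om) : gmem x -> oexact (chK Om (hexI Om x) - hexR Om x).
Proof.
move=> [/= o1 o2].
have h g : oddf (kform g) -> oexact (chern_of (kmod g) - curvature_form g).
  move=> og; rewrite /curvature_form opprD addrA; apply: (exact_byB odE).
    exact: chern_indep (some_connP _) (kconnP g).
  exact: exact_ddiff.
rewrite /chK /hexR -/(chern_of _) -/(chern_of _) -/(curvature_form _) -/(curvature_form _).
exact: (exact_sub2 odE (h _ o1) (h _ o2)).
Qed.

Lemma evenf_chK (x : Kzero A) : evenf (chK Om x).
Proof. by apply: evenfB; apply: (evenf_chern charK); exact: some_connP. Qed.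

Lemma closedf_chK (x : Kzero A) : closedf (chK Om x).
Proof.
rewrite /closedf raddfB; apply: gcommB; apply: (closedf_chern charK finOm); exact: some_connP.
Qed.

Lemma evenf_hexR (x : Khat Om) : gmem x -> evenf (hexR Om x).
Proof.
have h g : oddf (kform g) -> evenf (curvature_form g).
  move=> og; apply: evenfD; last exact: evenf_ddiff.
  by apply: (evenf_chern charK); exact: kconnP.
by move=> [/h o1 /h o2]; exact: evenfB.
Qed.

Lemma closedf_hexR (x : Khat Om) : gmem x -> closedf (hexR Om x).
Proof.
move=> mx; rewrite /closedf; apply: gcomm_congr (closedf_chK (hexI Om x)).
by rewrite -raddfB; exact: closed_exact (exact_sym odE (chK_hexI mx)).
Qed.

Lemma mem_hexR (x : Khat Om) : gmem x -> @gmem (Omega_ch0 Om) (hexR Om x).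
Proof.
move=> mx; split; [exact: evenf_hexR | exact: closedf_hexR |].
by exists (hexI Om x) => //; exact: chK_hexI.
Qed.

(** A generator stores a representative form; this expresses that only its class modulo Im(d)
    matters. *)
Lemma khat_iso_exact g (w w' : Om) (c := kconnP g) : dexact (w - w') ->
  khat_iso (KhatGen c w) (KhatGen c w').
Proof.
move=> e; have [phi [psi [phiK psiK h]]] := khat_iso_refl charK finOm (KhatGen c w).
exists phi, psi; split=> //; apply: (exact_trans evE h) => /=.
by rewrite subrr sub0r; exact: exact_byN.
Qed.

Lemma khat_iso_shift2 w g h : khat_iso g h -> khat_iso (khat_shift w g) (khat_shift w h).
Proof.
move=> [phi [psi [phiK psiK e]]]; exists phi, psi; split=> //=.
by rewrite [w + _]addrC addrKA.
Qed.

(* The forms by which some (M, D, eta) can be shifted without changing its class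
   are the elements of Omega_ch1. *)
Lemma ch1P w : @ch1 K A Om w <-> exists g, khat_iso (khat_shift w g) g.
Proof.
split=> [|[g [phi [psi [phiK psiK h]]]]]; last first.
  have {}h : dexact (KCS (affine_path (@kconn _ _ _ g) (pullback phi psi (@kconn _ _ _ g))) - w).
    by move: h; rewrite /= addrK.
  (* Here [w] is the secondary form of an automorphism minus an exact form. *)
  rewrite -[w](subKr (KCS (affine_path (@kconn _ _ _ g) (pullback phi psi (@kconn _ _ _ g))))).
  apply: gensubB; apply: gensub_mem; last by left.
  right; exists (kmod g), (@kconn _ _ _ g), phi, psi; split=> //; exact: kconnP.
elim=> {w} [w [e|[M [D [phi [psi [cD phiK psiK ->]]]]]]||u v _ [g hg] _ [h hh]].
- exists (khat_form (0 : Om)).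
  by apply: (@khat_iso_exact (khat_form (0 : Om))); rewrite addr0 subr0.
- exists (KhatGen cD 0), phi, psi; split=> //=.
  rewrite addr0 subr0 subrr; exact: exact0.
- exists (khat_form (0 : Om)).
  by apply: (@khat_iso_exact (khat_form (0 : Om))); rewrite addr0 subr0; exact: exact0.
exists (g +k h).
(* Shifting [hh] by - v yields an isomorphism for - v; the shifts of the two summands then add up to
   u - v. *)
have hv : khat_iso h (khat_shift (- v) h).
  apply: tr (khat_iso_shift2 (- v) hh).
  by apply: (@khat_iso_exact h); rewrite addKr subrr; exact: exact0.
have huv : khat_iso (khat_shift (u - v) (g +k h)) (khat_shift u g +k khat_shift (- v) h).
  apply: (@khat_iso_exact (g +k h)); rewrite /= addrACA subrr; exact: exact0.
exact: tr huv (ad hg (sy hv)).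
Qed.

Lemma khat_form_add u v : khat_iso (khat_form u +k khat_form v) (khat_form (u + v)).
Proof. exact: khat_iso_shift. Qed.

(** The modules on both sides coincide, so a stable isomorphism is an automorphism and u - v is its
    secondary form. One direction makes a well defined on the quotient, the other makes it
    injective. *)
Lemma hexa_geqv u v : @geqv (Khat Om) (hexa Om u) (hexa Om v) <-> @ch1 K A Om (u - v).
Proof.
split=> [/Khat_geqvE [h [phi [psi [phiK psiK e]]]]|/ch1P [g e]].
  apply/ch1P; exists (khat_form v +k khat_form (0 : Om) +k h), phi, psi; split=> //.
  have <- : kform (khat_form u +k khat_form (0 : Om) +k h) -
      kform (khat_form v +k khat_form (0 : Om) +k h) =
      kform (khat_shift (u - v) (khat_form v +k khat_form (0 : Om) +k h)) -
      kform (khat_form v +k khat_form (0 : Om) +k h).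
    by congr (_ - _); rewrite /= !addr0 addrA subrK.
  exact: e.
apply/Khat_geqvE; exists g => /=.
have h w : khat_iso (khat_form w +k khat_form (0 : Om) +k g) (khat_shift w g).
  apply: tr (ad (khat_form_add w 0) (rf g)) _; rewrite addr0.
  exact: khat_iso_shift.
apply: tr (h u) (tr _ (sy (h v))); apply: tr (khat_iso_shift2 v e).
by apply: (@khat_iso_exact g); rewrite addrA subrKC subrr; exact: exact0.
Qed.

Lemma hexa_add u v :
  @geqv (Khat Om) (hexa Om (u + v)) (gadd (hexa Om u : Khat Om) (hexa Om v)).
Proof.
apply/Khat_geqvE; apply: stablyW mon _ _ _ => /=.
apply: ad; first exact/sy/khat_form_add.
by apply: tr (khat_form_add 0 0) _; rewrite addr0; exact: rf.
Qed.

(** A shift by w adds dw to the curvature form, which is invariant under isomorphism. *)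
Lemma closedf_ch1 w : @ch1 K A Om w -> closedf w.
Proof.
move=> /ch1P [g /curvature_form_iso].
by rewrite /curvature_form /= raddfD /= addrCA addrK.
Qed.

Lemma hexI_congr (x y : Khat Om) : geqv x y -> @geqv (Kzero A) (hexI Om x) (hexI Om y).
Proof.
move/Khat_geqvE => [u [phi [psi [phiK psiK _]]]]; apply/Kzero_geqvE.
by exists (kmod u), phi, psi.
Qed.

(** A stable isomorphism of the underlying modules need not respect connections; its defect is a
    secondary form, which can be moved into the odd form. *)
Lemma hexI_kernel (y : Khat Om) : gmem y -> @geqv (Kzero A) (hexI Om y) (gzero _) ->
  exists2 w, oddf w & @geqv (Khat Om) (hexa Om w) y.
Proof.
move=> [o1 o2] /Kzero_geqvE [Z [f [g [fK gK]]]].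
have [DZ cZ] := fgpmod_has_conn Om Z; pose h := KhatGen cZ 0.
pose X w := khat_form w +k y.2 +k h; pose Y := y.1 +k khat_form (0 : Om) +k h.
pose B := KCS (affine_path (@kconn _ _ _ (X 0)) (pullback g f (@kconn _ _ _ Y))).
have oB : oddf B.
  apply: (oddf_KCS_affine charK (kconnP (X 0))).
  exact: (pullback_conn (M := kmod (X 0)) (L := kmod Y) gK (kconnP Y)).
(* The form [w] is the solution of kform (X w) - kform Y = B. *)
exists (B + kform y.1 - kform y.2); first exact/oddfB/o2/oddfD.
apply/Khat_geqvE; exists h, g, f; split=> //.
set w := B + _ - _.
have -> : kform (X w) - kform Y = B by rewrite /= !addr0 /w subrK addrK.
have : dexact (B - B) by rewrite subrr; exact: exact0.
exact.
Qed.

Lemma curvature_form_form w : curvature_form (khat_form w) = curvature_form (khat_form (0 : Om)) + ddiff Om w.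
Proof. by rewrite /curvature_form /= raddf0 addr0. Qed.

Lemma hexR_hexa w : hexR Om (hexa Om w) = ddiff Om w.
Proof.
rewrite /hexR -/(curvature_form _) -/(curvature_form _) curvature_form_form addrAC subrr.
exact: add0r.
Qed.

Lemma MK_abgroup : is_abgroup (MK Om).
Proof.
have [[m0 mN mD] G2 G3 [G4 G5 G6 G7]] := Khat_abgroup.
have m (x : MK Om) : gmem x -> @gmem (Khat Om) x by case.
split; [split=> [|x [mx hx]|x y [mx hx] [my hy]]|..].
- split=> //; rewrite /= subr0 [hexR _ _]subrr; exact: gcomm0.
- split; first exact: mN.
  move: hx => /= /gcommN; rewrite !subr0.
  by rewrite [- hexR _ _](_ : _ = hexR Om (gopp x : Khat Om)) // /hexR opprB.
- split; first exact: mD.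
  rewrite /= subr0; apply: gcomm_congr (hexR_add x y) _.
  by move: hx hy => /=; rewrite !subr0; exact: gcommD.
- have [r s t] := G2; split=> [x /m|x y /m ? /m|x y u /m ? /m ? /m]; [exact: r|exact: s|exact: t].
- have [a b] := G3; split=> [x x' y y' /m ? /m ? /m ? /m|x x' /m ? /m]; [exact: a|exact: b].
split=> [x y u /m ? /m ? /m|x y /m ? /m|x /m|x /m]; [exact: G4|exact: G5|exact: G6|exact: G7].
Qed.

Lemma Omega_ch0_abgroup : is_abgroup (Omega_ch0 Om).
Proof.
apply: form_group_abgroup; [|move=> u v|exact: gcomm0|exact: gcommB].
  split; [exact: evenf0|rewrite /closedf raddf0; exact: gcomm0|].
  exists (gzero (Kzero A)) => //=; rewrite subr0 [chK _ _]subrr; exact: exact0.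
move=> [eu cu [x _ hx]] [ev cv [y _ hy]]; split.
- exact: evenfB.
- by rewrite /closedf raddfB; exact: gcommB.
exists (gadd x (gopp y)) => //; apply: (exact_trans odE (chK_add x (gopp y))).
have -> : chK Om (gopp y) = - chK Om y by rewrite /chK opprB.
exact: exact_sub2.
Qed.

Lemma Omega_odd_ch1_abgroup : is_abgroup (Omega_odd_ch1 Om).
Proof.
apply: form_group_abgroup; [exact: oddf0|exact: oddfB|exact: gensub0|].
by move=> u v; exact: gensubB.
Qed.

Lemma HdR_even_abgroup : is_abgroup (HdR_even Om).
Proof.
apply: form_group_abgroup; [|move=> u v [eu cu] [ev cv]|exact: exact0|exact: exact_byB].
  by split; [exact: evenf0|rewrite /closedf raddf0; exact: gcomm0].
by split; [exact: evenfB|rewrite /closedf raddfB; exact: gcommB].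
Qed.

Lemma HdR_odd_abgroup : is_abgroup (HdR_odd Om).
Proof.
apply: form_group_abgroup; [|move=> u v [eu cu] [ev cv]|exact: exact0|exact: exact_byB].
  by split; [exact: oddf0|rewrite /closedf raddf0; exact: gcomm0].
by split; [exact: oddfB|rewrite /closedf raddfB; exact: gcommB].
Qed.

Lemma Khat_refl (x : Khat Om) : geqv x x.
Proof. by apply/Khat_geqvE; apply: stablyW mon _ _ _; exact: rf. Qed.

Lemma Kzero_refl (x : Kzero A) : geqv x x.
Proof. have [_ [h _ _] _ _] := Kzero_abgroup; exact: h. Qed.

Lemma hexI_hom : is_hom (hexI Om).
Proof.
split=> // [x y _ _|x y _ _]; [exact: hexI_congr|exact: Kzero_refl].
Qed.

Lemma hexR_hom : is_hom (hexR Om).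
Proof.
split=> [x|x y _ _|x y _ _]; [exact: mem_hexR|exact: hexR_congr|exact: hexR_add].
Qed.

Lemma hexa_hom : is_hom (hexa Om).
Proof.
split=> [w ow|u v _ _ /hexa_geqv //|u v _ _]; last exact: hexa_add.
by split=> //; exact: oddf0.
Qed.

Lemma mem_hex_alpha w : oddf w -> closedf w -> @gmem (MK Om) (hex_alpha Om w).
Proof.
move=> ow cw; split; first by split=> //; exact: oddf0.
by rewrite /= subr0 hexR_hexa.
Qed.

Lemma hex_alpha_hom : is_hom (hex_alpha Om).
Proof.
split=> [w [ow cw]|u v _ _ e|u v _ _]; last exact: hexa_add.
  exact: mem_hex_alpha.
by apply/hexa_geqv; apply: gensub_mem; left.
Qed.

Lemma hex_beta_hom : is_hom (hex_beta Om).
Proof.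
split=> // [x y _ _|x y _ _]; [exact: hexI_congr|exact: Kzero_refl].
Qed.

Lemma hex_r_hom : is_hom (hex_r Om).
Proof.
split=> [w []//|u v _ _ e|u v _ _].
  by apply: gensub_mem; left.
by rewrite /= subrr; exact: gensub0.
Qed.

Lemma hexPr_hom : is_hom (hexPr Om).
Proof.
split=> [w []//|u v _ _ e|u v _ _]; first exact: gcomm_exact.
by rewrite /= subrr; exact: exact0.
Qed.

Lemma chK_hom : is_hom (chK Om).
Proof.
split=> [x _|x y _ _|x y _ _]; [|exact: chK_congr|exact: chK_add].
by split; [exact: evenf_chK|exact: closedf_chK].
Qed.

Lemma hex_incl_hom : is_hom (hex_incl Om).
Proof. by split=> [x []//|//|x y _ _]; exact: Khat_refl. Qed.

Lemma hex_d_hom : is_hom (hex_d Om).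
Proof.
split=> [w ow|u v _ _ /closedf_ch1|u v _ _].
- split; [exact: evenf_ddiff|rewrite /closedf ddiffK; exact: gcomm0|].
  exists (gzero (Kzero A)) => //=; rewrite [chK _ _]subrr sub0r.
  by apply: exact_byN => //; exact: exact_ddiff.
- by rewrite /closedf raddfB.
by rewrite /= /hex_d raddfD subrr; exact: gcomm0.
Qed.

(** A primitive h of ch(y) - w is absorbed by giving the first generator the form - h. With general
    w this is surjectivity of R, with w = 0 exactness at K_0. *)
Lemma hexR_kernel_form (y : Kzero A) w : oexact (chK Om y - w) ->
  exists2 x : Khat Om, gmem x & gcomm (hexR Om x - w) /\ hexI Om x = y.
Proof.
case: y => M N [h oh hw].
exists (KhatGen (some_connP M) (- h), KhatGen (some_connP N) 0).
  by split; [exact: oddfN|exact: oddf0].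
have e (a b c d : Om) : a - b - c - d = a - c - d - b by rewrite [a - b - c]addrAC [LHS]addrAC.
split=> //; rewrite /hexR /= raddf0 addr0 raddfN /= e; exact: hw.
Qed.

Lemma short_exact_inclR : short_exact (hex_incl Om) (hexR Om).
Proof.
split=> [//|y my|y [ey cy [x _ hx]]]; last first.
  by have [z mz [hz _]] := hexR_kernel_form hx; exists z.
split=> [h|[x [mx hx] e]]; first by exists y => //; exact: Khat_refl.
move: hx; rewrite /= !subr0 => hx.
by apply: gcomm_congr hx; exact/gcomm_sym/hexR_congr.
Qed.

Lemma exact_at_aI : exact_at (hexa Om) (hexI Om).
Proof.
move=> y my; split=> [h|[w _ e]]; first exact: hexI_kernel.
have [_ [_ s _] _ _] := Kzero_abgroup.
by apply: s => //; exact: hexI_congr e.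
Qed.

Lemma short_exact_aI : short_exact (hexa Om) (hexI Om).
Proof.
split=> [w _ /hexa_geqv //|y my|[M N] _]; first exact: exact_at_aI.
exists (KhatGen (some_connP M) 0, KhatGen (some_connP N) 0).
  by split; exact: oddf0.
exact: Kzero_refl.
Qed.

(** The odd form provided by [hexI_kernel] is automatically closed, because R takes it to dw and
    vanishes on MK. *)
Lemma exact_at_alphabeta : exact_at (hex_alpha Om) (hex_beta Om).
Proof.
move=> y [my hy]; split=> [h|[w [ow cw] e]].
  have [w ow e] := hexI_kernel my h; exists w => //; split=> //.
  have := hexR_congr e; rewrite hexR_hexa => e'.
  by apply: gcomm_congr e' _; move: hy; rewrite /= subr0.
by apply/(exact_at_aI my); exists w.
Qed.

Lemma exact_at_betach : exact_at (hex_beta Om) (chK Om).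
Proof.
move=> y _; split=> [|[x [mx hx] e]].
  move=> /hexR_kernel_form [x mx [hx <-]]; exists x => //; exact: Kzero_refl.
move: hx; rewrite /= !subr0 => hx.
apply: (exact_subl odE (exact_sym odE (chK_congr e))).
by apply: (exact_subl odE (chK_hexI mx)); exact: gcomm_exact.
Qed.

Lemma exact_at_rd : exact_at (hex_r Om) (hex_d Om).
Proof.
move=> w ow; split=> [h|[v [ov cv] /closedf_ch1 e]].
  exists w; first by split=> //; move: h; rewrite /= subr0.
  by rewrite /= subrr; exact: gensub0.
rewrite /= subr0; move: e; rewrite /closedf raddfB => /gcomm_sym e.
exact: gcomm_congr e cv.
Qed.

Lemma exact_at_dPr : exact_at (hex_d Om) (hexPr Om).
Proof.
move=> y _; split=> [[h oh]|[w ow /gcomm_sym e]].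
  by rewrite subr0 => e; exists h => //; exact: gcomm_sym.
by exists w; rewrite ?subr0.
Qed.

End Hexagon.

Theorem corollary4p26 (K : fieldType) (charK : [pchar K] =i pred0)
    (A : algType K) (Om : dga A) (finOm : finite_chern Om) :
  [/\ (* the nodes are abelian groups *)
      [/\ is_abgroup (Khat Om), is_abgroup (MK Om), is_abgroup (Kzero A) &
          [/\ is_abgroup (Omega_ch0 Om), is_abgroup (Omega_odd_ch1 Om),
              is_abgroup (HdR_even Om) & is_abgroup (HdR_odd Om)]],
      (* the maps are well-defined homomorphisms *)
      [/\ is_hom (hexI Om), is_hom (hexR Om), is_hom (hexa Om) &
          is_hom (hex_alpha Om)] /\
      [/\ is_hom (hex_beta Om), is_hom (hex_r Om), is_hom (hexPr Om),
          is_hom (chK Om) & is_hom (hex_incl Om) /\ is_hom (hex_d Om)],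
      (* commutativity *)
      [/\ forall w : HdR_odd Om, gmem w ->
            geqv (hexa Om (hex_r Om w)) (hex_incl Om (hex_alpha Om w)),
          forall x : MK Om, gmem x ->
            geqv (hexI Om (hex_incl Om x)) (hex_beta Om x),
          forall w : Omega_odd_ch1 Om, gmem w ->
            geqv (hexR Om (hexa Om w)) (hex_d Om w) &
          forall x : Khat Om, gmem x ->
            geqv (hexPr Om (hexR Om x)) (chK Om (hexI Om x))] &
      (* exactness *)
      [/\ short_exact (hex_incl Om) (hexR Om),
          short_exact (hexa Om) (hexI Om),
          exact_at (hex_alpha Om) (hex_beta Om) /\
          exact_at (hex_beta Om) (chK Om) &
          exact_at (hex_r Om) (hex_d Om) /\
          exact_at (hex_d Om) (hexPr Om)]].
Proof.
split.
- split; [exact: Khat_abgroup|exact: MK_abgroup|exact: Kzero_abgroup|].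
  split; [exact: Omega_ch0_abgroup|exact: Omega_odd_ch1_abgroup|exact: HdR_even_abgroup|].
  exact: HdR_odd_abgroup.
- split; split; [exact: hexI_hom|exact: hexR_hom|exact: hexa_hom|exact: hex_alpha_hom
    |exact: hex_beta_hom|exact: hex_r_hom|exact: hexPr_hom|exact: chK_hom|].
  by split; [exact: hex_incl_hom|exact: hex_d_hom].
- split=> [w _|x _|w _|x mx].
  + exact: Khat_refl.
  + exact: Kzero_refl.
  + by rewrite hexR_hexa /= /hex_d subrr; exact: gcomm0.
  by apply: (exact_sym (oddf_lin Om)); exact: chK_hexI.
split; [exact: short_exact_inclR|exact: short_exact_aI| |].
  by split; [exact: exact_at_alphabeta|exact: exact_at_betach].
by split; [exact: exact_at_rd|exact: exact_at_dPr].
Qed.
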